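(* Let $n\ge3$, $A=(a_1,\dots,a_n)$ positive integers, $\Pi=\prod_{i=1}^n\{0,\dots,a_i\}\subset\mathbb{Z}^n$, and let tilings and flips be as in the context. (1) For any two tilings $T,T'$ there is a sequence $T=T_0\rightsquigarrow T_1\rightsquigarrow\cdots\rightsquigarrow T_k=T'$ of tilings in which consecutive ones are related by a flip. (2) Let $\mathbb{F}$ be an ordered field and let $x_I\in\mathbb{F}$ be positive elements attached to the vertices $I$ of $T$. Define values on the vertices of $T'$ by following such a sequence and, at each flip, computing the value at the new vertex from the relation $$x_{I+e_j+e_\ell}\,x_{I+e_k}=x_I\,x_{I+e_j+e_k+e_\ell}+x_{I+e_j+e_k}\,x_{I+e_\ell}+x_{I+e_k+e_\ell}\,x_{I+e_j}$$ of the flipped cube. Then the resulting values at the vertices of $T'$ do not depend on the choice of intermediate tilings $T_1,\dots,T_{k-1}$.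
   Context: Let $C=\prod_{i=1}^n[0,a_i]$ be the cubical complex with vertex set $\Pi$. Fix $0<\theta_1<\dots<\theta_n<\pi$, $v_i=(\cos\theta_i,\sin\theta_i)$, $\pi:C\to\mathbb{R}^2$, $\pi(x)=\sum x_iv_i$, and $P=\pi(C)$. A tiling is a two-dimensional subcomplex $T\subset C$ such that $\pi|_T:T\to P$ is a homeomorphism. For $I\in\Pi$ and $j<k<\ell$ with the cube $c=\{I+xe_j+ye_k+ze_\ell: x,y,z\in[0,1]\}\subset C$, the bottom faces of $c$ are its three 2-faces containing $I+e_k$ and the top faces its three 2-faces containing $I+e_j+e_\ell$. If a tiling contains the top (resp. bottom) faces of $c$, replacing them by the bottom (resp. top) faces gives another tiling; two tilings differing in this way are related by a flip. The vertex sets then differ by exchanging one element of $\{I+e_k,I+e_j+e_\ell\}$ for the other, and the displayed relation is solved for the new vertex's value (positivity ensures no division by zero). *)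

(* Defs.v *)
From HB Require Import structures.
From mathcomp Require Import all_boot all_order all_algebra.
From mathcomp Require Import all_classical all_reals all_analysis.
Set Implicit Arguments.
Unset Strict Implicit.
Unset Printing Implicit Defensive.
Import Order.TTheory GRing.Theory Num.Theory.
Import numFieldNormedType.Exports.
Local Open Scope classical_set_scope.
Local Open Scope ring_scope.

Definition homeomorphism_on (X Y : topologicalType) (A : set X) (B : set Y)
    (f : X -> Y) : Prop :=
  set_bij A B f /\ {within A, continuous f} /\
  exists g : Y -> X,
    (forall x, A x -> g (f x) = x) /\ {within B, continuous g}.

Definition basis_vec (n : nat) (j : 'I_n) : 'rV[int]_n := delta_mx ord0 j.

(* (I, S) stands for the closed face {I + \sum_(i in S) t_i e_i | 0 <= t_i <= 1}
   of the unit cubical structure on R^n; its dimension is #|S|. *)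
Definition cell (n : nat) : Type := ('rV[int]_n * {set 'I_n})%type.

Definition vertex (n : nat) (I : 'rV[int]_n) : cell n := (I, finset.set0).

Definition dim_cell (n : nat) (c : cell n) : nat := #|c.2|.

Definition in_box (n : nat) (a : 'I_n -> nat) (c : cell n) : Prop :=
  forall i, 0 <= c.1 ord0 i /\ c.1 ord0 i + (i \in c.2)%:Z <= (a i)%:Z.

(* d = (J, S') is a face of c = (I, S) when S' is included in S, J_i = I_i for i
   outside S :\: S', and J_i is I_i or I_i + 1 for i in S :\: S'. *)
Definition face_of (n : nat) (d c : cell n) : Prop :=
  d.2 \subset c.2 /\
  forall i, c.1 ord0 i <= d.1 ord0 i <= c.1 ord0 i + (i \in c.2 :\: d.2)%:Z.

Definition cell_points (R : realType) (n : nat) (c : cell n) : set 'rV[R]_n :=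
  [set p | forall i, (c.1 ord0 i)%:~R <= p ord0 i
                       <= (c.1 ord0 i + (i \in c.2)%:Z)%:~R].

Definition subcomplex (n : nat) (a : 'I_n -> nat) (T : set (cell n)) : Prop :=
  (forall c, T c -> in_box a c) /\
  (forall c d, T c -> face_of d c -> T d).

Definition two_dimensional (n : nat) (T : set (cell n)) : Prop :=
  (forall c, T c -> (dim_cell c <= 2)%N) /\ (exists c, T c /\ dim_cell c = 2%N).

Definition realization (R : realType) (n : nat) (T : set (cell n)) :
    set 'rV[R]_n :=
  [set p | exists c, T c /\ cell_points c p].

Definition box (R : realType) (n : nat) (a : 'I_n -> nat) : set 'rV[R]_n :=
  [set p | forall i, 0 <= p ord0 i <= (a i)%:R].

Definition proj (R : realType) (n : nat) (theta : 'I_n -> R) (p : 'rV[R]_n) :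
    R * R :=
  (\sum_i p ord0 i * cos (theta i), \sum_i p ord0 i * sin (theta i)).

Definition tiling (R : realType) (n : nat) (a : 'I_n -> nat)
    (theta : 'I_n -> R) (T : set (cell n)) : Prop :=
  subcomplex a T /\ two_dimensional T /\
  homeomorphism_on (@realization R n T) (proj theta @` @box R n a) (proj theta).

Definition cube (n : nat) (I : 'rV[int]_n) (j k l : 'I_n) : cell n :=
  (I, [set j; k; l]%SET).

Definition bottom_vertex (n : nat) (I : 'rV[int]_n) (j k l : 'I_n) :=
  I + basis_vec k.

Definition top_vertex (n : nat) (I : 'rV[int]_n) (j k l : 'I_n) :=
  I + basis_vec j + basis_vec l.

(* The subcomplex generated by the 2-faces of c that contain the vertex v. *)
Definition faces_at (n : nat) (c : cell n) (v : 'rV[int]_n) : set (cell n) :=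
  [set d | exists f, [/\ face_of f c, dim_cell f = 2%N,
                         face_of (vertex v) f & face_of d f]].

(* T' is obtained from T by replacing the 2-faces of c at v by those at w.  The
   two families generate subcomplexes with the same boundary hexagon, which is
   removed with the first and put back with the second. *)
Definition replaces_faces (n : nat) (c : cell n) (v w : 'rV[int]_n)
    (T T' : set (cell n)) : Prop :=
  faces_at c v `<=` T /\ T' = (T `\` faces_at c v) `|` faces_at c w.

(* The flip T ~> T' in the cube at I in directions j < k < l, removing the
   vertex v and creating the vertex w. *)
Definition flip_in (n : nat) (a : 'I_n -> nat) (I : 'rV[int]_n) (j k l : 'I_n)
    (v w : 'rV[int]_n) (T T' : set (cell n)) : Prop :=
  [/\ (j < k < l)%N,
      in_box a (cube I j k l),
      (v = bottom_vertex I j k l /\ w = top_vertex I j k l) \/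
      (v = top_vertex I j k l /\ w = bottom_vertex I j k l) &
      replaces_faces (cube I j k l) v w T T'].

Definition flip (n : nat) (a : 'I_n -> nat) (T T' : set (cell n)) : Prop :=
  exists I j k l v w, flip_in a I j k l v w T T'.

Definition flip_sequence (R : realType) (n : nat) (a : 'I_n -> nat)
    (theta : 'I_n -> R) (T T' : set (cell n)) (m : nat)
    (s : nat -> set (cell n)) : Prop :=
  [/\ s 0%N = T, s m = T',
      forall i, (i <= m)%N -> tiling a theta (s i) &
      forall i, (i < m)%N -> flip a (s i) (s i.+1)].

(* Values are functions on all of Z^n, of which only the restriction to the
   vertices of the tiling at hand is meaningful. *)
Definition flip_values (F : realFieldType) (n : nat) (a : 'I_n -> nat)
    (T T' : set (cell n)) (x x' : 'rV[int]_n -> F) : Prop :=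
  let e := @basis_vec n in
  exists I j k l v w,
    [/\ flip_in a I j k l v w T T',
        forall J, T' (vertex J) -> J <> w -> x' J = x J &
        x' w * x v = x I * x (I + e j + e k + e l)
                     + x (I + e j + e k) * x (I + e l)
                     + x (I + e k + e l) * x (I + e j)].

Definition values_along (F : realFieldType) (n : nat) (a : 'I_n -> nat)
    (m : nat) (s : nat -> set (cell n)) (x : 'rV[int]_n -> F)
    (xs : nat -> 'rV[int]_n -> F) : Prop :=
  (forall J, s 0%N (vertex J) -> xs 0%N J = x J) /\
  (forall i, (i < m)%N -> flip_values a (s i) (s i.+1) (xs i) (xs i.+1)).

(* Main.v *)
Require Import Defs.
From HB Require Import structures.
From mathcomp Require Import all_boot all_order all_algebra.
From mathcomp Require Import all_classical all_reals all_analysis.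
From mathcomp Require Import ring lra zify.
Set Implicit Arguments.
Unset Strict Implicit.
Unset Printing Implicit Defensive.
Import Order.TTheory GRing.Theory Num.Theory.
Import numFieldNormedType.Exports.
Local Open Scope classical_set_scope.
Local Open Scope ring_scope.

(* Connectivity.  A tiling is swept by monotone lattice paths from the right
   boundary of the zonogon to the left one: a path is a word in the directions,
   and as long as the word has an ascent, some ascent j k is the right side of a
   tile of the tiling, so that the path can be pushed over this tile.  Two
   ascents that are far apart commute and two adjacent ones span a hexagon, so,
   by induction on the number of non-inversions, every tiling can be flipped
   into one containing the tiles of any prescribed sweep.  A tiling containing
   a full sweep is determined by it, because the sweep covers the zonogon.

   Independence.  It is enough to extend the values on the vertices of T to a
   positive solution X of all the cube relations on the whole box: along every
   flip sequence from T one then computes the restrictions of X.  Flipping T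
   first, we may assume that the support of every vertex of T is an interval
   whose inner coordinates are full.  For such data X is built one layer of
   the last direction at a time: two consecutive layers are related by a linear
   equation (discrete Moutard equation), whose integrability condition is the
   cube relation of the first layer, and whose solutions satisfy the cube
   relation again.  This is the 4-dimensional consistency of the cube
   recurrence. *)

(** * Extension of interval data to a solution of all cube relations *)

(** Only the existence of the extension [X] matters, not its uniqueness: following flips is a
    computation inside any solution with the right initial values. Interval form leaves no
    constraint among the prescribed values: on the top layer of the last direction it becomes a
    suffix form, and peeling the lowest layer of a suffix-form problem leaves one free value, at a
    corner. Each unknown is a sum of products of positive terms divided by a positive term, so
    positivity propagates and every division is legal. Tilings are given topologically, so
    combinatorial facts are read off the projection: injectivity says which cells can coexist, and
    continuity of the inverse produces the tile beside an edge. Inside one cube the kernel of the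
    projection is a line with signs minus, plus, minus along [j < k < l]; hence bottom and top faces
    are two sheets over the same hexagon, and a flip moves points along this line. *)

(** The [z] are values of one layer on a cube with directions 1, 2, 3, the [y] those of the next
    layer; [Ey] is the linear relation of the pair 1, 2 shifted by 3. The values [y1], [y2] come
    from the pairs containing 3, and [y12] can be reached in two ways. Eliminating [z13] and [y13]
    leaves rational identities. *)
Lemma moutard_compatible (F : fieldType)
    (z z1 z2 z3 z12 z13 z23 z123 y y3 y13 y23 y123 : F) :
  z2 != 0 -> z3 != 0 -> z13 != 0 -> z23 != 0 ->
  z13 * z2 = z * z123 + z12 * z3 + z23 * z1 ->
  y13 * z23 = z3 * y123 + z123 * y3 + y23 * z13 ->
  let y1 := (z * y13 + z13 * y + y3 * z1) / z3 in
  let y2 := (z * y23 + z23 * y + y3 * z2) / z3 in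
  let y12 := (z1 * y123 + z123 * y1 + y13 * z12) / z13 in
  (z2 * y123 + z123 * y2 + y23 * z12) / z23 = y12 /\
  y1 * z2 = z * y12 + z12 * y + y2 * z1.
Proof.
move=> n2 n3 n13 n23 Ez Ey.
have Ez13 : z13 = (z * z123 + z12 * z3 + z23 * z1) / z2 by rewrite -Ez mulfK.
have Ey13 : y13 = (z3 * y123 + z123 * y3 + y23 * z13) / z23 by rewrite -Ey mulfK.
have ns : z * z123 + z12 * z3 + z23 * z1 != 0 by rewrite -Ez mulf_neq0.
move=> y1 y2 y12; rewrite /y12 /y2 /y1 Ey13 Ez13.
by split; field; rewrite ?n2 ?n3 ?n23 ?ns.
Qed.

(** A discrete Moutard transformation: the linear relations carry a solution of the cube relation to
    a solution on the next layer. *)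
Lemma moutard_transform (F : fieldType)
    (z z1 z2 z3 z12 z13 z23 z123 y y1 y2 y3 y12 y13 y23 y123 : F) :
  z2 != 0 -> z3 != 0 -> z13 != 0 -> z23 != 0 ->
  z13 * z2 = z * z123 + z12 * z3 + z23 * z1 ->
  y1 * z3 = z * y13 + z13 * y + y3 * z1 ->
  y2 * z3 = z * y23 + z23 * y + y3 * z2 ->
  y13 * z23 = z3 * y123 + z123 * y3 + y23 * z13 ->
  y12 * z13 = z1 * y123 + z123 * y1 + y13 * z12 ->
  y13 * y2 = y * y123 + y12 * y3 + y23 * y1.
Proof.
move=> n2 n3 n13 n23 Ez E1 E2 E13 E12.
have -> : y12 = (z1 * y123 + z123 * y1 + y13 * z12) / z13 by rewrite -E12 mulfK.
have -> : y1 = (z * y13 + z13 * y + y3 * z1) / z3 by rewrite -E1 mulfK.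
have -> : y2 = (z * y23 + z23 * y + y3 * z2) / z3 by rewrite -E2 mulfK.
have -> : y13 = (z3 * y123 + z123 * y3 + y23 * z13) / z23 by rewrite -E13 mulfK.
have ns : z * z123 + z12 * z3 + z23 * z1 != 0 by rewrite -Ez mulf_neq0.
have -> : z13 = (z * z123 + z12 * z3 + z23 * z1) / z2 by rewrite -Ez mulfK.
by field; rewrite ?n2 ?n3 ?n23 ?ns.
Qed.

Section LatticeBox.
Variable n : nat.
Implicit Types (J : 'rV[int]_n) (lo hi : 'I_n -> int).
Local Notation e := (@basis_vec n).

Definition ibox lo hi J := forall i, lo i <= J ord0 i <= hi i.

Definition corner_dist lo J := (\sum_i `|J ord0 i - lo i|)%N.

Lemma coord_addb J j i : (J + e j) ord0 i = J ord0 i + (i == j)%:Z.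
Proof. by rewrite !mxE eqxx natz. Qed.

Lemma coord_subb J j i : (J - e j) ord0 i = J ord0 i - (i == j)%:Z.
Proof. by rewrite !mxE eqxx natz. Qed.

End LatticeBox.

Ltac coords i :=
  rewrite ?(coord_addb, coord_subb) /=;
  repeat match goal with
  | |- context [(i == ?j)] => let E := fresh in
      case: (eqVneq i j) => [E|?]; [rewrite -?E ?eqxx /=|] => /=
  end.

Section LatticeBoxFaces.
Variable n : nat.
Implicit Types (J : 'rV[int]_n) (lo hi : 'I_n -> int).
Local Notation e := (@basis_vec n).

Lemma ibox_square lo hi J j k : ibox lo hi J -> ibox lo hi (J + e j + e k) ->
  ibox lo hi (J + e j) /\ ibox lo hi (J + e k).
Proof. by move=> B B2; split=> i; move: (B i) (B2 i); coords i; lia. Qed.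

Lemma ibox_cube lo hi J j k l : ibox lo hi J -> ibox lo hi (J + e j + e k + e l) ->
  [/\ ibox lo hi (J + e j), ibox lo hi (J + e k) & ibox lo hi (J + e l)] /\
  [/\ ibox lo hi (J + e j + e k), ibox lo hi (J + e j + e l) &
      ibox lo hi (J + e k + e l)].
Proof. by move=> B B3; split; split=> i; move: (B i) (B3 i); coords i; lia. Qed.

End LatticeBoxFaces.

Section Extension.
Variables (F : realFieldType) (n : nat).
Implicit Types (J : 'rV[int]_n) (lo hi : 'I_n -> int).
Local Notation e := (@basis_vec n).

Lemma corner_distS lo J j : (forall i, lo i <= J ord0 i) ->
  corner_dist lo (J + e j) = (corner_dist lo J).+1.
Proof.
move=> loJ; rewrite /corner_dist (bigD1 j) //= [in RHS](bigD1 j) //=.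
rewrite -addSn; congr (_ + _)%N.
  by move: (loJ j); rewrite coord_addb eqxx /=; lia.
by apply: eq_bigr => i /negbTE ij; rewrite coord_addb ij addr0.
Qed.

(** Discrete integration of a closed form: step maps that commute on every square determine a
    function from its value at the lowest corner. *)
Lemma path_integration lo hi (Phi : 'I_n -> 'rV[int]_n -> F -> F)
    (y0 : 'rV[int]_n -> F) :
  (forall J, 0 < y0 J) ->
  (forall J j y, ibox lo hi J -> ibox lo hi (J + e j) -> 0 < y ->
     0 < Phi j J y) ->
  (forall J (j k : 'I_n) y, (j < k)%N -> ibox lo hi J -> ibox lo hi (J + e j + e k) ->
     0 < y -> Phi k (J + e j) (Phi j J y) = Phi j (J + e k) (Phi k J y)) ->
  exists g : 'rV[int]_n -> F,
  [/\ forall J, ibox lo hi J -> 0 < g J,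
      forall J, (forall i, J ord0 i = lo i) -> g J = y0 J &
      forall J j, ibox lo hi J -> ibox lo hi (J + e j) ->
        g (J + e j) = Phi j J (g J)].
Proof.
move=> y0_gt0 Phi_gt0 Phi_comp.
have comp J (j k : 'I_n) y : j != k -> ibox lo hi J -> ibox lo hi (J + e j + e k) ->
    0 < y -> Phi k (J + e j) (Phi j J y) = Phi j (J + e k) (Phi k J y).
  move=> jk BJ BJ2 y_gt0; case: (ltngtP j k) => [jlk|klj|/ord_inj ejk].
  - exact: Phi_comp.
  - by rewrite -Phi_comp // addrAC.
  - by rewrite ejk eqxx in jk.
(* Descend to the corner along an arbitrarily picked direction; the fuel [N] is the distance to the
   corner. That the choice is immaterial is shown in [g_rel]. *)
pose G := fix G (N : nat) J {struct N} : F := if N is N'.+1 then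
    if [pick j | lo j < J ord0 j] is Some j then Phi j (J - e j) (G N' (J - e j))
    else y0 J else y0 J.
pose g J := G (corner_dist lo J) J.
have gS J j : ibox lo hi J -> ibox lo hi (J + e j) -> exists k, 
    [/\ lo k < (J + e j) ord0 k & g (J + e j) = Phi k (J + e j - e k) (g (J + e j - e k))].
  move=> BJ BJj; rewrite {1}/g corner_distS => [|i]; last by case/andP: (BJ i).
  rewrite /=; case: pickP => [k lok|/(_ j)]; last first.
    by move: (BJ j); rewrite coord_addb eqxx /=; lia.
  exists k; split=> //; rewrite /g; congr (Phi _ _ (G _ _)).
  apply: succn_inj; rewrite -(@corner_distS lo J j) => [|i]; last by case/andP: (BJ i).
  rewrite -(@corner_distS lo _ k) ?subrK // => i.
  have [->|kj] := eqVneq k j; first by rewrite addrK; case/andP: (BJ i).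
  by move: (BJ i) (BJj i) lok; rewrite (coord_addb _ _ k) (negbTE kj); coords i; lia.
have g_rel N J j : corner_dist lo J = N -> ibox lo hi J -> ibox lo hi (J + e j) ->
    0 < g J /\ g (J + e j) = Phi j J (g J).
  elim: N J j => [|N IH] J j JN BJ BJj.
    have Jlo i : J ord0 i = lo i.
      move: JN; rewrite /corner_dist (bigD1 i) //= => /eqP.
      by rewrite addn_eq0 => /andP[/eqP + _]; lia.
    split; first by rewrite /g JN.
    have [k [lok ->]] := gS J j BJ BJj.
    have -> : k = j; last by rewrite addrK.
    by move: lok; rewrite coord_addb Jlo; case: eqP => //=; lia.
  have gJ_gt0 : 0 < g J.
    case: (pickP [pred k | lo k < J ord0 k]) => [k /= lok|nok].
      have BJk : ibox lo hi (J - e k) by move=> i; move: (BJ i) lok; coords i; lia.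
      have := IH (J - e k) k; rewrite subrK => -[] //.
        by apply: succn_inj; rewrite -JN -(@corner_distS lo _ k) ?subrK // => i;
           case/andP: (BJk i).
      move=> gk_gt0 ->; apply: Phi_gt0 => //; by rewrite subrK.
    by rewrite /g JN /=; case: pickP => [k /=|]; rewrite ?nok //; move: (nok k) => /= ->.
  (* The value at [J + e j] was computed through the picked [k]. If [k] is not [j], compatibility on
     the square based at [J - e k] trades one for the other. *)
  split=> //; have [k [lok Eg]] := gS J j BJ BJj.
  case: (eqVneq k j) => [ekj|nkj]; first by rewrite Eg ekj addrK.
  have lok' : lo k < J ord0 k by move: lok; rewrite coord_addb (negbTE nkj) addr0.
  pose J' := J - e k.
  have JE : J = J' + e k by rewrite subrK.
  have BJ' : ibox lo hi J' by move=> i; move: (BJ i) lok'; rewrite /J'; coords i; lia.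
  have BJ'j : ibox lo hi (J' + e j).
    by move=> i; move: (BJ i) (BJj i) lok'; rewrite /J'; coords i; lia.
  have J'N : corner_dist lo J' = N.
    by apply: succn_inj; rewrite -JN -(@corner_distS lo _ k) ?subrK // => i;
       case/andP: (BJ' i).
  have [g'_gt0 Ej] := IH _ _ J'N BJ' BJ'j.
  have [_ Ek] := IH J' k J'N BJ' ltac:(by rewrite subrK).
  have E1 : J + e j - e k = J' + e j by rewrite addrAC.
  rewrite Eg E1 Ej comp //; last by rewrite JE addrAC in BJj.
    by rewrite -Ek -JE.
  by rewrite eq_sym.
exists g; split.
- move=> J BJ; case: (pickP [pred k | lo k < J ord0 k]) => [k /= lok|nok].
    have BJk : ibox lo hi (J - e k) by move=> i; move: (BJ i) lok; coords i; lia.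
    have [|gt0 E] := @g_rel _ (J - e k) k erefl BJk; first by rewrite subrK.
    by move: E; rewrite subrK => ->; apply: Phi_gt0 => //; rewrite subrK.
  rewrite /g; case: (corner_dist lo J) => //= N.
  by case: pickP => // k; move: (nok k) => /= ->.
- move=> J Jlo; rewrite /g; case: (corner_dist lo J) => //= N.
  by case: pickP => // k; rewrite Jlo ltxx.
- by move=> J j BJ BJj; have [] := @g_rel _ J j erefl BJ BJj.
Qed.

(** Miwa's discrete BKP equation, also called the cube recurrence. *)
Definition bkp (X : 'rV[int]_n -> F) J (j k l : 'I_n) :=
  X (J + e j + e l) * X (J + e k) =
    X J * X (J + e j + e k + e l) + X (J + e j + e k) * X (J + e l)
    + X (J + e k + e l) * X (J + e j).

Definition bkp_on lo hi X := forall J (j k l : 'I_n), (j < k < l)%N ->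
  ibox lo hi J -> ibox lo hi (J + e j + e k + e l) -> bkp X J j k l.

(* The cube relation for a pair of consecutive layers Z, Y of a direction larger
   than j and k; in terms of Y / Z it is the discrete Moutard equation. *)
Definition moutard (Z Y : 'rV[int]_n -> F) J (j k : 'I_n) :=
  Y (J + e j) * Z (J + e k) =
    Z J * Y (J + e j + e k) + Z (J + e j + e k) * Y J
    + Y (J + e k) * Z (J + e j).

Definition moutard_on lo hi Z Y := forall J (j k : 'I_n), (j < k)%N ->
  ibox lo hi J -> ibox lo hi (J + e j + e k) -> moutard Z Y J j k.

(** The shape of the free data for one layer: a point of interval form whose support contains the
    last direction has this form in the remaining ones. *)
Definition suffix_form lo hi J := forall i k : 'I_n, (i < k)%N ->
  lo i < J ord0 i -> J ord0 k = hi k.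

Definition interval_form lo hi J := forall i k l : 'I_n, (i < k < l)%N ->
  lo i < J ord0 i -> lo l < J ord0 l -> J ord0 k = hi k.

(** All directions after [m] are constant on the box, so [m] acts as the last one. Thinning it
    repeatedly reaches the earlier directions without changing [n]. *)
Lemma last_nondegenerate lo hi :
  (forall i, hi i <= lo i) \/
  exists m : 'I_n, lo m < hi m /\ forall i : 'I_n, (m < i)%N -> hi i <= lo i.
Proof.
case: (pickP [pred i | lo i < hi i]) => [i0 /= lt0|none]; last first.
  by left=> i; move: (none i) => /= /negbT; rewrite -leNgt.
right; case: (@arg_maxnP _ i0 [pred i | lo i < hi i] (@nat_of_ord n) lt0) => m /= ltm maxm.
exists m; split=> // i mi; rewrite leNgt; apply/negP => lti.
by move: (maxm i lti) mi; lia.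
Qed.

Definition upd (f : 'I_n -> int) (m : 'I_n) (t : int) i := if i == m then t else f i.

Definition volume lo hi := (\sum_i `|hi i - lo i|)%N.

Lemma volume_lt lo hi lo' hi' (m : 'I_n) :
  (forall i, i != m -> lo' i = lo i /\ hi' i = hi i) ->
  (`|hi' m - lo' m| < `|hi m - lo m|)%N ->
  (volume lo' hi' < volume lo hi)%N.
Proof.
move=> same lt; rewrite /volume (bigD1 m) //= [ltnRHS](bigD1 m) //=.
rewrite (eq_bigr (fun i => `|hi i - lo i|%N)); first by rewrite ltn_add2r.
by move=> i /same[-> ->].
Qed.

(** The lowest layer of the last direction [m] is peeled off. Above it the induction hypothesis
    gives [Y1]; on it the relations of the pairs [j], [m] prescribe the steps along each [j], and
    the cube relation of [Z] makes them commute. *)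
Lemma moutard_extension lo hi (Z y0 : 'rV[int]_n -> F) :
  (forall J, 0 < y0 J) -> (forall J, ibox lo hi J -> 0 < Z J) ->
  bkp_on lo hi Z ->
  exists Y, [/\ forall J, ibox lo hi J -> 0 < Y J,
    moutard_on lo hi Z Y &
    forall J, ibox lo hi J -> suffix_form lo hi J -> Y J = y0 J].
Proof.
move=> y0_gt0; have [N] := ubnP (volume lo hi).
elim: N lo hi => // N IH lo hi; rewrite ltnS => leN Z_gt0 Zrel.
case: (last_nondegenerate lo hi) => [deg|[m [ltm degm]]].
  exists y0; split=> // J j k jk BJ BJ2.
  by move: (deg k) (BJ k) (BJ2 k); rewrite !coord_addb eqxx; lia.
pose lo1 := upd lo m (lo m + 1); pose hi0 := upd hi m (lo m).
have up_m (f : 'I_n -> int) t : upd f m t m = t by rewrite /upd eqxx.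
have up_n (f : 'I_n -> int) t i : i != m -> upd f m t i = f i by rewrite /upd => /negbTE ->.
have B1P J : ibox lo1 hi J <-> ibox lo hi J /\ lo m < J ord0 m.
  split=> [B|[B lt] i]; last first.
    by move: (B i); case: (eqVneq i m) => [->|im]; rewrite /lo1 ?up_m ?up_n //; lia.
  split; last by move: (B m); rewrite /lo1 up_m; lia.
  by move=> i; move: (B i); case: (eqVneq i m) => [->|im]; rewrite /lo1 ?up_m ?up_n //; lia.
have B0P J : ibox lo hi0 J <-> ibox lo hi J /\ J ord0 m = lo m.
  split=> [B|[B lt] i]; last first.
    by move: (B i); case: (eqVneq i m) => [->|im]; rewrite /hi0 ?up_m ?up_n //; lia.
  split; last by move: (B m); rewrite /hi0 up_m; lia.
  by move=> i; move: (B i); case: (eqVneq i m) => [->|im]; rewrite /hi0 ?up_m ?up_n //; lia.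
have [||| Y1 [Y1_gt0 Y1rel Y1suf]] := IH lo1 hi.
- apply: leq_trans leN; apply: (@volume_lt lo hi lo1 hi m) => [i im|].
    by rewrite /lo1 up_n.
  by rewrite /lo1 up_m; lia.
- by move=> J /B1P[/Z_gt0].
- by move=> J j k l jkl /B1P[BJ _] /B1P[BJ2 _]; apply: Zrel.
have ltm_of J j : ibox lo hi J -> ibox lo hi (J + e j) -> (j <= m)%N.
  move=> BJ BJj; rewrite leqNgt; apply/negP => /degm.
  by move: (BJ j) (BJj j); rewrite coord_addb eqxx /=; lia.
(* The relation [moutard Z Y J j m] solved for [Y (J + e j)], with [y] in place of [Y J]. *)
pose Phi j J y := (Z J * Y1 (J + e j + e m) + Z (J + e j + e m) * y
                   + Y1 (J + e m) * Z (J + e j)) / Z (J + e m).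
have L1 J : ibox lo hi0 J -> ibox lo1 hi (J + e m).
  move=> /B0P[BJ Jm]; apply/B1P; split; last by rewrite coord_addb eqxx Jm /=; lia.
  by move=> i; move: (BJ i) Jm ltm; coords i; lia.
have L0 J : ibox lo hi0 J -> ibox lo hi J by move=> /B0P[].
have nz K : ibox lo hi K -> Z K != 0 by move=> /Z_gt0; rewrite lt0r => /andP[].
have L1' J : ibox lo1 hi J -> ibox lo hi J by move=> /B1P[].
have [||g [g_gt0 g0 grel]] := @path_integration lo hi0 Phi y0 y0_gt0.
- move=> J j y BJ BJj y_gt0; rewrite /Phi divr_gt0 ?Z_gt0 //; last exact/L1'/L1.
  by rewrite !addr_gt0 // mulr_gt0 ?Z_gt0 ?Y1_gt0 //; do ?[exact: L0 | exact: L1 | exact/L1'/L1].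
- move=> J j k y jk BJ BJ2 y_gt0.
  have [BJj BJk] := ibox_square BJ BJ2.
  have km : (k < m)%N.
    have := ltm_of (J + e j) k (L0 _ BJj) (L0 _ BJ2).
    rewrite leq_eqVlt => /orP[/eqP/ord_inj km|//].
    by case/B0P: BJ2 => _; case/B0P: BJj => _; rewrite !coord_addb km eqxx /=; lia.
  have BJm := L1 _ BJ; have BJjm := L1 _ BJj; have BJkm := L1 _ BJk.
  have BJjkm := L1 _ BJ2.
  have [||E _] := @moutard_compatible F (Z J) (Z (J + e j)) (Z (J + e k)) (Z (J + e m))
    (Z (J + e j + e k)) (Z (J + e j + e m)) (Z (J + e k + e m)) (Z (J + e j + e k + e m))
    y (Y1 (J + e m)) (Y1 (J + e j + e m)) (Y1 (J + e k + e m)) (Y1 (J + e j + e k + e m))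
    (nz _ (L0 _ BJk)) (nz _ (L1' _ BJm)) (nz _ (L1' _ BJjm)) (nz _ (L1' _ BJkm)).
  + by apply: Zrel; [rewrite jk km|exact: L0|exact: L1'].
  + have := Y1rel (J + e m) j k jk BJm; rewrite /moutard.
    rewrite ![J + e m + _]addrAC [J + e j + e m + e k]addrAC; exact.
  rewrite /Phi [J + e k + e j]addrAC -E; congr (_ / _).
pose Y J := if J ord0 m == lo m then g J else Y1 J.
have Yg J : J ord0 m = lo m -> Y J = g J by rewrite /Y => ->; rewrite eqxx.
have YY1 J : J ord0 m != lo m -> Y J = Y1 J by rewrite /Y => /negbTE ->.
have Ym J : J ord0 m = lo m -> Y (J + e m) = Y1 (J + e m).
  by move=> Jm; apply: YY1; rewrite coord_addb eqxx Jm /=; lia.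
exists Y; split.
- move=> J BJ; rewrite /Y; case: eqP => Jm; first exact/g_gt0/B0P.
  by apply/Y1_gt0/B1P; split=> //; move: (BJ m); lia.
- move=> J j k jk BJ BJ2.
  have [BJj BJk] := ibox_square BJ BJ2.
  have := ltm_of _ _ BJj BJ2; rewrite leq_eqVlt => /orP[/eqP/ord_inj km|km].
    have mj : (m == j) = false by apply/eqP => mj; move: jk; rewrite km mj ltnn.
    rewrite /moutard km; have [Jm|Jm] := eqVneq (J ord0 m) (lo m); last first.
      have lt : lo m < J ord0 m by move: (BJ m); lia.
      have := Y1rel J j m; rewrite -{1}km /moutard.
      rewrite !YY1 ?coord_addb ?eqxx ?mj //=; try lia.
      by apply=> //; apply/B1P; split=> //; rewrite -?km // !coord_addb km eqxx mj /=; lia.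
    have Jjm : (J + e j) ord0 m = lo m by rewrite coord_addb mj addr0.
    rewrite !Ym // !Yg // grel; try exact/B0P.
    by rewrite /Phi divfK // gt_eqF // Z_gt0 // -km.
  have mk : (m == k) = false by apply/eqP => mk; move: km; rewrite mk ltnn.
  have mj : (m == j) = false by apply/eqP => mj; move: (ltn_trans jk km); rewrite mj ltnn.
  rewrite /moutard; have [Jm|Jm] := eqVneq (J ord0 m) (lo m); last first.
    have := Y1rel J j k jk; rewrite /moutard.
    rewrite !YY1 ?coord_addb ?mk ?mj ?addr0 //; apply; apply/B1P; split=> //.
      by move: (BJ m); lia.
    by rewrite !coord_addb mk mj !addr0; move: (BJ m); lia.
  have lay K : ibox lo hi K -> K ord0 m = lo m -> ibox lo hi0 K by move=> *; apply/B0P.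
  have BJ0 := lay _ BJ Jm.
  have BJj0 : ibox lo hi0 (J + e j) by apply: lay => //; rewrite coord_addb mj addr0.
  have BJk0 : ibox lo hi0 (J + e k) by apply: lay => //; rewrite coord_addb mk addr0.
  have BJ20 : ibox lo hi0 (J + e j + e k).
    by apply: lay => //; rewrite !coord_addb mj mk !addr0.
  rewrite !Yg ?coord_addb ?mk ?mj ?addr0 // (grel (J + e j) k) // (grel J j) // (grel J k) //.
  (* For pairs below [m] in the lowest layer the relation was not imposed: it is the second half of
     the compatibility identity. *)
  have [||_] := @moutard_compatible F (Z J) (Z (J + e j)) (Z (J + e k)) (Z (J + e m))
    (Z (J + e j + e k)) (Z (J + e j + e m)) (Z (J + e k + e m)) (Z (J + e j + e k + e m))
    (g J) (Y1 (J + e m)) (Y1 (J + e j + e m)) (Y1 (J + e k + e m)) (Y1 (J + e j + e k + e m))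
    (nz _ BJk) (nz _ (L1' _ (L1 _ BJ0))) (nz _ (L1' _ (L1 _ BJj0))) (nz _ (L1' _ (L1 _ BJk0))).
  + by apply: Zrel; [rewrite jk km|exact: L0|exact/L1'/L1].
  + have := Y1rel (J + e m) j k jk (L1 _ BJ0); rewrite /moutard.
    by rewrite ![J + e m + _]addrAC [J + e j + e m + e k]addrAC; apply; exact: L1.
  exact.
(* In the lowest layer the corner is the only point of suffix form: an earlier coordinate above its
   minimum would force coordinate [m] to be [hi m]. *)
- move=> J BJ suf; have [Jm|Jm] := eqVneq (J ord0 m) (lo m).
    rewrite Yg //; apply: g0 => i; have [->//|im] := eqVneq i m.
    apply/eqP; case: (ltgtP (J ord0 i) (lo i)) => // [|lt]; first by move: (BJ i); lia.
    have [mi|im'] := ltnP m i; first by move: (degm i mi) (BJ i); lia.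
    have im2 : (i < m)%N by rewrite ltn_neqAle im' andbT.
    by move: (suf i m im2 lt) ltm; rewrite Jm => ->; rewrite ltxx.
  rewrite YY1 //; apply: Y1suf; first by apply/B1P; split=> //; move: (BJ m); lia.
  move=> i k ik; rewrite /lo1; have [im|im] := eqVneq i m; last by rewrite up_n //; exact: suf.
  by rewrite im up_m => lt; apply: suf ik _; rewrite im; lia.
Qed.


(** Here the top layer of the last direction is peeled off. Cube relations between the two top
    layers are Moutard relations, solvable by [moutard_extension]; those inside the top layer follow
    by [moutard_transform]. *)
Lemma bkp_extension lo hi (x0 : 'rV[int]_n -> F) : (forall J, 0 < x0 J) ->
  exists X, [/\ forall J, ibox lo hi J -> 0 < X J, bkp_on lo hi X &
    forall J, ibox lo hi J -> interval_form lo hi J -> X J = x0 J].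
Proof.
move=> x0_gt0; have [N] := ubnP (volume lo hi).
elim: N lo hi => // N IH lo hi; rewrite ltnS => leN.
case: (last_nondegenerate lo hi) => [deg|[m [ltm degm]]].
  exists x0; split=> // J j k l jkl BJ BJ2.
  by move: (deg l) (BJ l) (BJ2 l); rewrite !coord_addb eqxx; lia.
pose hi1 := upd hi m (hi m - 1); pose lo0 := upd lo m (hi m - 1).
have up_m (f : 'I_n -> int) t : upd f m t m = t by rewrite /upd eqxx.
have up_n (f : 'I_n -> int) t i : i != m -> upd f m t i = f i by rewrite /upd => /negbTE ->.
have B1P J : ibox lo hi1 J <-> ibox lo hi J /\ J ord0 m < hi m.
  split=> [B|[B lt] i]; last first.
    by move: (B i); case: (eqVneq i m) => [->|im]; rewrite /hi1 ?up_m ?up_n //; lia.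
  split; last by move: (B m); rewrite /hi1 up_m; lia.
  by move=> i; move: (B i); case: (eqVneq i m) => [->|im]; rewrite /hi1 ?up_m ?up_n //; lia.
have B0P J : ibox lo0 hi1 J <-> ibox lo hi J /\ J ord0 m = hi m - 1.
  split=> [B|[B lt] i]; last first.
    by move: (B i); case: (eqVneq i m) => [->|im]; rewrite /hi1 /lo0 ?up_m ?up_n //; lia.
  split; last by move: (B m); rewrite /hi1 /lo0 !up_m; lia.
  move=> i; move: (B i); case: (eqVneq i m) => [->|im]; rewrite /hi1 /lo0 ?up_m ?up_n //.
  by move: ltm; lia.
have [|X1 [X1_gt0 X1rel X1int]] := IH lo hi1.
  apply: leq_trans leN; apply: (@volume_lt lo hi lo hi1 m) => [i im|].
    by rewrite /hi1 up_n.
  by rewrite /hi1 up_m; lia.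
have B01 J : ibox lo0 hi1 J -> ibox lo hi1 J.
  by move=> /B0P[BJ Jm]; apply/B1P; split=> //; lia.
(* [Y] is indexed by the layer at height [hi m - 1] but stands for the values one step higher, hence
   the shift by [e m]. *)
have [|||Y [Y_gt0 Yrel Ysuf]] :=
    @moutard_extension lo0 hi1 X1 (fun J => x0 (J + e m)).
- by [].
- by move=> J /B01/X1_gt0.
- by move=> J j k l jkl /B01 BJ /B01 BJ2; apply: X1rel.
pose X J := if J ord0 m == hi m then Y (J - e m) else X1 J.
have XY J : J ord0 m = hi m - 1 -> X (J + e m) = Y J.
  by move=> Jm; rewrite /X coord_addb eqxx Jm /= subrK eqxx addrK.
have XX1 J : J ord0 m < hi m -> X J = X1 J by rewrite /X lt_neqAle => /andP[/negbTE ->].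
have ltm_of J j : ibox lo hi J -> ibox lo hi (J + e j) -> (j <= m)%N.
  move=> BJ BJj; rewrite leqNgt; apply/negP => /degm.
  by move: (BJ j) (BJj j); rewrite coord_addb eqxx /=; lia.
have top J : ibox lo hi J -> J ord0 m = hi m -> ibox lo0 hi1 (J - e m).
  move=> BJ Jm; apply/B0P; split; last by rewrite coord_subb eqxx Jm.
  by move=> i; move: (BJ i) Jm ltm; coords i; lia.
have nz K : ibox lo hi1 K -> X1 K != 0 by move=> /X1_gt0; rewrite lt0r => /andP[].
exists X; split.
- move=> J BJ; rewrite /X; case: eqP => Jm; first exact/Y_gt0/top.
  by apply/X1_gt0/B1P; split=> //; move: (BJ m); lia.
- move=> J j k l /andP[jk kl] BJ BJ3.
  have [_ [BJjk _ _]] := ibox_cube BJ BJ3.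
  have lm := ltm_of _ _ BJjk BJ3.
  have mk : (m == k) = false by apply/eqP => mk; move: kl lm; rewrite -mk; lia.
  have mj : (m == j) = false by apply/eqP => mj; move: jk kl lm; rewrite -mj; lia.
  move: lm; rewrite leq_eqVlt => /orP[/eqP/ord_inj lm|lm].
    rewrite lm in BJ3 kl *.
    have Jm : J ord0 m <= hi m - 1.
      by move: (BJ3 m); rewrite !coord_addb eqxx mk mj; lia.
    have [Jm'|Jm'] := ltP (J ord0 m) (hi m - 1).
      rewrite /bkp !XX1 ?coord_addb ?eqxx ?mk ?mj /=; try lia.
      by apply: X1rel => //; [rewrite jk kl|apply/B1P|apply/B1P]; split=> //;
         rewrite ?coord_addb ?eqxx ?mk ?mj /=; lia.
    have {Jm'}Jm : J ord0 m = hi m - 1 by lia.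
    have Jjm : (J + e j) ord0 m = hi m - 1 by rewrite coord_addb mj addr0.
    have Jkm : (J + e k) ord0 m = hi m - 1 by rewrite coord_addb mk addr0.
    have Jjkm : (J + e j + e k) ord0 m = hi m - 1 by rewrite coord_addb mk addr0.
    have lth : hi m - 1 < hi m by lia.
    rewrite /bkp !XY // !XX1 ?Jjkm ?Jjm ?Jkm ?Jm //.
    by apply: Yrel => //; apply/B0P.
  have ml : (m == l) = false by rewrite -val_eqE /= gtn_eqF.
  have [Jm|Jm] := ltP (J ord0 m) (hi m).
    rewrite /bkp !XX1 ?coord_addb ?mk ?mj ?ml ?addr0 //=.
    by apply: X1rel; [rewrite jk kl|apply/B1P|apply/B1P; split=> //;
         rewrite ?coord_addb ?ml ?mk ?mj ?addr0].
  have {}Jm : J ord0 m = hi m by move: (BJ m); lia.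
  pose K := J - e m.
  have JE : J = K + e m by rewrite subrK.
  have Km : K ord0 m = hi m - 1 by rewrite coord_subb eqxx Jm.
  have BK : ibox lo0 hi1 K by exact: top.
  have BK3 : ibox lo0 hi1 (K + e j + e k + e l).
    have -> : K + e j + e k + e l = J + e j + e k + e l - e m.
      by rewrite /K !(addrAC _ (- e m)).
    by apply: top => //; rewrite !coord_addb mj mk ml !addr0.
  have [[BKj BKk BKl] [BKjk BKjl BKkl]] := ibox_cube BK BK3.
  have jl := ltn_trans jk kl.
  rewrite /bkp JE ![K + e m + _]addrAC ![K + _ + e m + _]addrAC ![K + _ + _ + e m + _]addrAC.
  rewrite !XY ?coord_addb ?mj ?mk ?ml ?addr0 //.
  apply: (@moutard_transform F (X1 K) (X1 (K + e j)) (X1 (K + e k)) (X1 (K + e l))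
    (X1 (K + e j + e k)) (X1 (K + e j + e l)) (X1 (K + e k + e l)) (X1 (K + e j + e k + e l))).
  + exact/nz/B01.
  + exact/nz/B01.
  + exact/nz/B01.
  + exact/nz/B01.
  + by apply: X1rel; rewrite ?jk ?kl //; exact: B01.
  + exact: Yrel.
  + exact: Yrel.
  + by have := Yrel (K + e l) j k jk BKl; rewrite /moutard ![K + e l + _]addrAC
       ![K + _ + e l + _]addrAC; exact.
  + by have := Yrel (K + e j) k l kl BKj; rewrite /moutard; exact.
(* Lowering [hi m] keeps interval form, because [m] is never an inner coordinate: later directions
   are degenerate. In the top layer [m] belongs to the support, so all coordinates from the start of
   the support up to [m] are full after the first, which is suffix form. *)
- move=> J BJ int; have [Jm|Jm] := ltP (J ord0 m) (hi m).
    rewrite XX1 //; apply: X1int; first by apply/B1P.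
    move=> i k l ikl loi lol; rewrite /hi1; have [km|km] := eqVneq k m; last first.
      by rewrite up_n //; apply: int ikl _ _.
    have: (m < l)%N by case/andP: ikl => _; rewrite km.
    by move/degm; move: (BJ l) lol; lia.
  have {}Jm : J ord0 m = hi m by move: (BJ m); lia.
  rewrite -[J in LHS](subrK (e m)) XY ?coord_subb ?eqxx ?Jm // Ysuf ?subrK //.
    exact: top.
  move=> i k ik; rewrite !coord_subb /lo0 /hi1.
  have [im|im] := eqVneq i m; first by rewrite im up_m Jm /=; lia.
  have [km|km] := eqVneq k m; first by rewrite km up_m Jm.
  rewrite !up_n // !subr0 => loi; have [mk|mk] := ltnP m k.
    by move: (degm k mk) (BJ k); lia.
  by apply: (int i k m) => //; [rewrite ik ltn_neqAle km|rewrite Jm].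
Qed.

End Extension.

(** * Cells, cubes and flips *)

Section Cells.
Variable n : nat.
Implicit Types (c d f : cell n) (v w J : 'rV[int]_n).
Local Notation e := (@basis_vec n).

Lemma cell_eqP c d : (forall i, c.1 ord0 i = d.1 ord0 i) ->
  (forall i, (i \in c.2) = (i \in d.2)) -> c = d.
Proof.
case: c d => [I S] [I' S'] /= EI ES; congr pair.
  by apply/rowP => i; exact: EI.
by apply/setP => i; exact: ES.
Qed.

Lemma face_of_refl c : face_of c c.
Proof. by split=> // i; rewrite lexx ler_wpDr. Qed.

Lemma face_of_trans d c f : face_of d c -> face_of c f -> face_of d f.
Proof.
move=> [sdc dc] [scf cf]; split; first exact: fintype.subset_trans scf.
move=> i; move: (dc i) (cf i); rewrite !inE.
case: (boolP (i \in c.2)) => ic; case: (boolP (i \in d.2)) => id /=.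
- by lia.
- by rewrite (fintype.subsetP scf _ ic) /=; lia.
- by rewrite (fintype.subsetP sdc _ id) in ic.
- by case: (i \in f.2) => /=; lia.
Qed.

Lemma vertex_faceP v c : face_of (vertex v) c <->
  forall i, c.1 ord0 i <= v ord0 i <= c.1 ord0 i + (i \in c.2)%:Z.
Proof.
split=> [[_ +] i|H]; first by move=> /(_ i) /=; rewrite finset.setD0.
by split=> [|i]; rewrite /= ?finset.sub0set // finset.setD0.
Qed.

Definition opposite c v w := forall i,
  if i \in c.2 then (v ord0 i == c.1 ord0 i) && (w ord0 i == c.1 ord0 i + 1)
                 || (v ord0 i == c.1 ord0 i + 1) && (w ord0 i == c.1 ord0 i)
  else (v ord0 i == c.1 ord0 i) && (w ord0 i == c.1 ord0 i).

Lemma opposite_sym c v w : opposite c v w -> opposite c w v.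
Proof. by move=> op i; move: (op i); case: (i \in c.2); lia. Qed.

Lemma opposite_vertex c v w : opposite c v w -> face_of (vertex v) c.
Proof. by move=> op; apply/vertex_faceP => i; move: (op i); case: (i \in c.2) => /=; lia. Qed.

Lemma cube_opposite J (j k l : 'I_n) : (j < k < l)%N ->
  opposite (cube J j k l) (bottom_vertex J j k l) (top_vertex J j k l).
Proof.
move=> /andP[jk kl] i; rewrite /bottom_vertex /top_vertex /cube /= !inE !coord_addb.
have [->|ij] := eqVneq i j.
  have -> : (j == k) = false by rewrite -val_eqE /= ltn_eqF.
  have -> : (j == l) = false by rewrite -val_eqE /= ltn_eqF // (ltn_trans jk).
  by rewrite /=; lia.
have [->|ik] := eqVneq i k; last by case: eqP => /=; lia.
have -> : (k == l) = false by rewrite -val_eqE /= ltn_eqF.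
by rewrite /=; lia.
Qed.

Lemma card_cube (J : 'rV[int]_n) (j k l : 'I_n) : (j < k < l)%N ->
  #|(cube J j k l).2| = 3%N.
Proof.
move=> /andP[jk kl]; rewrite /cube /= finset.setUC cardsU1 cards2 !inE.
have -> : (l == j) = false by rewrite -val_eqE /= gtn_eqF // (ltn_trans jk).
have -> : (l == k) = false by rewrite -val_eqE /= gtn_eqF.
by have -> : (j == k) = false by rewrite -val_eqE /= ltn_eqF.
Qed.

(** A 2-face of a 3-cube at [v] is the cube with one direction [i] frozen at the coordinate of [v];
    its faces are the faces of the cube that are frozen there too. *)
Lemma faces_atP c v d : #|c.2| = 3%N -> face_of (vertex v) c ->
  faces_at c v d <-> face_of d c /\ exists2 i, i \in c.2 &
    (i \notin d.2) && (d.1 ord0 i == v ord0 i).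
Proof.
move=> c3 vc; split=> [[f [fc f2 vf df]]|[dc [i ic /andP[id /eqP di]]]].
  split; first exact: face_of_trans df fc.
  have [|i ic ifN] := @fintype.subsetPn _ (mem c.2) (mem f.2) _.
    by apply/negP => /subset_leq_card; rewrite c3 -[#|_|]/(dim_cell f) f2.
  exists i => //; have idN : i \notin d.2.
    by apply: contra ifN; case: df => /fintype.subsetP + _; apply.
  rewrite idN /=; move/vertex_faceP: vf => /(_ i).
  by case: df => _ /(_ i); rewrite inE (negbTE ifN) andbF /= => ? ?; lia.
pose f : cell n := (\row_i' if i' == i then v ord0 i else c.1 ord0 i', c.2 :\ i).
have ci : c.1 ord0 i <= v ord0 i <= c.1 ord0 i + 1.
  by move/vertex_faceP: vc => /(_ i); rewrite ic.
exists f; split.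
- split=> [|i']; first exact: finset.subsetDl.
  rewrite /f /= mxE !inE; have [->|ii] := eqVneq i' i; first by rewrite ic.
  by case: (i' \in c.2) => /=; lia.
- by apply: succn_inj; rewrite -c3 (cardsD1 i) ic.
- apply/vertex_faceP => i'; rewrite /f /= mxE !inE.
  have [->|ii] := eqVneq i' i => /=; first by lia.
  by move/vertex_faceP: vc => /(_ i').
- case: dc => sdc dc; split=> [|i'].
    apply/fintype.subsetP => i' i'd; rewrite !inE (fintype.subsetP sdc _ i'd) andbT.
    by apply: contraNneq id => <-.
  rewrite /f /= mxE !inE; have [->|ii] := eqVneq i' i; last by move: (dc i'); rewrite inE.
  by rewrite id di /=; lia.
Qed.

(** Missing [v] means being frozen in some direction of [c] away from [v], that is, at the
    coordinate of [w]. In particular the boundary hexagon belongs to both families. *)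
Lemma faces_at_opposite c v w d : #|c.2| = 3%N -> opposite c v w -> 
  face_of d c -> ~ face_of (vertex v) d -> faces_at c w d.
Proof.
move=> c3 op dc vd; apply/faces_atP => //; first exact/opposite_vertex/opposite_sym/op.
split=> //; have [i /negP vi] : exists i, ~ (d.1 ord0 i <= v ord0 i <= d.1 ord0 i + (i \in d.2)%:Z).
  by apply: contrapT => /forallNP nv; apply: vd; apply/vertex_faceP => i; apply: contrapT; exact: nv.
move: (op i); case: dc => sdc /(_ i); rewrite inE.
case: (boolP (i \in c.2)) => ic; last first.
  by case: (boolP (i \in d.2)) vi => [/(fintype.subsetP sdc)|] /=; rewrite ?(negbTE ic) //=; lia.
by rewrite /= => dci opi; exists i => //; move: vi dci opi; case: (i \in d.2) => /=; lia.
Qed.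

Lemma face_of_vertexP J d : face_of d (vertex J) -> d = vertex J.
Proof.
move=> [sd dJ]; have d0 i : (i \in d.2) = false.
  by apply: contraTF sd => id; apply/fintype.subsetPn; exists i => //; rewrite inE.
by apply: cell_eqP => i; [move: (dJ i)|]; rewrite /= !inE ?d0 // andbF /=; lia.
Qed.

Lemma faces_at_face c v d d' : faces_at c v d -> face_of d' d -> faces_at c v d'.
Proof. by move=> [f [fc f2 vf df]] dd; exists f; split=> //; exact: face_of_trans df. Qed.

Lemma faces_at_vertex c v w J : #|c.2| = 3%N -> opposite c v w ->
  face_of (vertex J) c -> J <> w -> faces_at c v (vertex J).
Proof.
move=> c3 op Jc Jw; apply: faces_at_opposite Jc _ => //; first exact: opposite_sym op.
by move=> /face_of_vertexP[] /esym.
Qed.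

End Cells.

(** * Values carried along flips *)

Section FlipValues.
Variables (F : realFieldType) (n : nat) (a : 'I_n -> nat).
Implicit Types (T : set (cell n)) (J : 'rV[int]_n).
Local Notation e := (@basis_vec n).

Lemma flip_opposite J (j k l : 'I_n) v w T T' : flip_in a J j k l v w T T' ->
  #|(cube J j k l).2| = 3%N /\ opposite (cube J j k l) v w.
Proof.
case=> jkl _ vw _; split; first exact: card_cube.
by case: vw => [[-> ->]|[-> ->]]; [|apply: opposite_sym]; apply: cube_opposite.
Qed.

Lemma flip_vertex J (j k l : 'I_n) v w T T' K :
  flip_in a J j k l v w T T' -> K <> w -> K <> v ->
  T (vertex K) <-> T' (vertex K).
Proof.
move=> fl; have [c3 op] := flip_opposite fl; case: fl => _ _ _ [sub ->] Kw Kv.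
split=> [TK|[[]//|fw]].
  have [fK|fK] := pselect (faces_at (cube J j k l) v (vertex K)); last by left.
  right; apply: faces_at_vertex Kv; first by [].
    exact: opposite_sym op.
  by case/(faces_atP _ c3 (opposite_vertex op)): fK.
apply: sub; apply: faces_at_vertex Kw => //.
by case/(faces_atP _ c3 (opposite_vertex (opposite_sym op))): fw.
Qed.

Lemma flip_old_vertex J (j k l : 'I_n) v w T T' K :
  flip_in a J j k l v w T T' -> face_of (vertex K) (cube J j k l) -> K <> w ->
  T (vertex K).
Proof.
move=> fl; have [c3 op] := flip_opposite fl; case: fl => _ _ _ [sub _] Kc Kw.
by apply: sub; apply: faces_at_vertex Kw.
Qed.

Lemma flip_new_vertex J (j k l : 'I_n) v w T T' :
  flip_in a J j k l v w T T' -> T' (vertex w).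
Proof.
move=> fl; have [c3 op] := flip_opposite fl; case: fl => _ _ _ [_ ->]; right.
have Ewv : w <> v.
  case: (pickP (mem (cube J j k l).2)) => [i /= ic|/eq_card0]; last by rewrite c3.
  by move=> E; move: (op i); rewrite E ic; lia.
apply: faces_at_vertex Ewv => //; first exact: opposite_sym op.
exact/opposite_vertex/opposite_sym/op.
Qed.

Lemma flip_vw J (j k l : 'I_n) v w T T' : flip_in a J j k l v w T T' -> v <> w.
Proof.
move=> fl; have [c3 op] := flip_opposite fl.
case: (pickP (mem (cube J j k l).2)) => [i /= ic|/eq_card0]; last by rewrite c3.
by move=> E; move: (op i); rewrite E ic; lia.
Qed.

(* The six vertices of the cube on the common boundary of its top and bottom. *)
Lemma cube_hexagon J (j k l : 'I_n) v w T T' K : flip_in a J j k l v w T T' ->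
  K \in [:: J; J + e j + e k + e l; J + e j + e k; J + e l; J + e k + e l; J + e j] ->
  [/\ face_of (vertex K) (cube J j k l), K <> v & K <> w].
Proof.
case=> /andP[jk kl] _ vw _ KJ.
have njk : (j == k) = false by rewrite -val_eqE /= ltn_eqF.
have nkl : (k == l) = false by rewrite -val_eqE /= ltn_eqF.
have njl : (j == l) = false by rewrite -val_eqE /= ltn_eqF // (ltn_trans jk).
have [nkj nlk nlj] : [/\ (k == j) = false, (l == k) = false & (l == j) = false].
  by split; rewrite eq_sym.
have [Kc Kb Kt] : [/\ face_of (vertex K) (cube J j k l),
    K <> bottom_vertex J j k l & K <> top_vertex J j k l].
  split.
  - apply/vertex_faceP => i; move: KJ; rewrite /cube /= !inE.
    by do 5?[case/orP => [/eqP ->|]]; last move=> /eqP ->; rewrite ?coord_addb;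
       have [Ei|] := eqVneq i j; have [Ei'|] := eqVneq i k; have [Ei''|] := eqVneq i l;
       subst; rewrite ?eqxx ?njk ?nkl ?njl //= in njk nkl njl *; lia.
  - move=> KE; move: KJ; rewrite KE /bottom_vertex !inE.
    have coordE (A B : 'rV[int]_n) i : A = B -> A ord0 i = B ord0 i by move=> ->.
    by do 5?[case/orP]; move=> /eqP E; move: (coordE _ _ j E) (coordE _ _ k E) (coordE _ _ l E);
      rewrite ?coord_addb ?eqxx ?nkj ?nlk ?nlj ?njk ?nkl ?njl /=; lia.
  - move=> KE; move: KJ; rewrite KE /top_vertex !inE.
    have coordE (A B : 'rV[int]_n) i : A = B -> A ord0 i = B ord0 i by move=> ->.
    by do 5?[case/orP]; move=> /eqP E; move: (coordE _ _ j E) (coordE _ _ k E) (coordE _ _ l E);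
      rewrite ?coord_addb ?eqxx ?nkj ?nlk ?nlj ?njk ?nkl ?njl /=; lia.
by case: vw => [[-> ->]|[-> ->]].
Qed.

Local Notation zero := (fun=> 0 : int).
Local Notation top := (fun i => (a i)%:Z).

Lemma in_box_vertex c K : in_box a c -> face_of (vertex K) c -> ibox zero top K.
Proof. by move=> ac /vertex_faceP Kc i; move: (ac i) (Kc i); lia. Qed.

Definition hexagon_rhs (x : 'rV[int]_n -> F) J (j k l : 'I_n) :=
  x J * x (J + e j + e k + e l) + x (J + e j + e k) * x (J + e l)
  + x (J + e k + e l) * x (J + e j).

Lemma hexagon_rhs_eq (x y : 'rV[int]_n -> F) J (j k l : 'I_n) v w T T' :
  flip_in a J j k l v w T T' ->
  (forall K, face_of (vertex K) (cube J j k l) -> K <> v -> K <> w -> x K = y K) ->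
  hexagon_rhs x J j k l = hexagon_rhs y J j k l.
Proof.
move=> fl xy; have E K : K \in [:: J; J + e j + e k + e l; J + e j + e k; J + e l;
    J + e k + e l; J + e j] -> x K = y K.
  by move=> /(cube_hexagon fl)[]; exact: xy.
by rewrite /hexagon_rhs !E // !inE eqxx ?orbT.
Qed.

(** The product on the left is symmetric in the bottom and top vertices, so one relation serves both
    directions of the flip. *)
Lemma bkp_flip X J (j k l : 'I_n) v w T T' : bkp_on zero top X ->
  flip_in a J j k l v w T T' -> X w * X v = hexagon_rhs X J j k l.
Proof.
move=> HX fl; have [|Jc _ _] := cube_hexagon fl (K := J); first by rewrite inE eqxx.
have [|Jc' _ _] := cube_hexagon fl (K := J + e j + e k + e l).
  by rewrite !inE eqxx ?orbT.
case: fl => jkl bx vw _.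
have := HX J j k l jkl (in_box_vertex bx Jc) (in_box_vertex bx Jc').
by rewrite /bkp -/(hexagon_rhs X J j k l) => <-; case: vw => [[-> ->]|[-> ->]] //; rewrite mulrC.
Qed.

Section Solution.
Variable X : 'rV[int]_n -> F.
Hypothesis X_gt0 : forall K, ibox zero top K -> 0 < X K.
Hypothesis X_bkp : bkp_on zero top X.

Lemma solution_neq0 J (j k l : 'I_n) v w T T' : flip_in a J j k l v w T T' ->
  X v != 0 /\ X w != 0.
Proof.
move=> fl; have [_ op] := flip_opposite fl; case: fl => _ bx _ _.
have nz u u' : opposite (cube J j k l) u u' -> X u != 0.
  by move=> /opposite_vertex uc; rewrite gt_eqF // X_gt0 //; exact: in_box_vertex uc.
by split; [exact: nz op | exact/nz/opposite_sym/op].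
Qed.

Lemma flip_values_solution T T' x x' : flip_values a T T' x x' ->
  (forall K, T (vertex K) -> x K = X K) -> forall K, T' (vertex K) -> x' K = X K.
Proof.
move=> [J [j [k [l [v [w [fl xw rel]]]]]]] xX K TK.
have vT : T (vertex v).
  apply: (flip_old_vertex fl); last exact: flip_vw fl.
  by have [_ /opposite_vertex] := flip_opposite fl.
have [nv _] := solution_neq0 fl.
have [Kw|Kw] := pselect (K = w).
  rewrite Kw; apply: (mulIf nv); rewrite (bkp_flip X_bkp fl) -{1}(xX v vT) rel.
  apply: (hexagon_rhs_eq fl) => L Lc Lv Lw; apply: xX; exact: flip_old_vertex fl _ _.
rewrite xw // xX //; have [->//|Kv] := pselect (K = v).
exact/(flip_vertex fl Kw Kv).
Qed.

(** Were [w] already a vertex of [T], its old value would be overwritten and lost. Otherwise [v]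
    carries the only value to recover, and the relation divided by [X w] gives it. *)
Lemma flip_values_solution_back T T' x x' : flip_values a T T' x x' ->
  (forall J j k l v w, flip_in a J j k l v w T T' -> ~ T (vertex w)) ->
  (forall K, T' (vertex K) -> x' K = X K) -> forall K, T (vertex K) -> x K = X K.
Proof.
move=> [J [j [k [l [v [w [fl xw rel]]]]]]] /(_ _ _ _ _ _ _ fl) Tw xX K TK.
have Kw : K <> w by move=> Kw; apply: Tw; rewrite -Kw.
have x_of L : T (vertex L) -> L <> v -> x L = X L.
  move=> TL Lv; have Lw : L <> w by move=> Lw; apply: Tw; rewrite -Lw.
  have TL' : T' (vertex L) by apply/(flip_vertex fl Lw Lv).
  by rewrite -xX // xw.
have [Kv|/(x_of _ TK)//] := pselect (K = v).
have [_ nw] := solution_neq0 fl.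
rewrite Kv; apply: (mulfI nw); rewrite (bkp_flip X_bkp fl).
rewrite -{1}(xX w (flip_new_vertex fl)) rel.
by apply: (hexagon_rhs_eq fl) => L Lc Lv Lw; apply: x_of => //; exact: flip_old_vertex fl _ _.
Qed.

End Solution.

(** The new value is a sum of products of positive values divided by a positive one, so the next
    flip can divide as well. *)
Lemma flip_values_exist T T' (x : 'rV[int]_n -> F) : flip a T T' ->
  (forall K, T (vertex K) -> 0 < x K) ->
  exists x', flip_values a T T' x x' /\ forall K, T' (vertex K) -> 0 < x' K.
Proof.
move=> [J [j [k [l [v [w fl]]]]]] x_gt0.
have vT : T (vertex v).
  apply: (flip_old_vertex fl); last exact: flip_vw fl.
  by have [_ /opposite_vertex] := flip_opposite fl.
exists (fun K => if K == w then hexagon_rhs x J j k l / x v else x K); split.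
  exists J, j, k, l, v, w; split=> //.
    by move=> K _ /eqP/negbTE ->.
  by rewrite eqxx divfK // gt_eqF // x_gt0.
move=> K TK; case: eqP => Kw.
  have xh L : L \in [:: J; J + e j + e k + e l; J + e j + e k; J + e l;
      J + e k + e l; J + e j] -> 0 < x L.
    by move=> /(cube_hexagon fl)[Lc _ Lw]; apply: x_gt0; exact: flip_old_vertex fl _ _.
  by rewrite divr_gt0 ?x_gt0 // !addr_gt0 // mulr_gt0 // xh // !inE eqxx ?orbT.
apply: x_gt0; have [->//|Kv] := pselect (K = v).
exact/(flip_vertex fl Kw Kv).
Qed.

Lemma values_along_exist m (s : nat -> set (cell n)) (x : 'rV[int]_n -> F) :
  (forall i, (i < m)%N -> flip a (s i) (s i.+1)) ->
  (forall K, s 0%N (vertex K) -> 0 < x K) ->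
  exists xs, values_along a m s x xs /\
    forall K, s m (vertex K) -> 0 < xs m K.
Proof.
move=> + x_gt0; elim: m => [|m IH] fl; first by exists (fun=> x); split.
have [|xs [[xs0 xsS] xs_gt0]] := IH; first by move=> i im; apply: fl; exact: ltnW.
have [x' [fv x'_gt0]] := flip_values_exist (fl m (ltnSn m)) xs_gt0.
exists (fun i => if (i <= m)%N then xs i else x'); split; last by rewrite ltnn.
split=> // i; rewrite ltnS => im; rewrite im.
by move: im; rewrite leq_eqVlt => /orP[/eqP ->|im]; rewrite ?ltnn // im; exact: xsS.
Qed.

Lemma values_along_solution (X : 'rV[int]_n -> F) m (s : nat -> set (cell n)) x xs :
  (forall K, ibox zero top K -> 0 < X K) -> bkp_on zero top X ->
  values_along a m s x xs -> (forall K, s 0%N (vertex K) -> x K = X K) ->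
  forall K, s m (vertex K) -> xs m K = X K.
Proof.
move=> X_gt0 HX [xs0 xsS] xX; elim: m xsS => [|m IH] xsS.
  by move=> K sK; rewrite xs0 // xX.
apply: (flip_values_solution X_gt0 HX (xsS m (ltnSn m))).
by apply: IH => i im; apply: xsS; exact: ltnW.
Qed.

Lemma values_along_solution_back (X : 'rV[int]_n -> F) m (s : nat -> set (cell n)) x
    xs :
  (forall K, ibox zero top K -> 0 < X K) -> bkp_on zero top X ->
  values_along a m s x xs ->
  (forall i, (i < m)%N -> forall J j k l v w,
     flip_in a J j k l v w (s i) (s i.+1) -> ~ s i (vertex w)) ->
  (forall K, s m (vertex K) -> xs m K = X K) ->
  forall K, s 0%N (vertex K) -> x K = X K.
Proof.
move=> X_gt0 HX [xs0 xsS]; elim: m xsS => [|m IH] xsS sw xsX.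
  by move=> K sK; rewrite -xs0 // xsX.
apply: IH => [i im|i im|]; [apply: xsS; exact: ltnW|apply: sw; exact: ltnW|].
exact: flip_values_solution_back (xsS m (ltnSn m)) (sw m (ltnSn m)) xsX.
Qed.

End FlipValues.

(** * Realizations and carriers *)

Section CompactHomeomorphism.
Variables (R : realType) (n : nat).
Local Notation rV := 'rV[R]_n.

Lemma within_continuous_coord (g : R * R -> rV) (B : set (R * R)) x (delta : R) :
  {within B, continuous g} -> B x -> 0 < delta ->
  exists2 eps, 0 < eps & forall y, B y -> `|x.1 - y.1| < eps -> `|x.2 - y.2| < eps ->
    forall i, `|g x ord0 i - g y ord0 i| < delta.
Proof.
move=> /subspace_continuousP gc Bx d_gt0.
have /(gc x Bx) : nbhs (g x) (ball (g x) delta) by exact: nbhsx_ballx.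
rewrite /= /within /= => /nbhs_ballP[eps /= e_gt0 H].
exists eps => // y By y1 y2 i.
by have [|_ /(_ ord0 i)] := H y _ By; first by split.
Qed.

(** A continuous bijection from a compact set to a Hausdorff space is closed: the preimage of a
    closed set under the inverse is a compact image. *)
Lemma homeomorphism_on_compact (A : set rV) (B : set (R * R)) (f : rV -> R * R) :
  compact A -> continuous f -> set_bij A B f -> homeomorphism_on A B f.
Proof.
move=> cA cf bij; split=> //; split; first exact: continuous_subspaceT.
have [fAB finj fsurj] := bij.
pose g y := xget 0 [set x | A x /\ f x = y].
have gP y : B y -> A (g y) /\ f (g y) = y.
  by move=> /fsurj[x Ax <-]; apply: (@xgetPex _ 0 [set x' | A x' /\ f x' = f x]); exists x.
exists g; split=> [x Ax|].
  have [Ag fg] := gP (f x) (fAB _ Ax); apply: finj => //; exact: mem_set.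
apply/continuous_closedP => D cD; apply/closed_subspaceP.
exists (f @` (A `&` D)).
  apply: compact_closed; first exact: norm_hausdorff.
  apply: continuous_compact; first exact: continuous_subspaceT.
  exact: compact_closedI.
apply/seteqP; split=> [y [[x [Ax Dx] <-] By]|y [Dy By]].
  split=> //; have [Ag fg] := gP (f x) By; change (D (g (f x))).
  have -> // : g (f x) = x by apply: finj => //; exact: mem_set.
by split=> //; have [Ag fg] := gP y By; exists (g y).
Qed.

Lemma compact_cell (c : cell n) : compact (@cell_points R n c).
Proof.
have := @rV_compact R n (fun i => `[(c.1 ord0 i)%:~R, (c.1 ord0 i + (i \in c.2)%:Z)%:~R]%classic).
have -> : [set v : rV | forall i, `[(c.1 ord0 i)%:~R,
    (c.1 ord0 i + (i \in c.2)%:Z)%:~R]%classic (v ord0 i)] = cell_points c.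
  by apply/seteqP; split=> v /= Hv i; move: (Hv i); rewrite /= in_itv.
by apply=> i; exact: segment_compact.
Qed.

Lemma compact_realization (a : 'I_n -> nat) (T : set (cell n)) :
  (forall c, T c -> in_box a c) -> compact (@realization R n T).
Proof.
(* Corners of cells in the box have coordinates at most [N], so the realization is a union over a
   finite type of compact cells. *)
move=> Ta; pose N := \max_i a i.
pose mk (x : {ffun 'I_n -> 'I_N.+1} * {set 'I_n}) : cell n :=
  (\row_i (nat_of_ord (x.1 i))%:Z, x.2).
have -> : @realization R n T =
    \big[setU/set0]_(x | `[< T (mk x) >]) cell_points (mk x).
  apply/seteqP; split=> p.
    move=> [c [Tc pc]]; pose x := ([ffun i => inord `|c.1 ord0 i|%N], c.2)
      : {ffun 'I_n -> 'I_N.+1} * {set 'I_n}.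
    have cE : c = mk x.
      apply: cell_eqP => i //; rewrite /mk /x /= mxE ffunE inordK.
        by case: (Ta c Tc i); lia.
      have : (a i <= N)%N by exact: leq_bigmax.
      by case: (Ta c Tc i); lia.
    rewrite -bigcup_seq_cond; exists x; last by rewrite -cE.
    by rewrite /= mem_index_enum -cE; apply/asboolP.
  by rewrite -bigcup_seq_cond => -[x /andP[_ /asboolP Tx] px]; exists (mk x).
by apply: bigsetU_compact => x _; exact: compact_cell.
Qed.

End CompactHomeomorphism.

Section Projection.
Variables (R : realType) (n : nat).
Implicit Types (p q : 'rV[R]_n) (u : 'I_n -> R).

Definition lin u p : R := \sum_i p ord0 i * u i.

Lemma linD u p q : lin u (p + q) = lin u p + lin u q.
Proof. by rewrite -big_split; apply: eq_bigr => i _; rewrite mxE mulrDl. Qed.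

Lemma linN u p : lin u (- p) = - lin u p.
Proof. by rewrite -sumrN; apply: eq_bigr => i _; rewrite mxE mulNr. Qed.

Lemma linZ u t p : lin u (t *: p) = t * lin u p.
Proof. by rewrite mulr_sumr; apply: eq_bigr => i _; rewrite mxE mulrA. Qed.

Lemma lin0 u : lin u 0 = 0.
Proof. by rewrite /lin big1 // => i _; rewrite mxE mul0r. Qed.

Lemma lin_delta u i : lin u (delta_mx ord0 i) = u i.
Proof.
rewrite /lin (bigD1 i) //= big1 ?addr0 => [|j ji]; first by rewrite mxE !eqxx mul1r.
by rewrite mxE (negbTE ji) andbF mul0r.
Qed.

Lemma lin_continuous u : continuous (lin u).
Proof.
apply: continuous_big => [|i _ p]; first exact: add_continuous.
apply: (@cvgM R _ (nbhs p) _ (fun q : 'rV[R]_n => q ord0 i) (fun=> u i)).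
  exact: (@coord_continuous R 1 n ord0 i p).
exact: cvg_cst.
Qed.

Lemma proj_continuous (theta : 'I_n -> R) : continuous (Defs.proj theta).
Proof.
move=> p.
have -> : Defs.proj theta =
  fun q => (lin (fun i => cos (theta i)) q, lin (fun i => sin (theta i)) q) by [].
apply: (@cvg_pair _ _ _ (nbhs p) (nbhs _) (nbhs _)).
- exact: (@lin_continuous (fun i => cos (theta i))).
- exact: (@lin_continuous (fun i => sin (theta i))).
Qed.

Definition rvec (v : 'rV[int]_n) : 'rV[R]_n := map_mx intr v.

(** The cell whose relative interior contains [p], hence the smallest cell containing it. It turns
    statements about points of a realization into statements about cells. *)
Definition carrier p : cell n :=
  (\row_i Num.floor (p ord0 i), [set i | (Num.floor (p ord0 i))%:~R != p ord0 i]%SET).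

Lemma carrier_points p : cell_points (carrier p) p.
Proof.
move=> i; rewrite /carrier /= !mxE inE; have /andP[le lt] := floor_itv (p ord0 i).
rewrite le /=; case: eqP => [E|_] /=; first by rewrite addr0 E.
exact: ltW.
Qed.

Lemma carrier_face (c : cell n) p : cell_points c p -> face_of (carrier p) c.
Proof.
move=> pc; have sub i : i \in (carrier p).2 -> i \in c.2.
  rewrite inE; apply: contraR => ic; move: (pc i); rewrite (negbTE ic) addr0.
  by rewrite -eq_le => /eqP <-; rewrite floorK // intr_int.
split=> [|i]; first exact/fintype.subsetP.
have /andP[le1 le2] := pc i; rewrite !inE mxE floor_ge_int le1 /=.
have /andP[fle flt] := floor_itv (p ord0 i).
case: eqP => [E|/eqP ne] /=; first by rewrite -(ler_int R) E.
rewrite addr0 -ltzD1 -(ltr_int R); apply: lt_le_trans (_ : p ord0 i <= _).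
  by rewrite lt_neqAle ne.
apply: le_trans le2 _; rewrite ler_int lerD2l; by case: (i \in c.2).
Qed.

Lemma carrier_eq (c : cell n) p :
  (forall i, if i \in c.2 then (c.1 ord0 i)%:~R < p ord0 i < (c.1 ord0 i + 1)%:~R
             else p ord0 i == (c.1 ord0 i)%:~R) -> carrier p = c.
Proof.
move=> H; have E i : Num.floor (p ord0 i) = c.1 ord0 i.
  apply/eqP; rewrite floor_eq; move: (H i); case: ifP => _.
    by move=> /andP[/ltW -> ->].
  by move=> /eqP ->; rewrite lexx /= ltr_int ltzD1.
apply: cell_eqP => i; rewrite /carrier /= ?mxE // inE E.
by move: (H i); case: ifP => _ => [/andP[/lt_eqF ->]|/eqP ->] //; rewrite eqxx.
Qed.

Lemma face_points (d c : cell n) p : face_of d c -> cell_points d p -> cell_points c p.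
Proof.
move=> [/fintype.subsetP sdc dc] pd i; move: (dc i) (pd i) => /andP[d1 d2] /andP[p1 p2].
apply/andP; split; first by apply: le_trans p1; rewrite ler_int.
apply: le_trans p2 _; rewrite ler_int; move: d1 d2; rewrite inE.
case: (boolP (i \in d.2)) => [/sdc ->|_] /=; first by lia.
by case: (i \in c.2) => /=; lia.
Qed.

Lemma faces_at_points (c : cell n) v p : #|c.2| = 3%N -> face_of (vertex v) c ->
  @realization R n (faces_at c v) p <->
  cell_points c p /\ exists2 i, i \in c.2 & p ord0 i = (v ord0 i)%:~R.
Proof.
move=> c3 vc; split=> [[d [/(faces_atP _ c3 vc)[dc [i ic /andP[id /eqP di]]] pd]]|[pc [i ic pi]]].
  split; first exact: face_points pd.
  by exists i => //; move: (pd i); rewrite (negbTE id) addr0 -eq_le di => /eqP.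
exists (carrier p); split; last exact: carrier_points.
apply/(faces_atP _ c3 vc); split; first exact: carrier_face.
by exists i => //; rewrite /carrier /= inE mxE pi intrKfloor !eqxx.
Qed.

Lemma rvec_carrier v : carrier (rvec v) = vertex v.
Proof. by apply: carrier_eq => i; rewrite inE !mxE. Qed.

Definition center (c : cell n) : 'rV[R]_n :=
  \row_i ((c.1 ord0 i)%:~R + (i \in c.2)%:R / 2).

Lemma center_carrier c : carrier (center c) = c.
Proof.
apply: carrier_eq => i; rewrite mxE; case: (i \in c.2) => /=.
  by rewrite intrD; apply/andP; split; lra.
by rewrite mul0r addr0.
Qed.

Lemma center_points c : cell_points c (center c).
Proof. by have := carrier_points (center c); rewrite center_carrier. Qed.

End Projection.

(** * A flip of a tiling is a tiling *)

Section Angles.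
Variables (R : realType) (n : nat) (theta : 'I_n -> R).
Hypothesis theta_bounds : forall i, 0 < theta i < pi.
Hypothesis theta_incr : forall i j : 'I_n, (i < j)%N -> theta i < theta j.

Lemma sin_theta_gt0 i : 0 < sin (theta i).
Proof. exact: sin_gt0_pi. Qed.

(** The determinant of the two direction vectors is the sine of [theta j - theta i], an angle
    between 0 and [pi]. *)
Lemma cross_theta_gt0 (i j : 'I_n) : (i < j)%N ->
  0 < cos (theta i) * sin (theta j) - sin (theta i) * cos (theta j).
Proof.
move=> ij; have := theta_incr ij; move: (theta_bounds i) (theta_bounds j).
move=> /andP[i0 i1] /andP[j0 j1] lt.
rewrite [X in X - _]mulrC [X in _ - X]mulrC -sinB.
by apply: sin_gt0_pi; lra.
Qed.

End Angles.

(* C and S stand for the cosines and sines of the angles; besides projE only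
   the signs of S i and of the determinants cross i j matter. *)
Section Geometry.
Variables (R : realType) (n : nat) (a : 'I_n -> nat) (theta : 'I_n -> R).
Variables C S : 'I_n -> R.
Definition vcross (i j : 'I_n) : R := C i * S j - S i * C j.
Local Notation cross := vcross.
Hypothesis projE : forall p, Defs.proj theta p = (lin C p, lin S p).
Hypothesis S_gt0 : forall i, 0 < S i.
Hypothesis cross_gt0 : forall i j : 'I_n, (i < j)%N -> 0 < cross i j.
Implicit Types (p q r : 'rV[R]_n) (c d : cell n) (v w : 'rV[int]_n) (T : set (cell n)).

Local Notation E i := (delta_mx ord0 i : 'rV[R]_n).

Definition same_proj p q := lin C p = lin C q /\ lin S p = lin S q.

Lemma same_projE p q : same_proj p q <-> Defs.proj theta p = Defs.proj theta q.
Proof. by rewrite !projE; split=> [[-> ->]|[]]. Qed.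

Lemma same_proj_sym p q : same_proj p q -> same_proj q p.
Proof. by case. Qed.

Lemma same_proj_trans p q r : same_proj p q -> same_proj q r -> same_proj p r.
Proof. by move=> [E1 E2] [E3 E4]; split; rewrite ?E1 ?E2. Qed.

Lemma cell_pointsP c p : cell_points c p <->
  forall i, (c.1 ord0 i)%:~R <= p ord0 i <= (c.1 ord0 i)%:~R + (i \in c.2)%:R.
Proof. by split=> H i; move: (H i); rewrite intrD. Qed.

Section Tiling.
Variable T : set (cell n).
Hypothesis tT : tiling a theta T.

Lemma tiling_box c : T c -> in_box a c.
Proof. by case: tT => -[+ _] _; exact. Qed.

Lemma tiling_face c d : T c -> face_of d c -> T d.
Proof. by case: tT => -[_ +] _; exact. Qed.

Lemma tiling_dim c : T c -> (#|c.2| <= 2)%N.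
Proof. by case: tT => _ [[+ _] _]; exact. Qed.

Lemma tiling_carrier p : @realization R n T p -> T (carrier p).
Proof. by move=> [c [Tc pc]]; apply: tiling_face Tc _; exact: carrier_face. Qed.

Lemma tiling_inj p q : @realization R n T p -> @realization R n T q ->
  same_proj p q -> p = q.
Proof.
move=> rp rq /same_projE pq; case: tT => _ [_ [[_ inj _] _]].
by apply: inj => //; exact: mem_set.
Qed.

Lemma tiling_surj p : @box R n a p -> exists q, @realization R n T q /\ same_proj q p.
Proof.
move=> bp; case: tT => _ [_ [[_ _ surj] _]].
have [|q rq qp] := surj (Defs.proj theta p); first by exists p.
by exists q; split=> //; apply/same_projE.
Qed.

(** Continuity of the inverse homeomorphism: points of the zonogon near the projection of [q] lift
    to points of the tiling near [q]. *)
Lemma tiling_near q (delta : R) : @realization R n T q -> 0 < delta ->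
  exists2 eps : R, 0 < eps & forall p, @box R n a p ->
    `|lin C q - lin C p| < eps -> `|lin S q - lin S p| < eps ->
    exists r, [/\ @realization R n T r, same_proj r p &
                  forall i, `|q ord0 i - r ord0 i| < delta].
Proof.
move=> rq d_gt0; case: tT => _ [_ [[fP inj _] [_ [g [gf gc]]]]].
have [eps e_gt0 H] := within_continuous_coord gc (fP _ rq) d_gt0.
exists eps => // p bp Cp Sp; have [r [rr rp]] := tiling_surj bp.
exists r; split=> // i; have := H (Defs.proj theta p); rewrite gf //.
have <- : Defs.proj theta r = Defs.proj theta p by apply/same_projE.
rewrite gf //; apply; first exact: fP.
  by case: rp => E1 _; rewrite !projE /= E1.
by case: rp => _ E2; rewrite !projE /= E2.
Qed.

End Tiling.

Lemma in_box_points c p : in_box a c -> cell_points c p -> @box R n a p.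
Proof.
move=> ac /[swap] i pc; case: (ac i) => a1 a2; move: (pc i) => /andP[p1 p2].
apply/andP; split; first by apply: le_trans p1; rewrite ler0z.
by apply: le_trans p2 _; rewrite -(ler_int R) in a2.
Qed.

(** Inside [c] the fibres of the projection are parallel to [kappa], and adding positive multiples
    of [kappa] moves every coordinate of [c] towards that of [v]. The last clause says that the
    directions of [c] span the plane. *)
Definition kernel_dir c v (kappa : 'rV[R]_n) :=
  [/\ forall i, if i \in c.2 then
        if v ord0 i == c.1 ord0 i then kappa ord0 i < 0 else 0 < kappa ord0 i
        else kappa ord0 i == 0,
      lin C kappa = 0 /\ lin S kappa = 0,
      forall delta : 'rV[R]_n, (forall i, i \notin c.2 -> delta ord0 i = 0) ->
        lin C delta = 0 -> lin S delta = 0 -> exists t, delta = t *: kappa &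
      forall x y : R, exists delta : 'rV[R]_n,
        [/\ forall i, i \notin c.2 -> delta ord0 i = 0,
            lin C delta = x & lin S delta = y]].

Lemma kernel_dir_opposite c v w kappa : opposite c v w ->
  kernel_dir c v kappa -> kernel_dir c w (- kappa).
Proof.
move=> op [sgn [kC kS] ker spn]; split=> //.
- move=> i; move: (op i) (sgn i); rewrite !mxE oppr_lt0 oppr_gt0; case: ifP => _.
    have cF : (c.1 ord0 i + 1 == c.1 ord0 i) = false by apply/eqP; lia.
    by case/orP => /andP[/eqP Ev /eqP Ew]; rewrite Ev Ew eqxx cF.
  by rewrite oppr_eq0.
- by rewrite !linN kC kS oppr0.
- move=> delta d0 dC dS; have [t ->] := ker delta d0 dC dS.
  by exists (- t); rewrite scalerN scaleNr opprK.
Qed.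

Lemma lin3 u (j k l : 'I_n) x y z :
  lin u (x *: E j + y *: E k + z *: E l) = x * u j + y * u k + z * u l.
Proof. by rewrite !linD !linZ !lin_delta. Qed.

Lemma coord3 (j k l : 'I_n) (x y z : R) i :
  (x *: E j + y *: E k + z *: E l) ord0 i =
  x * (i == j)%:R + y * (i == k)%:R + z * (i == l)%:R.
Proof. by rewrite !mxE !eqxx. Qed.

(** The linear relation between three plane vectors weights each by the determinant of the other
    two, with alternating signs. As the determinants are positive, the middle coordinate goes up and
    the outer ones go down, which points to the bottom vertex. *)
Lemma cube_kernel_dir J (j k l : 'I_n) : (j < k < l)%N ->
  exists kappa, kernel_dir (cube J j k l) (bottom_vertex J j k l) kappa.
Proof.
move=> jkl; have /andP[jk kl] := jkl; have jl := ltn_trans jk kl.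
have njk : (j == k) = false by rewrite -val_eqE /= ltn_eqF.
have nkl : (k == l) = false by rewrite -val_eqE /= ltn_eqF.
have njl : (j == l) = false by rewrite -val_eqE /= ltn_eqF.
have [nkj nlk nlj] : [/\ (k == j) = false, (l == k) = false & (l == j) = false].
  by split; rewrite eq_sym.
have djk := cross_gt0 jk; have dkl := cross_gt0 kl; have djl := cross_gt0 jl.
exists (- cross k l *: E j + cross j l *: E k + - cross j k *: E l); split.
- move=> i; rewrite /cube /bottom_vertex /= !inE coord3 coord_addb.
  have [->|ij] := eqVneq i j.
    rewrite njk njl /= addr0 eqxx !mulr0 !addr0 mulr1; lra.
  have [->|ik] := eqVneq i k.
    rewrite nkl /= !mulr0 mulr1 addr0 add0r; case: eqP => // /eqP; lia.
  have [->|il] := eqVneq i l; last by rewrite /= !mulr0 !addr0.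
  by rewrite /= addr0 eqxx !mulr0 !add0r mulr1; lra.
- by rewrite !lin3 /vcross; split; ring.
- move=> delta d0 dC dS.
  have dE : delta = delta ord0 j *: E j + delta ord0 k *: E k + delta ord0 l *: E l.
    apply/rowP => i; rewrite coord3.
    have [->|ij] := eqVneq i j; first by rewrite njk njl /=; ring.
    have [->|ik] := eqVneq i k; first by rewrite nkl /=; ring.
    have [->|il] := eqVneq i l; first by rewrite /=; ring.
    rewrite (d0 i) /=; first by ring.
    by rewrite /cube /= !inE (negbTE ij) (negbTE ik) (negbTE il).
  move: dC dS; rewrite {1 2}dE !lin3.
  move: (delta ord0 j) (delta ord0 k) (delta ord0 l) dE => x y z dE dC dS.
  (* The multiple is read off coordinate [k], where [kappa] equals [cross j l]. *)
  exists (y / cross j l); rewrite dE !scalerDr !scalerA; congr (_ *: _ + _ *: _ + _ *: _).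
  + apply: (mulIf (lt0r_neq0 djl)); rewrite mulrAC divfK ?gt_eqF //.
    apply/eqP; rewrite -subr_eq0 /vcross; apply/eqP.
    transitivity ((x * C j + y * C k + z * C l) * S l - (x * S j + y * S k + z * S l) * C l).
      by ring.
    by rewrite dC dS; ring.
  + by rewrite divfK // gt_eqF.
  + apply: (mulIf (lt0r_neq0 djl)); rewrite mulrAC divfK ?gt_eqF //.
    apply/eqP; rewrite -subr_eq0 /vcross; apply/eqP.
    transitivity (- ((x * C j + y * C k + z * C l) * S j - (x * S j + y * S k + z * S l) * C j)).
      by ring.
    by rewrite dC dS; ring.
(* Cramer's rule in the basis of directions [j] and [k]; direction [l] gets weight 0. *)
- move=> x y; pose al := (x * S k - y * C k) / cross j k.
  pose be := (C j * y - S j * x) / cross j k.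
  exists (al *: E j + be *: E k + 0 *: E l); split.
  + move=> i; rewrite coord3 /cube /= !inE !negb_or => /andP[/andP[/negbTE -> /negbTE ->] _] /=.
    by ring.
  + rewrite lin3 /al /be; move: djk; rewrite /vcross => djk; field; exact: lt0r_neq0.
  + rewrite lin3 /al /be; move: djk; rewrite /vcross => djk; field; exact: lt0r_neq0.
Qed.

(** * The projection restricted to one cube *)

Section CubeProjection.
Variables (c : cell n) (v w : 'rV[int]_n) (kappa : 'rV[R]_n).
Hypothesis c3 : #|c.2| = 3%N.
Hypothesis op : opposite c v w.
Hypothesis kdir : kernel_dir c v kappa.

Let sgn i : i \in c.2 ->
  (v ord0 i)%:~R = (c.1 ord0 i)%:~R :> R /\ kappa ord0 i < 0 \/
  (v ord0 i)%:~R = (c.1 ord0 i)%:~R + 1 :> R /\ 0 < kappa ord0 i.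
Proof.
move=> ic; case: kdir => /(_ i) + _ _ _; move: (op i); rewrite ic.
case: eqVneq => [->|ne] /=; first by left.
by rewrite /= => /andP[/eqP -> _] k0; right; rewrite intrD.
Qed.

Let kappa_out i : i \notin c.2 -> kappa ord0 i = 0.
Proof. by move=> /negbTE ic; case: kdir => /(_ i) + _ _ _; rewrite ic => /eqP. Qed.

(** Travel along [kappa] until the first coordinate reaches that of [v]: the stopping time is the
    least of the times [t i]. *)
Lemma push_to_faces p : cell_points c p ->
  exists q, same_proj q p /\ @realization R n (faces_at c v) q.
Proof.
move=> /cell_pointsP pc.
have [i0 i0c] : exists i, i \in c.2 by apply/card_gt0P; rewrite c3.
pose t i := ((v ord0 i)%:~R - p ord0 i) / kappa ord0 i.
case: (@Order.TotalTheory.arg_minP _ _ _ i0 (mem c.2) t i0c) => i ic' mini.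
have {ic'}ic : i \in c.2 by [].
have kn j : j \in c.2 -> kappa ord0 j != 0.
  by move=> /sgn[[_ /lt_eqF ->]|[_ /gt_eqF ->]].
have t_ge0 : 0 <= t i.
  move: (pc i) => /andP[p1 p2]; rewrite ic /= in p2; rewrite /t.
  case: (sgn ic) => [[-> k0]|[-> k0]].
    by rewrite -mulrNN -invrN; apply: divr_ge0; lra.
  by apply: divr_ge0; lra.
exists (p + t i *: kappa); split.
  by case: kdir => _ [kC kS] _ _; rewrite /same_proj !linD !linZ kC kS mulr0 !addr0.
apply/(faces_at_points _ c3 (opposite_vertex op)); split; last first.
  by exists i => //; rewrite !mxE /t divfK ?kn // addrC subrK.
apply/cell_pointsP => j; rewrite !mxE; have [jc|jc] := boolP (j \in c.2); last first.
  by move: (pc j); rewrite (kappa_out jc) (negbTE jc) mulr0 !addr0.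
have le_t : t i <= t j by exact: mini.
move: (pc j); rewrite jc /= => /andP[p1 p2].
have E : t j * kappa ord0 j = (v ord0 j)%:~R - p ord0 j by rewrite /t divfK ?kn.
case: (sgn jc) => [[Ev k0]|[Ev k0]]; rewrite Ev in E.
  have m1 : t i * kappa ord0 j <= 0 by rewrite mulr_ge0_le0 // ltW.
  have m2 : t j * kappa ord0 j <= t i * kappa ord0 j by rewrite ler_nM2r.
  by apply/andP; split; rewrite /=; lra.
have m1 : 0 <= t i * kappa ord0 j by rewrite mulr_ge0 // ltW.
have m2 : t i * kappa ord0 j <= t j * kappa ord0 j by rewrite ler_pM2r.
by apply/andP; split; rewrite /=; lra.
Qed.

(** Two points of a fibre differ by a multiple of [kappa]. The one lying behind has a coordinate
    already equal to that of [v], so the one ahead would be outside [c]. *)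
Lemma faces_at_inj p q : @realization R n (faces_at c v) p ->
  @realization R n (faces_at c v) q -> same_proj p q -> p = q.
Proof.
have vc := opposite_vertex op.
move=> /(faces_at_points _ c3 vc)[/cell_pointsP pc [i ic pi]].
move=> /(faces_at_points _ c3 vc)[/cell_pointsP qc [i' ic' qi]] [EC ES].
case: kdir => _ _ ker _; have [|||t Et] := ker (p - q).
- move=> j jc; rewrite !mxE; move: (pc j) (qc j); rewrite (negbTE jc) /= !addr0.
  by rewrite -!eq_le => /eqP <- /eqP <-; rewrite subrr.
- by rewrite linD linN EC subrr.
- by rewrite linD linN ES subrr.
have Ep j : p ord0 j - q ord0 j = t * kappa ord0 j.
  by have := congr1 (fun M : 'rV[R]_n => M ord0 j) Et; rewrite !mxE.
have p_eq : t = 0 -> p = q by move=> t0; apply/eqP; rewrite -subr_eq0 Et t0 scale0r.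
case: (ltgtP t 0) => [t0|t0|/p_eq//]; exfalso; clear Et p_eq.
  move: (Ep i) (qc i) => Ei /andP[q1 q2]; rewrite ic /= in q2.
  case: (sgn ic) => [[Ev k0]|[Ev k0]]; rewrite Ev in pi.
    have : 0 < t * kappa ord0 i by rewrite nmulr_lgt0.
    by lra.
  have : t * kappa ord0 i < 0 by rewrite nmulr_rlt0.
  by lra.
move: (Ep i') (pc i') => Ei /andP[p1 p2]; rewrite ic' /= in p2.
case: (sgn ic') => [[Ev k0]|[Ev k0]]; rewrite Ev in qi.
  have : t * kappa ord0 i' < 0 by rewrite pmulr_rlt0.
  by lra.
have : 0 < t * kappa ord0 i' by rewrite pmulr_rgt0.
by lra.
Qed.

(* The point v projects to an interior point of the hexagon. *)
Lemma faces_at_neighbourhood (delta : 'rV[R]_n) :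
  exists2 eps : R, 0 < eps < 1 &
    exists q, same_proj q (rvec R v + eps *: delta) /\ @realization R n (faces_at c v) q.
Proof.
case: (kdir) => _ [kC kS] _ /(_ (lin C delta) (lin S delta))[eta [eta_out etaC etaS]].
(* [M] is so large that [eta - M *: kappa] points from [v] weakly into [c] in every direction; the
   correction does not change the projection. [B] bounds the coordinates and is at least 2, so
   [B^-1] keeps the point in [c] and is below 1. *)
pose M := \sum_(i in c.2) `|eta ord0 i / kappa ord0 i|.
pose eta' := eta - M *: kappa.
pose B := 2 + \sum_(i in c.2) `|eta' ord0 i|.
have B_ge2 : 2 <= B by rewrite lerDl sumr_ge0.
have leB i : i \in c.2 -> `|eta' ord0 i| <= B.
  move=> ic; rewrite /B (bigD1 i) //= addrCA lerDl addr_ge0 // sumr_ge0 //.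
have leM i : i \in c.2 -> `|eta ord0 i| <= M * `|kappa ord0 i|.
  move=> ic; have kn : 0 < `|kappa ord0 i|.
    by rewrite normr_gt0; case: (sgn ic) => [[_ /lt_eqF ->]|[_ /gt_eqF ->]].
  rewrite -ler_pdivrMr // -normfV -normrM /M (bigD1 i) //= lerDl sumr_ge0 //.
have B0 : 0 < B by lra.
exists B^-1.
  by rewrite invr_gt0 B0 invf_lt1 //; lra.
have [|q [qp rq]] := @push_to_faces (rvec R v + B^-1 *: eta').
  apply/cell_pointsP => i; rewrite !mxE; have [ic|ic] := boolP (i \in c.2); last first.
    rewrite eta_out // kappa_out //.
    have -> : v ord0 i = c.1 ord0 i by move: (op i); rewrite (negbTE ic) => /andP[/eqP].
    by rewrite /= mulr0 subr0 mulr0 !addr0 lexx.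
  have le1 : `|B^-1 * eta' ord0 i| <= 1.
    by rewrite normrM normfV (gtr0_norm B0) ler_pdivrMl // mulr1 leB.
  move: le1 (leM i ic); rewrite /eta' !mxE; set z := _ - _ => le1 leMi.
  have [[Ev k0]|[Ev k0]] := sgn ic; rewrite Ev.
    rewrite (ltr0_norm k0) in leMi.
    have z0 : 0 <= z by move: leMi; rewrite ler_norml /z => /andP[]; lra.
    have zB : 0 <= B^-1 * z by rewrite mulr_ge0 // invr_ge0 ltW.
    by move: le1; rewrite ger0_norm //= => le1; apply/andP; split; lra.
  rewrite (gtr0_norm k0) in leMi.
  have z0 : z <= 0 by move: leMi; rewrite ler_norml /z => /andP[]; lra.
  have zB : B^-1 * z <= 0 by rewrite mulr_ge0_le0 // invr_ge0 ltW.
  by move: le1; rewrite ler0_norm //= => le1; apply/andP; split; lra.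
exists q; split=> //; apply: same_proj_trans qp _.
by rewrite /same_proj !linD !linZ /eta' !linD !linN !linZ kC kS !mulr0 !subr0 etaC etaS.
Qed.

Section Flip.
Variable T : set (cell n).
Hypothesis tT : tiling a theta T.
Hypothesis sub : faces_at c v `<=` T.

Let real_sub q : @realization R n (faces_at c v) q -> @realization R n T q.
Proof. by move=> [d [/sub Td qd]]; exists d. Qed.

(** A point inside [d] close to [v] projects into the hexagon, so a point of the faces at [v] has
    the same projection. Injectivity on [T] identifies the two, and [d] is the carrier of the
    first. *)
Lemma star_faces_at d : T d -> face_of (vertex v) d -> faces_at c v d.
Proof.
move=> Td /vertex_faceP vd.
pose delta : 'rV[R]_n := \row_i
  if i \in d.2 then if v ord0 i == d.1 ord0 i then 1 else -1 else 0.
have [eps /andP[e0 e1] [q [qp rq]]] := faces_at_neighbourhood delta.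
have dE : carrier (rvec R v + eps *: delta) = d.
  apply: carrier_eq => i; rewrite /delta !mxE; move: (vd i); case: ifP => [id|id] /=.
    have [Ev _|ne vd'] := eqVneq (v ord0 i) (d.1 ord0 i).
      by rewrite id Ev intrD mulr1; apply/andP; split; lra.
    rewrite id; have -> : v ord0 i = d.1 ord0 i + 1 by lia.
    by rewrite intrD mulrN1; apply/andP; split; lra.
  by rewrite addr0 => vd'; rewrite id mulr0 addr0 eqr_int; lia.
have pT : @realization R n T (rvec R v + eps *: delta).
  by exists d; split=> //; have := carrier_points (rvec R v + eps *: delta); rewrite dE.
have qE := tiling_inj tT (real_sub rq) pT qp; rewrite qE in rq.
case: rq => f [ff /carrier_face]; rewrite dE; exact: faces_at_face.
Qed.

(** Pushing [w] onto the faces at [v] gives a point of [T] with the same projection, hence [w]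
    itself; but [w] differs from [v] in every direction of [c]. *)
Lemma opposite_vertex_notin : ~ T (vertex w).
Proof.
move=> Tw; have wc : cell_points c (rvec R w).
  apply: face_points (opposite_vertex (opposite_sym op)) _.
  by rewrite -(rvec_carrier R); exact: carrier_points.
have [q [qw rq]] := push_to_faces wc.
have rw : @realization R n T (rvec R w).
  by exists (vertex w); split=> //; rewrite -(rvec_carrier R); exact: carrier_points.
have qE := tiling_inj tT (real_sub rq) rw qw; rewrite qE in rq.
move: rq => /(faces_at_points _ c3 (opposite_vertex op))[_ [i ic]].
by rewrite mxE => /eqP; rewrite eqr_int; move: (op i); rewrite ic; lia.
Qed.

Lemma faces_at_kept d : T d -> ~ face_of (vertex v) d ->
  ((T `\` faces_at c v) `|` faces_at c w) d.
Proof.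
move=> Td vd; have [fd|fd] := pselect (faces_at c v d); last by left.
right; apply: faces_at_opposite vd => //.
by case/(faces_atP _ c3 (opposite_vertex op)): fd.
Qed.

End Flip.

End CubeProjection.

(** Over the hexagon the sheet at [v] is exchanged for the sheet at [w] along the kernel line;
    elsewhere nothing changes. The realization is compact, so bijectivity onto the zonogon is
    enough. *)
Lemma flip_tiling c v w kappa T : #|c.2| = 3%N -> opposite c v w ->
  kernel_dir c v kappa -> in_box a c -> tiling a theta T -> faces_at c v `<=` T ->
  tiling a theta ((T `\` faces_at c v) `|` faces_at c w).
Proof.
move=> c3 op kd cbox tT sub.
have vc := opposite_vertex op; have op' := opposite_sym op; have wc := opposite_vertex op'.
have kd' := kernel_dir_opposite op kd.
set T' := _ `|` _.
have star := star_faces_at c3 op kd tT sub.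
have kept d : T d -> ~ face_of (vertex v) d -> T' d by exact: faces_at_kept.
have old d : T' d -> ~ faces_at c w d -> T d /\ ~ face_of (vertex v) d.
  by move=> [[Td fd] _|//]; split=> // vd; apply: fd; exact: star.
have boxT' d : T' d -> in_box a d.
  move=> [[/(tiling_box tT)//]|[f [fc _ _ df]]].
  have {}fc := face_of_trans df fc => i; move: (cbox i); case: fc => /fintype.subsetP s /(_ i).
  rewrite inE; case: (boolP (i \in d.2)) => [/s ->|_] /=; first by lia.
  by case: (i \in c.2) => /=; lia.
have dimT' d : T' d -> (dim_cell d <= 2)%N.
  move=> [[/(tiling_dim tT)//]|[f [_ <- _ [/subset_leq_card]]]] //.
split; first split=> //.
  move=> d d' T'd d'd; have [fd|fd] := pselect (faces_at c w d).
    by right; apply: faces_at_face d'd.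
  have [Td vd] := old d T'd fd; apply: kept; first exact: tiling_face d'd.
  by move=> vd'; apply: vd; exact: face_of_trans d'd.
split.
  split=> //; have [i ic] : exists i, i \in c.2 by apply/card_gt0P; rewrite c3.
  pose f : cell n := (\row_j if j == i then w ord0 i else c.1 ord0 j, c.2 :\ i).
  exists f; split; last by apply: succn_inj; rewrite -c3 (cardsD1 i) ic.
  right; apply/(faces_atP _ c3 wc); split; last first.
    by exists i => //; rewrite /f /= mxE !inE !eqxx.
  split=> [|j]; first exact: finset.subsetDl.
  rewrite /f /= mxE !inE; have [->|ji] := eqVneq j i; last by case: (j \in c.2) => /=; lia.
  by rewrite ic /=; move/vertex_faceP: wc => /(_ i); rewrite ic.
apply: homeomorphism_on_compact; first exact: compact_realization boxT'.
  by move=> p; exact: proj_continuous.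
have realT' p : @realization R n T' p -> @realization R n (faces_at c w) p \/
    @realization R n T p /\ ~ face_of (vertex v) (carrier p).
  move=> [d [T'd pd]]; have [fd|fd] := pselect (faces_at c w d); first by left; exists d.
  have [Td vd] := old d T'd fd; right; split; first by exists d.
  by move=> vp; apply: vd; apply: face_of_trans vp _; exact: carrier_face.
split.
- by move=> p [d [/boxT' bd pd]]; exists p => //; exact: in_box_points bd pd.
(* A new point [p] and an old point [q] off the star of [v] with the same projection: pushing [p] to
   the old sheet gives [q], by injectivity on [T]. So [q] lies on the boundary hexagon, which is
   part of the new sheet, where the projection is injective. *)
- have mixed p q : @realization R n (faces_at c w) p ->
      @realization R n T q -> ~ face_of (vertex v) (carrier q) -> same_proj p q -> p = q.
    move=> rp rq vq pq.
    have [|p' [p'p rp']] := push_to_faces c3 op kd (p := p).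
      by case/(faces_at_points _ c3 wc): rp.
    have p'T : @realization R n T p' by case: rp' => d [/sub Td]; exists d.
    have p'q : p' = q by apply: (tiling_inj tT) => //; exact: same_proj_trans p'p pq.
    rewrite p'q in rp'; apply: (faces_at_inj c3 op' kd') => //.
    exists (carrier q); split; last exact: carrier_points.
    apply: faces_at_opposite vq => //.
    by case/(faces_at_points _ c3 vc): rp' => qc _; exact: carrier_face.
  move=> p q /set_mem rp /set_mem rq /same_projE pq.
  have [rp'|[rp' vp]] := realT' p rp; have [rq'|[rq' vq]] := realT' q rq.
  + exact: (faces_at_inj c3 op' kd').
  + exact: mixed.
  + by apply/esym; apply: mixed => //; exact: same_proj_sym.
  + exact: (tiling_inj tT).
- move=> _ [p bp <-]; have [q [rq qp]] := tiling_surj tT bp.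
  have [vq|vq] := pselect (face_of (vertex v) (carrier q)); last first.
    exists q; last by apply/same_projE.
    by exists (carrier q); split; [apply: kept => //; exact: tiling_carrier|exact: carrier_points].
  have fq : faces_at c v (carrier q) by apply: star => //; exact: tiling_carrier.
  have [|q' [q'q rq']] := push_to_faces c3 op' kd' (p := q).
    apply: face_points (carrier_points q).
    by case/(faces_atP _ c3 vc): fq.
  exists q'; last by apply/same_projE; exact: same_proj_trans q'q qp.
  by case: rq' => d [fd q'd]; exists d; split=> //; right.
Qed.

End Geometry.

(** * Paths in a tiling *)

Section Paths.
Variables (R : realType) (n : nat) (a : 'I_n -> nat) (theta : 'I_n -> R).
Variables C S : 'I_n -> R.
Local Notation cross := (vcross C S).
Hypothesis projE : forall p, Defs.proj theta p = (lin C p, lin S p).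
Hypothesis S_gt0 : forall i, 0 < S i.
Hypothesis cross_gt0 : forall i j : 'I_n, (i < j)%N -> 0 < cross i j.
Implicit Types (p q r : 'rV[R]_n) (c d : cell n) (V : 'rV[int]_n) (T : set (cell n)).
Implicit Types (u w z : seq 'I_n).

Local Notation E i := (delta_mx ord0 i : 'rV[R]_n).
Local Notation e := (@basis_vec n).

Lemma crossC (i j : 'I_n) : cross i j = - cross j i.
Proof. by rewrite /vcross; ring. Qed.

Lemma lin2 (f : 'I_n -> R) (i j : 'I_n) x y : lin f (x *: E i + y *: E j) = x * f i + y * f j.
Proof. by rewrite linD !linZ !lin_delta. Qed.

Lemma coord2 (j k : 'I_n) (x y : R) i :
  (x *: E j + y *: E k) ord0 i = x * (i == j)%:R + y * (i == k)%:R.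
Proof. by rewrite !mxE !eqxx. Qed.

(** The condition on [m] gives room in the box to move the midpoint of the edge horizontally to the
    left. The lift of the moved point is near the midpoint, so its carrier has direction [b] and one
    more direction; the sign of the displacement in the latter tells the kind of tile. *)
Lemma left_tile T V (b : 'I_n) : tiling a theta T -> T (V, [set b]%SET) ->
  (exists m : 'I_n, (b < m)%N /\ V ord0 m < (a m)%:Z) \/
  (exists m : 'I_n, (m < b)%N /\ 0 < V ord0 m) ->
  (exists m : 'I_n, (b < m)%N /\ T (V, [set b; m]%SET)) \/
  (exists m : 'I_n, (m < b)%N /\ T (V - e m, [set m; b]%SET)).
Proof.
move=> tT Tb nB; pose q : 'rV[R]_n := center R (V, [set b]%SET).
have qb : q ord0 b = (V ord0 b)%:~R + 1 / 2 by rewrite mxE /= inE eqxx.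
have qo i : i != b -> q ord0 i = (V ord0 i)%:~R.
  by move=> ib; rewrite mxE /= inE (negbTE ib) mul0r addr0.
have rq : @realization R n T q by exists (V, [set b]%SET); split=> //; exact: center_points.
have boxq := in_box_points (tiling_box tT Tb) (center_points R (V, [set b]%SET)).
(* With radius 1/2, coordinate [b] of the lift stays strictly inside its unit interval and every
   other coordinate stays within 1/2 of that of [V]. *)
have half_gt0 : 0 < 1 / 2 :> R by lra.
have [eps e_gt0 near] := tiling_near projE tT rq half_gt0.
have [p [tau [boxp tau_gt0 tau_lt EC ES]]] : exists p tau,
    [/\ @box R n a p, 0 < tau, tau < eps, lin C p = lin C q - tau & lin S p = lin S q].
  have build (m : 'I_n) (sg : R) : m != b -> `|sg| = 1 -> 0 < sg * cross b m ->
      (forall x, 0 <= x <= 1 / 2 -> 0 <= (V ord0 m)%:~R + sg * x <= (a m)%:R) ->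
      exists p tau, [/\ @box R n a p, 0 < tau, tau < eps, lin C p = lin C q - tau
        & lin S p = lin S q].
    (* Moving along [E m] and back along [E b] with weights proportional to [S b] and [S m] keeps
       the height and lowers the abscissa by a multiple of [cross b m]. The scale [K^-1] keeps both
       weights at most 1/2 and the drop below [eps]. *)
    move=> mb sg1 sgm Vm; pose K := 2 * (1 + S b + S m + sg * cross b m / eps).
    have cr0 : 0 < sg * cross b m / eps by rewrite divr_gt0.
    have Sb := S_gt0 b; have Sm := S_gt0 m.
    have K_gt0 : 0 < K by rewrite /K; lra.
    pose t := K^-1; have t_gt0 : 0 < t by rewrite invr_gt0.
    have leK x : 0 <= x -> x <= K / 2 -> 0 <= t * x <= 1 / 2.
      move=> x0 xK; rewrite mulr_ge0 //= ?(ltW t_gt0) //.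
      by rewrite /t mulrC ler_pdivrMr //; lra.
    have tb : 0 <= t * S b <= 1 / 2 by apply: leK; rewrite /K; lra.
    have tm : 0 <= t * S m <= 1 / 2 by apply: leK; rewrite /K; lra.
    have te : 0 <= t * (sg * cross b m / eps) <= 1 / 2 by apply: leK; rewrite /K; lra.
    exists (q + ((sg * (t * S b)) *: E m + (- (sg * (t * S m))) *: E b)), (t * (sg * cross b m)).
    split.
    - move=> i; rewrite mxE coord2; have [im|im] := eqVneq i m.
        rewrite im (negbTE mb) mulr0 addr0 mulr1 qo //; exact: Vm.
      have [ib|ib] := eqVneq i b; last by rewrite !mulr0 !addr0; exact: boxq.
      rewrite ib mulr0 add0r mulr1 qb; case: (tiling_box tT Tb b) => /=.
      rewrite inE eqxx => V0 V1; move: tm => /andP[tm0 tm1].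
      have : `|sg * (t * S m)| <= 1 / 2 by rewrite normrM sg1 [1 * `|_|]mul1r ger0_norm.
      rewrite ler_norml => /andP[n1 n2].
      have V0' : 0 <= (V ord0 b)%:~R :> R by rewrite ler0z.
      have V1' : (V ord0 b)%:~R + 1 <= (a b)%:R :> R.
        by rewrite -[1]/(1%:~R) -intrD -[(a b)%:R]/((a b)%:Z%:~R) ler_int.
      by apply/andP; split; lra.
    - exact: mulr_gt0.
    - case/andP: te => _; rewrite mulrA ler_pdivrMr //; lra.
    - by rewrite linD lin2 /vcross; ring.
    - by rewrite linD lin2; ring.
  case: nB => [[m [bm Vm]]|[m [mb Vm]]].
  - apply: (build m 1); first by rewrite -val_eqE /= gtn_eqF.
    + exact: normr1.
    + by rewrite mul1r cross_gt0.
    + move=> x /andP[x0 x1]; have /andP[q0 q1] := boxq m.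
      rewrite qo in q0 q1; last by rewrite -val_eqE /= gtn_eqF.
      have : (V ord0 m)%:~R + 1 <= (a m)%:R :> R.
        by rewrite -[1]/(1%:~R) -intrD -[(a m)%:R]/((a m)%:Z%:~R) ler_int; lia.
      by move=> V1; apply/andP; split; lra.
  - apply: (build m (-1)); first by rewrite -val_eqE /= ltn_eqF.
    + by rewrite normrN1.
    + by rewrite mulN1r crossC opprK cross_gt0.
    + move=> x /andP[x0 x1]; have /andP[q0 q1] := boxq m.
      rewrite qo in q0 q1; last by rewrite -val_eqE /= ltn_eqF.
      have V1 : 1 <= (V ord0 m)%:~R :> R by rewrite -[1]/(1%:~R) ler_int; lia.
      by apply/andP; split; lra.
have [||r [rr [rC rS] rnear]] := near p boxp.
- by rewrite EC opprB addrC subrK gtr0_norm.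
- by rewrite ES subrr normr0.
rewrite EC in rC; rewrite ES in rS.
have Tr := tiling_carrier tT rr.
have rb : (V ord0 b)%:~R < r ord0 b < (V ord0 b + 1)%:~R.
  by move: (rnear b); rewrite qb ltr_norml intrD => /andP[h1 h2]; apply/andP; split; lra.
have rlt i : i != b -> -(1/2) < (V ord0 i)%:~R - r ord0 i < 1 / 2.
  by move=> ib; move: (rnear i); rewrite qo // ltr_norml.
(* If no coordinate but [b] changed, equal heights would forbid any move, while the abscissa has
   dropped. *)
have [m mb rm] : exists2 m, m != b & r ord0 m != (V ord0 m)%:~R.
  apply: contrapT => no; have rV i : i != b -> r ord0 i = (V ord0 i)%:~R.
    by move=> ib; apply/eqP; apply: contrapT => /negP ne; apply: no; exists i.
  have rE : r = q + (r ord0 b - q ord0 b) *: E b.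
    apply/rowP => i; have -> : (q + (r ord0 b - q ord0 b) *: E b) ord0 i =
        q ord0 i + (r ord0 b - q ord0 b) * (i == b)%:R by rewrite !mxE eqxx.
    have [->|ib] := eqVneq i b; first by rewrite mulr1 addrC subrK.
    by rewrite (rV i ib) (qo i ib) mulr0 addr0.
  move: rC rS; rewrite rE !linD !linZ !lin_delta => rC rS.
  have z0 : (r ord0 b - q ord0 b) = 0.
    have /eqP : (r ord0 b - q ord0 b) * S b = 0 by lra.
    by rewrite mulf_eq0 [S b == 0]gt_eqF // orbF => /eqP.
  by move: rC; rewrite z0 mul0r; lra.
have frac i : i != b -> r ord0 i != (V ord0 i)%:~R -> i \in (carrier r).2.
  move=> ib ri; rewrite inE; apply: contra ri => /eqP Ei; move: (rlt i ib); rewrite -Ei.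
  move=> /andP[h1 h2]; rewrite eqr_int; apply/eqP.
  have g1 : (Num.floor (r ord0 i))%:~R < (V ord0 i + 1)%:~R :> R by rewrite intrD; lra.
  have g2 : (V ord0 i)%:~R < (Num.floor (r ord0 i) + 1)%:~R :> R by rewrite intrD; lra.
  by apply/eqP; rewrite eq_le -!ltzD1 -!(ltr_int R) g1 g2.
have cb : b \in (carrier r).2.
  rewrite inE; apply/eqP => Eb; move: rb; rewrite -Eb !ltr_int; lia.
have cE : (carrier r).2 = [set b; m]%SET.
  apply/esym/eqP; rewrite eqEcard finset.subUset !finset.sub1set cb frac //= cards2 eq_sym mb.
  exact: (tiling_dim tT Tr).
have rV i : i != b -> i != m -> r ord0 i = (V ord0 i)%:~R.
  move=> ib im; apply/eqP; apply: contrapT => /negP /(frac i ib).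
  by rewrite cE !inE (negbTE ib) (negbTE im).
pose x := r ord0 m - (V ord0 m)%:~R; pose y := r ord0 b - q ord0 b.
have rE : r = q + (y *: E b + x *: E m).
  apply/rowP => i; rewrite mxE coord2.
  have [->|ib] := eqVneq i b; first by rewrite eq_sym (negbTE mb) /y /=; ring.
  have [->|im] := eqVneq i m; first by rewrite qo // /x /=; ring.
  by rewrite rV // qo //=; ring.
have xc : x * cross b m = tau * S b.
  move: rC rS; rewrite rE !(linD _ q) !lin2 => rC rS.
  have yS : y * S b = - (x * S m) by lra.
  have yC : y * C b = - tau - x * C m by lra.
  rewrite /vcross mulrBr.
  have -> : x * (C b * S m) = C b * (x * S m) by ring.
  have -> : x * S m = - (y * S b) by rewrite yS opprK.
  transitivity (- (y * C b) * S b - x * (S b * C m)); first by ring.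
  by rewrite yC; ring.
have tS : 0 < tau * S b by rewrite mulr_gt0.
have rm' := rlt m mb; rewrite -opprB -/x in rm'.
case: (ltngtP b m) => [bm|mb'|/ord_inj bm]; last by rewrite bm eqxx in mb.
- left; exists m; split=> //.
  have x0 : 0 < x by rewrite -(pmulr_lgt0 _ (cross_gt0 bm)) xc.
  have <- // : carrier r = (V, [set b; m]%SET).
  apply: carrier_eq => i; rewrite !inE; have [->|ib] := eqVneq i b => //=.
  have [->|im] := eqVneq i m => /=; last by rewrite rV.
  by rewrite intrD; move: rm' x0; rewrite /x => /andP[h1 h2] h3; apply/andP; split; lra.
- right; exists m; split=> //.
  have x0 : x < 0.
    move: tS; rewrite -xc crossC mulrN -mulNr pmulr_lgt0 ?oppr_gt0 //; exact: cross_gt0.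
  have <- // : carrier r = (V - e m, [set m; b]%SET).
  apply: carrier_eq => i; rewrite !inE coord_subb.
  have [->|im] := eqVneq i m => /=.
    rewrite subrK intrD intrN; move: rm' x0; rewrite /x => /andP[h1 h2] h3.
    by apply/andP; split; lra.
  by rewrite subr0; have [->|ib] := eqVneq i b => //=; rewrite rV.
Qed.

Lemma rvecD_coord V p i : (rvec R V + p) ord0 i = (V ord0 i)%:~R + p ord0 i.
Proof. by rewrite !mxE. Qed.

Lemma wedge_point V (i j : 'I_n) (x y : R) : i != j -> 0 <= x <= 1 -> 0 <= y <= 1 ->
  cell_points (V - e j, [set j; i]%SET) (rvec R V + (x *: E i + (- y) *: E j)).
Proof.
move=> ij /andP[x0 x1] /andP[y0 y1]; apply/cell_pointsP => k.
rewrite rvecD_coord coord2 coord_subb /= !inE intrD intrN.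
have [->|kj] := eqVneq k j.
  by rewrite eq_sym (negbTE ij) /=; apply/andP; split; lra.
by have [->|ki] := eqVneq k i => /=; apply/andP; split; lra.
Qed.

(* Both tiles contain the horizontal segment going left from V. *)
Lemma left_tiles_eq T V (b m m' b' : 'I_n) : tiling a theta T ->
  (b < m)%N -> T (V - e b, [set b; m]%SET) ->
  (m' < b')%N -> T (V - e m', [set m'; b']%SET) -> m = b' /\ b = m'.
Proof.
move=> tT bm T1 mb T2; have c1 := cross_gt0 bm; have c2 := cross_gt0 mb.
(* [x1] times direction [m] minus [y1] times direction [b] is the vector (-1, 0), and likewise for
   the second tile. After scaling by [eps] both points lie in their tiles and project to the same
   point left of [V]. *)
pose x1 := S b / cross b m; pose y1 := S m / cross b m.
pose x2 := S m' / cross m' b'; pose y2 := S b' / cross m' b'.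
have [p1 q1 p2 q2] : [/\ 0 < x1, 0 < y1, 0 < x2 & 0 < y2] by split; rewrite divr_gt0.
pose eps := (1 + x1 + y1 + x2 + y2)^-1.
have D_gt0 : 0 < 1 + x1 + y1 + x2 + y2 by lra.
have eps_gt0 : 0 < eps by rewrite invr_gt0.
have le1 x : 0 < x -> x <= 1 + x1 + y1 + x2 + y2 -> 0 <= eps * x <= 1.
  by move=> x0 xD; rewrite (mulr_ge0 (ltW eps_gt0) (ltW x0)) /= /eps ler_pdivrMl // mulr1.
pose p := rvec R V + ((eps * x1) *: E m + (- (eps * y1)) *: E b).
pose q := rvec R V + ((eps * x2) *: E b' + (- (eps * y2)) *: E m').
have nbm : m != b by rewrite -val_eqE /= gtn_eqF.
have nmb : b' != m' by rewrite -val_eqE /= gtn_eqF.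
have pq : p = q.
  apply: (tiling_inj projE tT).
  - exists (V - e b, [set b; m]%SET); split=> //; apply: wedge_point => //; apply: le1 => //; lra.
  - exists (V - e m', [set m'; b']%SET); split=> //; apply: wedge_point => //; apply: le1 => //; lra.
  have lC (i j : 'I_n) : 0 < cross i j ->
      eps * (S i / cross i j) * C j + - (eps * (S j / cross i j)) * C i = - eps.
    by rewrite /vcross => cij; field; exact: lt0r_neq0.
  have lS (i j : 'I_n) : 0 < cross i j ->
      eps * (S i / cross i j) * S j + - (eps * (S j / cross i j)) * S i = 0.
    by rewrite /vcross => cij; field; exact: lt0r_neq0.
  by split; rewrite /p /q !(linD _ (rvec R V)) !lin2 ?lC ?lS.
have coordp k : eps * x1 * (k == m)%:R - eps * y1 * (k == b)%:R =
                eps * x2 * (k == b')%:R - eps * y2 * (k == m')%:R.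
  have := congr1 (fun M : 'rV[R]_n => M ord0 k) pq.
  by rewrite /p /q !rvecD_coord !coord2 !mulNr => /addrI.
have [e1 e2 e3 e4] : [/\ 0 < eps * x1, 0 < eps * y1, 0 < eps * x2 & 0 < eps * y2].
  by split; rewrite mulr_gt0.
split.
  have := coordp m; rewrite eqxx (negbTE nbm) /=.
  by case: eqP => // _ h; exfalso; move: h; case: (m == m') => /=; lra.
have := coordp b; rewrite eqxx eq_sym (negbTE nbm) /=.
by case: (b =P m') => // _ h; exfalso; move: h; case: (b == b') => /=; lra.
Qed.

Definition vsum u : 'rV[int]_n := \sum_(j <- u) e j.

Lemma vsum_coord u i : vsum u ord0 i = (count_mem i u)%:Z.
Proof.
elim: u => [|j u IH]; first by rewrite /vsum big_nil mxE.
rewrite /vsum big_cons addrC coord_addb IH /= PoszD addrC.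
by rewrite eq_sym.
Qed.

Lemma vsum_cat u z : vsum (u ++ z) = vsum u + vsum z.
Proof. by rewrite /vsum big_cat. Qed.

Lemma vsum1 j : vsum [:: j] = e j.
Proof. by rewrite /vsum big_seq1. Qed.

Lemma vsum_rcons u j : vsum (rcons u j) = vsum u + e j.
Proof. by rewrite -cats1 vsum_cat vsum1. Qed.

Fixpoint path_in T V w :=
  if w is j :: w' then T (V, [set j]%SET) /\ path_in T (V + e j) w' else True.

Lemma path_in_cat T V u z : path_in T V (u ++ z) <->
  path_in T V u /\ path_in T (V + vsum u) z.
Proof.
elim: u V => [|j u IH] V /=; first by rewrite /vsum big_nil addr0; split=> [|[]].
rewrite IH /vsum big_cons addrA; split=> [[? []]|[[? ?] ?]]; by split.
Qed.

Lemma path_in_edge T u j z : path_in T 0 (u ++ j :: z) -> T (vsum u, [set j]%SET).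
Proof. by move=> /path_in_cat[_]; rewrite add0r => -[]. Qed.

Definition full w := forall i, count_mem i w = a i.

Definition geo : rel 'I_n := fun i j => (j <= i)%N.
Definition leo : rel 'I_n := fun i j => (i <= j)%N.

(** The ascent found is the leftmost one, so the letters before it decrease weakly down to [j]; this
    bound is what preserves interval form in [interval_sweep]. *)
Lemma not_sorted_ascent w : ~~ sorted geo w ->
  exists u (j k : 'I_n) z,
    [/\ w = u ++ j :: k :: z, (j < k)%N & forall i, i \in u -> (j <= i)%N].
Proof.
case: w => // j w; elim: w j => //= k w IH j; rewrite negb_and.
case: (boolP (geo j k)) => /= [jk /IH|]; last first.
  by rewrite /geo -ltnNge => jk _; exists [::], j, k, w.
move=> [u [j' [k' [z [wE lt le]]]]]; exists (j :: u), j', k', z; rewrite wE; split=> // i.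
rewrite inE => /predU1P[->|/le//]; apply: leq_trans jk.
by case: u wE le => [[->]|i' u [-> _]] // /(_ i'); rewrite inE eqxx; exact.
Qed.

Lemma tile_edge_low V (j k : 'I_n) : face_of (V, [set j]%SET) (V, [set j; k]%SET).
Proof.
split=> /= [|i]; first exact: finset.subsetUl.
by rewrite lexx lerDl.
Qed.

Lemma tile_edge_high V (j k : 'I_n) : j != k ->
  face_of (V + e k, [set j]%SET) (V, [set j; k]%SET).
Proof.
move=> jk; split=> /= [|i]; first exact: finset.subsetUl.
rewrite coord_addb !inE; have [->|ik] := eqVneq i k; last by rewrite addr0 lexx lerDl.
by rewrite eq_sym (negbTE jk) /=; lia.
Qed.

Lemma path_in_step T V u (j k : 'I_n) z :
  (forall c d, T c -> face_of d c -> T d) -> j != k ->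
  path_in T V (u ++ j :: k :: z) -> T (V + vsum u, [set j; k]%SET) ->
  path_in T V (u ++ k :: j :: z).
Proof.
move=> Tf jk /path_in_cat[uT [_ [_ zT]]] Tt; apply/path_in_cat; split=> //=.
split; first by apply: (Tf _ _ Tt); rewrite finset.setUC; exact: tile_edge_low.
split; first by apply: (Tf _ _ Tt); exact: tile_edge_high.
by rewrite addrAC.
Qed.

(** Start with the tile left of the first edge of an ascent. If it is based at the start of that
    edge ([up]), compare it with the tile left of the next edge: either both contain the segment
    left of the common vertex, so they coincide and the ascent is found, or the next tile is again
    of kind [up] and the search moves on. [down] is the mirror image. The box stops the search at
    the ends of the word. *)
Lemma ascent_tile T w : tiling a theta T -> full w -> path_in T 0 w ->
  ~~ sorted geo w ->
  exists u (j k : 'I_n) z, [/\ w = u ++ j :: k :: z, (j < k)%N & T (vsum u, [set j; k]%SET)].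
Proof.
move=> tT fw pw; set goal := exists u, _.
have edge u j z : w = u ++ j :: z -> T (vsum u, [set j]%SET).
  by move=> wE; apply: (@path_in_edge T u j z); rewrite -wE.
have cnt u j z i : w = u ++ j :: z -> (count_mem i u + (j == i) + count_mem i z = a i)%N.
  by move=> wE; rewrite -(fw i) wE count_cat /= addnA.
have up z u (j m : 'I_n) : w = u ++ j :: z -> (j < m)%N -> T (vsum u, [set j; m]%SET) -> goal.
  elim: z u j m => [|k z IH] u j m wE jm Tt.
    have nm : (j == m) = false by rewrite -val_eqE /= ltn_eqF.
    have := cnt _ _ _ m wE; rewrite nm /=.
    by case: (tiling_box tT Tt m) => /=; rewrite vsum_coord !inE eqxx orbT /=; lia.
  have wE' : w = rcons u j ++ k :: z by rewrite wE cat_rcons.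
  have Vm : vsum (rcons u j) ord0 m < (a m)%:Z.
    have nm : (m == j) = false by rewrite -val_eqE /= gtn_eqF.
    case: (tiling_box tT Tt m) => /= _; rewrite vsum_rcons coord_addb nm !inE eqxx orbT.
    by lia.
  have Vj : 0 < vsum (rcons u j) ord0 j by rewrite vsum_rcons coord_addb eqxx vsum_coord; lia.
  have [|[m' [km T']]|[m' [mk T']]] := left_tile tT (edge _ _ _ wE').
  - by case: (ltnP k m) => km; [left; exists m|right; exists j; split=> //; exact: leq_trans km].
  - exact: IH wE' km T'.
  - have Tt' : T (vsum (rcons u j) - e j, [set j; m]%SET) by rewrite vsum_rcons addrK.
    have [mE jE] := left_tiles_eq tT jm Tt' mk T'.
    by exists u, j, k, z; rewrite -mE; split=> //; rewrite wE mE.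
have down u z (j m : 'I_n) : w = u ++ j :: z -> (m < j)%N ->
    T (vsum u - e m, [set m; j]%SET) -> goal.
  elim/last_ind: u z j m => [|u k IH] z j m wE mj Tt.
    by case: (tiling_box tT Tt m) => /=; rewrite coord_subb vsum_coord eqxx /=; lia.
  have wE' : w = u ++ k :: j :: z by rewrite wE cat_rcons.
  have [Vm0 _] := tiling_box tT Tt m; rewrite /= coord_subb eqxx vsum_rcons coord_addb in Vm0.
  have nj : (j == m) = false by rewrite -val_eqE /= gtn_eqF.
  have [_ Vj1] := tiling_box tT Tt j.
  rewrite /= coord_subb nj vsum_rcons coord_addb !inE eqxx orbT in Vj1.
  have [|[m' [km T']]|[m' [mk T']]] := left_tile tT (edge _ _ _ wE').
  - case: (ltnP m k) => mk.
      right; exists m; split=> //.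
      by move: Vm0; rewrite -val_eqE /= (ltn_eqF mk) /=; lia.
    left; exists j; split; first exact: leq_ltn_trans mk mj.
    by move: Vj1; case: (j == k) => /=; lia.
  - have T'' : T (vsum (rcons u k) - e k, [set k; m']%SET) by rewrite vsum_rcons addrK.
    have [mE kE] := left_tiles_eq tT km T'' mj Tt.
    by exists u, k, j, z; rewrite -mE; split=> //; rewrite wE' mE.
  - exact: IH wE' mk T'.
move=> /not_sorted_ascent[u [j [k [z [wE jk _]]]]].
have [|[m [jm Tt]]|[m [mj Tt]]] := left_tile tT (edge _ _ _ wE).
- left; exists k; split=> //; have nk : (j == k) = false by rewrite -val_eqE /= ltn_eqF.
  by have := cnt _ _ _ k wE; rewrite vsum_coord nk /= eqxx; lia.
- exact: up wE jm Tt.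
- exact: down wE mj Tt.
Qed.

(** The differences [q i - r i] weighted by [cross i j] are nonnegative on both sides of [j], and at
    equal heights their sum is [S j] times the difference of abscissas. If it vanishes, only
    coordinate [j] can differ, and the height excludes this. *)
Lemma extremal_point q r (j : 'I_n) :
  (forall i : 'I_n, (i < j)%N -> r ord0 i <= q ord0 i) ->
  (forall i : 'I_n, (j < i)%N -> q ord0 i <= r ord0 i) ->
  lin S r = lin S q -> lin C r <= lin C q /\ (lin C r = lin C q -> r = q).
Proof.
move=> lo hi ES.
pose t i := (q ord0 i - r ord0 i) * cross i j.
have t_ge0 i : 0 <= t i.
  case: (ltngtP i j) => [ij|ji|/ord_inj ->].
  - by apply: mulr_ge0; [rewrite subr_ge0; exact: lo|exact/ltW/cross_gt0].
  - rewrite /t crossC mulrN -mulNr opprB.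
    by apply: mulr_ge0; [rewrite subr_ge0; exact: hi|exact/ltW/cross_gt0].
  - by rewrite /t /vcross [S j * _]mulrC subrr mulr0.
have tE : \sum_i t i = (lin C q - lin C r) * S j.
  transitivity (lin C (q - r) * S j - lin S (q - r) * C j).
    rewrite /lin !mulr_suml -sumrB; apply: eq_bigr => i _.
    by rewrite /t /vcross !mxE; ring.
  by rewrite !linD !linN ES subrr mul0r subr0.
have Sj := S_gt0 j.
split; first by rewrite -subr_ge0 -(pmulr_lge0 _ Sj) -tE sumr_ge0.
move=> EC; have t0 i : t i = 0.
  have /eqP := tE; rewrite EC subrr mul0r psumr_eq0 // => /allP/(_ i).
  by rewrite mem_index_enum => /(_ isT)/eqP.
have ri i : i != j -> r ord0 i = q ord0 i.
  move=> ij; have /eqP := t0 i; rewrite mulf_eq0 subr_eq0 => /orP[/eqP->//|].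
  case: (ltngtP i j) => [lt|gt|/ord_inj E0]; last by rewrite E0 eqxx in ij.
    by rewrite gt_eqF // cross_gt0.
  by rewrite crossC oppr_eq0 gt_eqF // cross_gt0.
have rE : r - q = (r ord0 j - q ord0 j) *: E j.
  apply/rowP => i; rewrite !mxE eqxx /=.
  by have [->|ij] := eqVneq i j; rewrite ?mulr1 // (ri i ij) subrr mulr0.
have : lin S (r - q) = 0 by rewrite linD linN ES subrr.
rewrite rE linZ lin_delta => /eqP; rewrite mulf_eq0 [S j == 0]gt_eqF // orbF => /eqP z0.
by apply/eqP; rewrite -subr_eq0 rE z0 scale0r.
Qed.

(** By [extremal_point] the midpoint of a right boundary edge is the only point of the box with its
    projection. Its lift to the tiling is therefore itself, and its carrier is the edge. *)
Lemma right_path_in T w : tiling a theta T -> full w -> sorted leo w -> path_in T 0 w.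
Proof.
move=> tT fw sw.
have edge u j z : w = u ++ j :: z -> T (vsum u, [set j]%SET).
  move=> wE; have leoT : transitive leo by move=> x y t; exact: leq_trans.
  move: sw; rewrite wE sorted_cat_cons // => /andP[su sz].
  have us i : i \in u -> (i <= j)%N.
    move: su; rewrite -cats1 (sorted_pairwise leoT) pairwise_cat => /and3P[+ _ _].
    by move=> /allrelP + iu => /(_ i j iu); apply; rewrite inE.
  have zs i : i \in z -> (j <= i)%N.
    by move: sz; rewrite /= path_sortedE // => /andP[/allP + _ iz] => /(_ i iz).
  have cnt i : (count_mem i u + (j == i) + count_mem i z = a i)%N.
    by rewrite -(fw i) wE count_cat /= addnA.
  have bxe : in_box a (vsum u, [set j]%SET).
    move=> i; rewrite /= vsum_coord inE; split=> //; move: (cnt i).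
    by rewrite eq_sym; case: (i == j) => /=; lia.
  have [r [rr rq]] := tiling_surj projE tT (in_box_points bxe (center_points R (vsum u, [set j]%SET))).
  have Vi i : i != j -> center R (vsum u, [set j]%SET) ord0 i = (count_mem i u)%:R.
    by move=> ij; rewrite mxE /= inE (negbTE ij) vsum_coord mul0r addr0.
  have rbox i : 0 <= r ord0 i <= (a i)%:R.
    by case: rr => c [/(tiling_box tT) bc rc]; exact: (in_box_points bc rc).
  have [||_ eqr] := @extremal_point (center R (vsum u, [set j]%SET)) r j _ _ rq.2.
  - move=> i ij; rewrite Vi -?val_eqE /= ?ltn_eqF //.
    have iz : i \notin z by apply/negP => /zs; rewrite leqNgt ij.
    move: (cnt i) (rbox i); rewrite (count_memPn iz) -val_eqE /= gtn_eqF // !addn0 => ->.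
    by move=> /andP[].
  - move=> i ij; rewrite Vi -?val_eqE /= ?gtn_eqF //.
    have iu : i \notin u by apply/negP => /us; rewrite leqNgt ij.
    by rewrite (count_memPn iu); case/andP: (rbox i).
  have rE := eqr rq.1; rewrite -[X in T X](center_carrier R) -rE; exact: (tiling_carrier tT).
have main u z : w = u ++ z -> path_in T (vsum u) z.
  elim: z u => [//|j z IH] u wE /=; split; first exact: edge wE.
  by rewrite -vsum_rcons; apply: IH; rewrite cat_rcons.
by have := main [::] w erefl; rewrite /vsum big_nil.
Qed.

End Paths.

(** * Sweeps *)

Section Sweeps.
Variables (R : realType) (n : nat) (a : 'I_n -> nat).
Variables C S : 'I_n -> R.
Local Notation cross := (vcross C S).
Hypothesis S_gt0 : forall i, 0 < S i.
Hypothesis cross_gt0 : forall i j : 'I_n, (i < j)%N -> 0 < cross i j.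
Implicit Types (p q r : 'rV[R]_n) (c d : cell n) (V : 'rV[int]_n) (T : set (cell n)).
Implicit Types (u w z : seq 'I_n) (h x : R).

Local Notation E i := (delta_mx ord0 i : 'rV[R]_n).
Local Notation e := (@basis_vec n).

(* The abscissa at height h of the path with word w starting at the origin. *)
Fixpoint fpath w h : R := if w is j :: w' then
  if h <= S j then h * (C j / S j) else C j + fpath w' (h - S j) else 0.

Lemma fpath0 w : fpath w 0 = 0.
Proof. by case: w => //= j w; rewrite ltW ?mul0r. Qed.

Lemma fpath_ge j w h : S j <= h -> fpath (j :: w) h = C j + fpath w (h - S j).
Proof.
move=> /= hj; case: ifP => // hj'; have -> : h = S j by apply/eqP; rewrite eq_le hj hj'.
by rewrite subrr fpath0 addr0 mulrC divfK // gt_eqF.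
Qed.

Definition wsum (f : 'I_n -> R) u := \sum_(j <- u) f j.

Lemma wsum_cons f j u : wsum f (j :: u) = f j + wsum f u.
Proof. exact: big_cons. Qed.

Lemma wsum_ge0 u : 0 <= wsum S u.
Proof. by apply: sumr_ge0 => j _; exact: ltW. Qed.

Lemma fpath_cat u w h : 0 <= h -> fpath (u ++ w) (wsum S u + h) = wsum C u + fpath w h.
Proof.
move=> h0; elim: u => [|j u IH]; first by rewrite /wsum !big_nil !add0r.
rewrite cat_cons fpath_ge !wsum_cons; last by rewrite -addrA lerDl addr_ge0 // wsum_ge0.
have -> : S j + wsum S u + h - S j = wsum S u + h by ring.
by rewrite IH addrA.
Qed.

Lemma rvecD V V' : rvec R (V + V') = rvec R V + rvec R V'.
Proof. by apply/rowP => i; rewrite !mxE intrD. Qed.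

Lemma rvec_basis j : rvec R (e j) = E j.
Proof. by apply/rowP => i; rewrite !mxE; case: (_ && _). Qed.

Lemma lin_vsum f u : lin f (rvec R (vsum u)) = wsum f u.
Proof.
elim: u => [|j u IH].
  by rewrite /vsum /wsum !big_nil /lin big1 // => i _; rewrite !mxE mul0r.
by rewrite wsum_cons -IH /vsum big_cons rvecD linD rvec_basis lin_delta.
Qed.

Let sl j := C j / S j.

Let slK j : sl j * S j = C j.
Proof. by rewrite /sl divfK // gt_eqF. Qed.

Let sl_lt (j k : 'I_n) : (j < k)%N -> sl k < sl j.
Proof.
move=> /cross_gt0; rewrite /vcross subr_gt0 => lt.
by rewrite /sl ltr_pdivrMr // mulrAC ltr_pdivlMr // mulrC.
Qed.

(** The minimum is the height climbed along [j]; the rest is climbed with the inverse slope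
    [sl k]. *)
Lemma fpath2 (j k : 'I_n) z h : 0 <= h <= S j + S k ->
  fpath (j :: k :: z) h = h * sl k + Num.min h (S j) * (sl j - sl k).
Proof.
move=> /andP[h0 hjk] /=; case: ifP => hj; first by rewrite min_l // -/(sl j); ring.
rewrite min_r; last by rewrite ltW // ltNge hj.
have -> : h - S j <= S k by lra.
by rewrite -/(sl k) -(slK j); ring.
Qed.

(** Direction [j] leans more to the right than [k], so climbing [j] first keeps the path on the
    right. *)
Lemma fpath_swap_le u (j k : 'I_n) z h : (j < k)%N -> 0 <= h ->
  fpath (u ++ k :: j :: z) h <= fpath (u ++ j :: k :: z) h.
Proof.
move=> jk; elim: u h => [|i u IH] h h0; last first.
  rewrite /=; case: (leP h (S i)) => // hi; rewrite lerD2l IH //; lra.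
have Sj := S_gt0 j; have Sk := S_gt0 k.
have [hle|hgt] := leP h (S j + S k); last first.
  rewrite !cat0s fpath_ge; last by lra.
  rewrite fpath_ge; last by lra.
  rewrite [leRHS]fpath_ge; last by lra.
  rewrite [fpath (k :: z) _]fpath_ge; last by lra.
  have -> : h - S k - S j = h - S j - S k by ring.
  by lra.
rewrite !cat0s fpath2; last by rewrite h0 addrC.
rewrite fpath2 ?h0 //; have lt := sl_lt jk.
have -> : h * sl j + Num.min h (S k) * (sl k - sl j) =
  h * sl k + (h - Num.min h (S k)) * (sl j - sl k) by ring.
rewrite lerD2l ler_wpM2r //; first by lra.
by rewrite lerBlDr; case: (leP h (S k)) => h1; case: (leP h (S j)) => h2; lra.
Qed.

(* The middle vertex of the other side of a hexagon is strictly on the left. *)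
Lemma fpath_middle (j k : 'I_n) z : (j < k)%N -> C k < fpath (j :: k :: z) (S k).
Proof.
move=> jk; have Sj := S_gt0 j; have Sk := S_gt0 k.
rewrite fpath2; last by apply/andP; split; lra.
rewrite mulrC slK ltrDl mulr_gt0 ?subr_gt0 ?sl_lt //.
by case: (leP (S k) (S j)).
Qed.

Lemma fpath_corner (j k : 'I_n) z : (j < k)%N -> fpath (k :: j :: z) (S j) <= C j.
Proof.
move=> jk; have Sj := S_gt0 j; have Sk := S_gt0 k.
apply: le_trans (fpath_swap_le [::] z jk (ltW Sj)) _.
by rewrite cat0s fpath_ge // subrr fpath0 addr0.
Qed.

Lemma tile_between u (j k : 'I_n) z h x : (j < k)%N -> 0 <= h ->
  fpath (u ++ k :: j :: z) h < x <= fpath (u ++ j :: k :: z) h ->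
  exists al be, [/\ 0 <= al <= 1, 0 <= be <= 1,
    x = wsum C u + al * C j + be * C k & h = wsum S u + al * S j + be * S k].
Proof.
move=> jk; elim: u h x => [|i u IH] h x h0.
  rewrite !cat0s /wsum !big_nil; have Sj := S_gt0 j; have Sk := S_gt0 k.
  have [hle|hgt] := leP h (S j + S k); last first.
    rewrite fpath_ge; last by lra.
    rewrite fpath_ge; last by lra.
    rewrite [fpath (j :: k :: z) h]fpath_ge; last by lra.
    rewrite [fpath (k :: z) _]fpath_ge; last by lra.
    have -> : h - S k - S j = h - S j - S k by ring.
    by move=> /andP[h1 h2]; exfalso; lra.
  rewrite !fpath2 ?h0 //= 1?addrC //.
  have -> : Num.min h (S k) * (sl k - sl j) + h * sl j =
    h * sl k + (h - Num.min h (S k)) * (sl j - sl k) by ring.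
  have dl : 0 < sl j - sl k by rewrite subr_gt0 sl_lt.
  (* [y] is the height to be climbed along [j], and [h - y] the one along [k]; the two paths confine
     them to the sides of the parallelogram. *)
  move=> /andP[x1 x2]; pose y := (x - h * sl k) / (sl j - sl k).
  have yE : y * (sl j - sl k) = x - h * sl k by rewrite /y divfK // gt_eqF.
  have y1 : h - Num.min h (S k) <= y by rewrite -(ler_pM2r dl) yE; lra.
  have y2 : y <= Num.min h (S j) by rewrite -(ler_pM2r dl) yE; lra.
  have [m1 m2] : Num.min h (S j) <= S j /\ Num.min h (S j) <= h.
    by split; case: (leP h (S j)) => // /ltW.
  have [m3 m4] : Num.min h (S k) <= S k /\ Num.min h (S k) <= h.
    by split; case: (leP h (S k)) => // /ltW.
  exists (y / S j), ((h - y) / S k); split.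
  - by apply/andP; split; [apply: divr_ge0; lra|rewrite ler_pdivrMr // mul1r; lra].
  - by apply/andP; split; [apply: divr_ge0; lra|rewrite ler_pdivrMr // mul1r; lra].
  - have -> : y / S j * C j = y * sl j by rewrite /sl; ring.
    have -> : (h - y) / S k * C k = (h - y) * sl k by rewrite /sl; ring.
    by lra.
  - by rewrite !divfK ?gt_eqF //; ring.
rewrite !cat_cons /=; case: (leP h (S i)) => hi; first by move=> /andP[h1 h2]; exfalso; lra.
move=> xb; have [||al [be [al1 be1 xE hE]]] := IH (h - S i) (x - C i); first by lra.
  by move: xb => /andP[h1 h2]; apply/andP; split; lra.
by exists al, be; split=> //; rewrite wsum_cons; lra.
Qed.

(** The word must be nonempty, since an empty path puts no cell in [T]. *)
Lemma path_point T V w h : path_in T V w -> (0 < size w)%N -> 0 <= h <= wsum S w ->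
  exists q, [/\ @realization R n T q, lin C q = lin C (rvec R V) + fpath w h &
                lin S q = lin S (rvec R V) + h].
Proof.
elim: w V h => // j w IH V h [Tj wT] _ /andP[h0 hw]; have Sj := S_gt0 j.
rewrite /=; case: leP => hj.
  exists (rvec R V + (h / S j) *: E j); split.
  - exists (V, [set j]%SET); split=> //; apply/cell_pointsP => i.
    rewrite rvecD_coord !mxE eqxx /= inE.
    have h1 : 0 <= h / S j <= 1.
      by rewrite divr_ge0 //= ?(ltW Sj) // ler_pdivrMr // mul1r.
    case: (i == j) => /=; last by rewrite mulr0 !addr0 lexx.
    by move: h1 => /andP[h1 h2]; apply/andP; split; lra.
  - by rewrite linD linZ lin_delta; ring.
  - by rewrite linD linZ lin_delta divfK // gt_eqF.
rewrite wsum_cons in hw.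
have [||q [rq qC qS]] := IH (V + e j) (h - S j) wT.
- by case: w hw {IH wT} => //; rewrite /wsum big_nil; lra.
- by apply/andP; split; lra.
exists q; split=> //; rewrite ?qC ?qS rvecD linD rvec_basis lin_delta; ring.
Qed.

(** With [le] a parameter, both boundary paths are treated at once. At height [h] the letters before
    [j] are used up and those after [j] not begun, the shape needed by [extremal_point]. *)
Lemma sorted_path_point (le : rel 'I_n) w h : reflexive le -> transitive le ->
  sorted le w -> (0 < size w)%N -> 0 <= h <= wsum S w ->
  exists r j, [/\ j \in w, lin S r = h, lin C r = fpath w h,
    forall i, ~~ le j i -> r ord0 i = (count_mem i w)%:R &
    forall i, ~~ le i j -> r ord0 i = 0].
Proof.
move=> le_refl le_tr; elim: w h => // j w IH h /= sw _ /andP[h0 hw].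
have Sj := S_gt0 j; have := sw; rewrite path_sortedE // => /andP[/allP jw sw'].
case: leP => hj.
  exists ((h / S j) *: E j), j; split; rewrite ?inE ?eqxx // ?linZ ?lin_delta.
  - by rewrite divfK // gt_eqF.
  - by ring.
  - move=> i ji; rewrite !mxE eqxx /=; have [ij|ij] := eqVneq i j.
      by rewrite ij le_refl in ji.
    have iw : i \notin w by apply: contra ji => /jw.
    by rewrite mulr0 (count_memPn iw).
  - move=> i ji; rewrite !mxE eqxx /=; have [ij|ij] := eqVneq i j; rewrite ?mulr0 //.
    by rewrite ij le_refl in ji.
rewrite wsum_cons in hw.
have [||r [j' [j'w rS rC r1 r0]]] := IH (h - S j) sw'.
- by case: w hw {IH sw jw sw'} => //; rewrite /wsum big_nil; lra.
- by apply/andP; split; lra.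
exists (E j + r), j'; split; rewrite ?inE ?j'w ?orbT // ?linD ?lin_delta ?rS ?rC //; first by ring.
- by move=> i ji; rewrite !mxE eqxx /= (r1 i ji) natrD eq_sym.
- move=> i ij'; rewrite !mxE eqxx /= (r0 i ij') addr0.
  by case: eqP => // ij; move: ij'; rewrite ij jw.
Qed.

Lemma lin_full f w : full a w -> wsum f w = \sum_i (a i)%:R * f i.
Proof.
by move=> fw; rewrite -lin_vsum; apply: eq_bigr => i _; rewrite mxE vsum_coord fw.
Qed.

Lemma box_height w p : full a w -> @box R n a p -> 0 <= lin S p <= wsum S w.
Proof.
move=> fw bp; rewrite (lin_full S fw); apply/andP; split.
  by apply: sumr_ge0 => i _; case/andP: (bp i) => p0 _; rewrite mulr_ge0 // ltW.
by apply: ler_sum => i _; case/andP: (bp i) => _ p1; rewrite ler_wpM2r // ltW.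
Qed.

Lemma box_le_right_path w p : full a w -> (0 < size w)%N -> sorted (@leo n) w ->
  @box R n a p -> lin C p <= fpath w (lin S p).
Proof.
move=> fw w0 sw bp.
have [||r [j [jw rS rC r1 r0]]] := @sorted_path_point (@leo n) w (lin S p) _ _ sw w0 (box_height fw bp).
- by move=> i; rewrite /leo.
- by move=> x y z; exact: leq_trans.
have [|||le _] := @extremal_point R n C S S_gt0 cross_gt0 r p j.
- by move=> i ij; rewrite r1 ?fw; [case/andP: (bp i)|rewrite /leo -ltnNge].
- by move=> i ij; rewrite r0; [case/andP: (bp i)|rewrite /leo -ltnNge].
- by rewrite rS.
by rewrite -rC.
Qed.

Lemma box_ge_left_path w p : full a w -> (0 < size w)%N -> sorted (@geo n) w ->
  @box R n a p -> fpath w (lin S p) <= lin C p.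
Proof.
move=> fw w0 sw bp.
have [||r [j [jw rS rC r1 r0]]] := @sorted_path_point (@geo n) w (lin S p) _ _ sw w0 (box_height fw bp).
- by move=> i; rewrite /geo.
- by move=> x y z xy yz; exact: leq_trans yz xy.
have [|||le _] := @extremal_point R n C S S_gt0 cross_gt0 p r j.
- by move=> i ij; rewrite r0; [case/andP: (bp i)|rewrite /geo -ltnNge].
- by move=> i ij; rewrite r1 ?fw; [case/andP: (bp i)|rewrite /geo -ltnNge].
- by rewrite rS.
by rewrite -rC.
Qed.

(** [L] collects the tiles crossed while [w] is pushed, ascent by ascent, to the left boundary;
    their order is not recorded. *)
Inductive sweep : seq 'I_n -> set (cell n) -> Prop :=
| sweep_nil w of sorted (@geo n) w : sweep w set0
| sweep_cons u (j k : 'I_n) z L of (j < k)%N & sweep (u ++ k :: j :: z) L :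
    sweep (u ++ j :: k :: z) ([set (vsum u, [set j; k]%SET)] `|` L).

Lemma full_swap u (j k : 'I_n) z : full a (u ++ j :: k :: z) -> full a (u ++ k :: j :: z).
Proof. by move=> fw i; rewrite -(fw i) !count_cat /=; lia. Qed.

(** A point left of the path is either left of the pushed path or in the tile just crossed; after
    the last push it is squeezed onto the left boundary. [T] is merely closed under faces, so that
    an intersection can be taken for it. *)
Lemma sweep_cover w L T p : sweep w L -> full a w -> (0 < size w)%N ->
  (forall c d, T c -> face_of d c -> T d) -> path_in T 0 w -> L `<=` T ->
  @box R n a p -> lin C p <= fpath w (lin S p) ->
  exists q, @realization R n T q /\ same_proj C S q p.
Proof.
move=> sw fw w0 Tf + + bp; elim: sw fw w0 => {w L} [w sw|u j k z L jk _ IH] fw w0 pw LT le.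
  have [q [rq qC qS]] := path_point pw w0 (box_height fw bp).
  exists q; split=> //; rewrite /same_proj qC qS.
  have -> : rvec R 0 = 0 :> 'rV[R]_n by apply/rowP => i; rewrite !mxE.
  rewrite !lin0 !add0r; split=> //; apply/eqP; rewrite eq_le le andbT.
  exact: box_ge_left_path.
have Tt : T (vsum u, [set j; k]%SET) by apply: LT; left.
have njk : j != k by rewrite -val_eqE /= ltn_eqF.
have [le'|lt] := leP (lin C p) (fpath (u ++ k :: j :: z) (lin S p)).
  apply: IH => //; first exact: full_swap.
  - by move: w0; rewrite !size_cat.
  - by apply: path_in_step => //; rewrite add0r.
  - by move=> c Lc; apply: LT; right.
have [h0 _] := andP (box_height fw bp).
have [|al [be [al1 be1 xE hE]]] := tile_between jk h0 (x := lin C p) (u := u) (z := z).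
  by rewrite lt le.
exists (rvec R (vsum u) + (al *: E j + be *: E k)); split.
  exists (vsum u, [set j; k]%SET); split=> //; apply/cell_pointsP => i.
  rewrite rvecD_coord coord2 /= !inE; move: al1 be1 => /andP[? ?] /andP[? ?].
  have [->|ij] := eqVneq i j; first by rewrite (negbTE njk) /=; apply/andP; split; lra.
  by have [->|ik] := eqVneq i k => /=; apply/andP; split; lra.
by rewrite /same_proj !(linD _ (rvec R (vsum u))) !lin2 !lin_vsum xE hE !addrA.
Qed.

End Sweeps.

(** * Connectivity by flips *)

Section Connectivity.
Variables (R : realType) (n : nat) (a : 'I_n -> nat) (theta : 'I_n -> R).
Variables C S : 'I_n -> R.
Local Notation cross := (vcross C S).
Hypothesis projE : forall p, Defs.proj theta p = (lin C p, lin S p).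
Hypothesis S_gt0 : forall i, 0 < S i.
Hypothesis cross_gt0 : forall i j : 'I_n, (i < j)%N -> 0 < cross i j.
Implicit Types (c d : cell n) (U V : 'rV[int]_n) (T L : set (cell n)).
Implicit Types (u w z : seq 'I_n).

Local Notation e := (@basis_vec n).
Local Notation fpath := (fpath C S).
Local Notation fge := (@fpath_ge R n C S S_gt0).
Local Notation fcat := (@fpath_cat R n C S S_gt0).
Local Notation f0 := (@fpath0 R n C S S_gt0).

Lemma irow_eq (U V : 'rV[int]_n) : (forall i, U ord0 i = V ord0 i) -> U = V.
Proof. by move=> UV; apply/rowP => i; exact: UV. Qed.

Definition flips T T' := exists m s, flip_sequence a theta T T' m s.

Lemma flips_refl T : tiling a theta T -> flips T T.
Proof. by move=> tT; exists 0%N, (fun=> T); split. Qed.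

Lemma flips_trans T1 T2 T3 : flips T1 T2 -> flips T2 T3 -> flips T1 T3.
Proof.
move=> [m1 [s1 [s10 s1m tl1 fl1]]] [m2 [s2 [s20 s2m tl2 fl2]]].
exists (m1 + m2)%N, (fun i => if (i <= m1)%N then s1 i else s2 (i - m1)%N); split=> //.
- case: ifP => [le|_]; last by rewrite addKn.
  have m20 : m2 = 0%N by lia.
  by rewrite m20 addn0 s1m -s20 -{1}m20.
- by move=> i im; case: ifP => im1; [exact: tl1|apply: tl2; lia].
- move=> i im; case: (ltngtP i m1) => im1.
  + exact: fl1.
  + by rewrite subSn ?(ltnW im1) //; apply: fl2; lia.
  + by rewrite im1 subSn // subnn s1m -s20; apply: fl2; lia.
Qed.

Lemma flips_step T T' : tiling a theta T -> tiling a theta T' -> flip a T T' -> flips T T'.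
Proof.
move=> tT tT' fl; exists 1%N, (fun i => if i is 0%N then T else T'); split=> //.
  by case.
by case.
Qed.

Lemma flip_kernel_dir J (j k l : 'I_n) v v' T T' : flip_in a J j k l v v' T T' ->
  exists kappa, kernel_dir C S (cube J j k l) v kappa.
Proof.
case=> jkl _ vw _; have [kappa kd] := cube_kernel_dir cross_gt0 J jkl.
case: vw => [[-> _]|[-> _]]; first by exists kappa.
by exists (- kappa); apply: kernel_dir_opposite kd; exact: cube_opposite.
Qed.

Lemma flip_in_tiling J (j k l : 'I_n) v v' T T' : flip_in a J j k l v v' T T' ->
  tiling a theta T -> tiling a theta T'.
Proof.
move=> fl tT; have [c3 op] := flip_opposite fl; have [kappa kd] := flip_kernel_dir fl.
case: fl => _ bx _ [sub ->]; exact: flip_tiling kd _ _ _.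
Qed.

Lemma flip_in_new J (j k l : 'I_n) v v' T T' : flip_in a J j k l v v' T T' ->
  tiling a theta T -> ~ T (vertex v').
Proof.
move=> fl tT; have [c3 op] := flip_opposite fl; have [kappa kd] := flip_kernel_dir fl.
case: fl => _ bx _ [sub _]; exact: (opposite_vertex_notin projE c3 op kd tT sub).
Qed.

(** Only vertices are tested, and points of the path count as right of it. This suffices because a
    flip keeps every cell that does not contain the removed vertex. *)
Definition right_of w c := forall U, face_of (vertex U) c ->
  fpath w (lin S (rvec R U)) <= lin C (rvec R U).

Lemma edge_vertexP U V j : face_of (vertex U) (V, [set j]%SET) -> U = V \/ U = V + e j.
Proof.
move=> /vertex_faceP Uf; have [Uj|Uj] := eqVneq (U ord0 j) (V ord0 j); [left|right].
  apply: irow_eq => i; move: (Uf i) => /=; rewrite inE.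
  by have [->|ij] := eqVneq i j => /=; [rewrite Uj|lia].
apply: irow_eq => i; rewrite coord_addb; move: (Uf i) => /=; rewrite inE.
by have [->|ij] := eqVneq i j => /=; move: Uj; lia.
Qed.

Lemma tile_vertexP U V (j k : 'I_n) : j != k -> face_of (vertex U) (V, [set j; k]%SET) ->
  [\/ U = V, U = V + e j, U = V + e k | U = V + e j + e k].
Proof.
move=> jk /vertex_faceP Uf.
have Uo i : i != j -> i != k -> U ord0 i = V ord0 i.
  by move=> ij ik; move: (Uf i) => /=; rewrite !inE (negbTE ij) (negbTE ik) /=; lia.
have Uj := Uf j; rewrite /= !inE eqxx /= in Uj.
have Uk := Uf k; rewrite /= !inE eqxx orbT /= in Uk.
have row (b b' : bool) : U ord0 j = V ord0 j + b%:Z -> U ord0 k = V ord0 k + b'%:Z ->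
    forall i, U ord0 i = V ord0 i + (b && (i == j))%:Z + (b' && (i == k))%:Z.
  move=> Ej Ek i; have [->|ij] := eqVneq i j.
    by rewrite Ej (negbTE jk) andbF andbT addr0.
  by have [->|ik] := eqVneq i k; rewrite ?andbT ?andbF ?addr0 ?Ek ?Uo.
have [Ej|Ej] := eqVneq (U ord0 j) (V ord0 j); have [Ek|Ek] := eqVneq (U ord0 k) (V ord0 k).
- constructor 1; apply: irow_eq => i; rewrite (row false false) ?addr0 //.
- constructor 3; apply: irow_eq => i; rewrite (row false true) ?coord_addb ?addr0 //; lia.
- constructor 2; apply: irow_eq => i; rewrite (row true false) ?coord_addb ?addr0 //; lia.
- constructor 4; apply: irow_eq => i; rewrite (row true true) ?coord_addb //; lia.
Qed.

Lemma lin_vsum1 (f : 'I_n -> R) u j : lin f (rvec R (vsum u + e j)) = wsum f u + f j.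
Proof. by rewrite rvecD linD lin_vsum rvec_basis lin_delta. Qed.

Lemma lin_vsum2 (f : 'I_n -> R) u j k :
  lin f (rvec R (vsum u + e j + e k)) = wsum f u + (f j + f k).
Proof. by rewrite !rvecD !linD lin_vsum !rvec_basis !lin_delta addrA. Qed.

Lemma fpath_vertex u z : fpath (u ++ z) (wsum S u) = wsum C u.
Proof. by rewrite -[wsum S u]addr0 fcat // f0 addr0. Qed.

Lemma right_of_edge u j z : right_of (u ++ j :: z) (vsum u, [set j]%SET).
Proof.
move=> U /edge_vertexP[->|->]; first by rewrite !lin_vsum fpath_vertex.
by rewrite !lin_vsum1 fcat ?(ltW (S_gt0 j)) // fge // subrr f0 addr0.
Qed.

Lemma right_of_tile u (j k : 'I_n) z : (j < k)%N ->
  right_of (u ++ k :: j :: z) (vsum u, [set j; k]%SET).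
Proof.
move=> jk; have njk : j != k by rewrite -val_eqE /= ltn_eqF.
move=> U /(tile_vertexP njk)[->|->|->|->].
- by rewrite !lin_vsum fpath_vertex.
- by rewrite !lin_vsum1 fcat ?(ltW (S_gt0 j)) // lerD2l fpath_corner.
- by rewrite !lin_vsum1 fcat ?(ltW (S_gt0 k)) // fge // subrr f0 addr0.
- have Sj := S_gt0 j; have Sk := S_gt0 k.
  rewrite !lin_vsum2 fcat; last by lra.
  rewrite fge; last by lra.
  have -> : S j + S k - S k = S j by ring.
  by rewrite fge // subrr f0; lra.
Qed.

Lemma right_of_step u (j k : 'I_n) z c : (j < k)%N -> in_box a c ->
  right_of (u ++ j :: k :: z) c -> right_of (u ++ k :: j :: z) c.
Proof.
move=> jk bc rc U Uc; apply: le_trans (rc U Uc); apply: fpath_swap_le => //.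
apply: sumr_ge0 => i _; rewrite mxE mulr_ge0 ?ler0z ?(ltW (S_gt0 i)) //.
by case/andP: (in_box_vertex bc Uc i).
Qed.

Lemma path_kept T T' w : path_in T 0 w -> (forall c, T c -> right_of w c -> T' c) ->
  path_in T' 0 w.
Proof.
move=> + kept; suff main u z : w = u ++ z -> path_in T (vsum u) z -> path_in T' (vsum u) z.
  by move=> pw; have := main [::] w erefl; rewrite /vsum big_nil; exact.
elim: z u => // j z IH u wE [Tj pz]; split.
  by apply: kept => //; rewrite wE; exact: right_of_edge.
by rewrite -vsum_rcons; apply: IH; rewrite ?cat_rcons ?vsum_rcons.
Qed.

Lemma face_fix d V V' (A A' : {set 'I_n}) i : face_of d (V, A) -> i \notin d.2 ->
  V' ord0 i = d.1 ord0 i -> (forall i', i' != i -> V' ord0 i' = V ord0 i') ->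
  (forall i', i' != i -> i' \in A -> i' \in A') -> face_of d (V', A').
Proof.
move=> [/fintype.subsetP sA dV] id Vi Vo Ao; split=> /= [|i'].
  apply/fintype.subsetP => i' i'd; apply: Ao; last exact: sA.
  by apply: contraNneq id => <-.
have [->|ii] := eqVneq i' i; first by rewrite Vi lexx lerDl.
rewrite Vo //; move: (dV i'); rewrite /= !inE; move: (Ao i' ii).
by case: (i' \in A) => [-> //|_]; case: (i' \notin d.2); case: (i' \in A') => /=; lia.
Qed.

Lemma faces_at_tiles J (j k l : 'I_n) v T : (j < k < l)%N ->
  (forall c d, T c -> face_of d c -> T d) -> face_of (vertex v) (cube J j k l) ->
  (forall i (V : 'rV[int]_n) (A : {set 'I_n}), i \in (cube J j k l).2 ->
     V ord0 i = v ord0 i -> (forall i', i' != i -> V ord0 i' = J ord0 i') ->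
     A = ((cube J j k l).2 :\ i)%SET -> T (V, A)) ->
  faces_at (cube J j k l) v `<=` T.
Proof.
move=> jkl Tf vc tiles d /(faces_atP _ (card_cube J jkl) vc)[dc [i ic /andP[id /eqP di]]].
pose V : 'rV[int]_n := \row_i' if i' == i then v ord0 i else J ord0 i'.
have Vi : V ord0 i = v ord0 i by rewrite mxE eqxx.
have Vo i' : i' != i -> V ord0 i' = J ord0 i' by rewrite mxE => /negbTE ->.
apply: (Tf (V, ((cube J j k l).2 :\ i)%SET)); first exact: tiles ic Vi Vo erefl.
apply: face_fix dc id _ Vo _; first by rewrite Vi di.
by move=> i' ii ic'; rewrite in_setD1 ii.
Qed.

(** * Flips in the hexagon of three consecutive letters *)

Section Hexagon.
Variables (u z : seq 'I_n) (j k l : 'I_n) (T : set (cell n)).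
Hypothesis jkl : (j < k < l)%N.
Hypothesis fw : full a (u ++ j :: k :: l :: z).
Hypothesis tT : tiling a theta T.
Local Notation J := (vsum u).
Local Notation w := (u ++ j :: k :: l :: z).

Let jk : (j < k)%N. Proof. by case/andP: jkl. Qed.
Let kl : (k < l)%N. Proof. by case/andP: jkl. Qed.
Let jl : (j < l)%N. Proof. exact: ltn_trans jk kl. Qed.
Let njk : (j == k) = false. Proof. by rewrite -val_eqE /= ltn_eqF. Qed.
Let nkl : (k == l) = false. Proof. by rewrite -val_eqE /= ltn_eqF. Qed.
Let njl : (j == l) = false. Proof. by rewrite -val_eqE /= ltn_eqF. Qed.
Let nkj : (k == j) = false. Proof. by rewrite eq_sym. Qed.
Let nlk : (l == k) = false. Proof. by rewrite eq_sym. Qed.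
Let nlj : (l == j) = false. Proof. by rewrite eq_sym. Qed.

Lemma word_cube_box : in_box a (cube J j k l).
Proof.
move=> i; have := fw i; rewrite /cube /= !inE vsum_coord count_cat /=.
rewrite ![_ == i]eq_sym => cnt; split=> //; move: cnt.
have [ij|ij] := eqVneq i j; first by rewrite /=; lia.
have [ik|ik] := eqVneq i k; first by rewrite /=; lia.
by have [il|il] := eqVneq i l; rewrite /=; lia.
Qed.

(** Both middle vertices lie strictly left of [w], so no cell right of [w] contains the removed
    one. *)
Lemma hexagon_flip v v' :
  (v = bottom_vertex J j k l /\ v' = top_vertex J j k l) \/
  (v = top_vertex J j k l /\ v' = bottom_vertex J j k l) ->
  faces_at (cube J j k l) v `<=` T ->
  exists T', [/\ flips T T', tiling a theta T', faces_at (cube J j k l) v' `<=` T' &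
    forall c, T c -> right_of w c -> T' c].
Proof.
move=> vv sub; pose T' := (T `\` faces_at (cube J j k l) v) `|` faces_at (cube J j k l) v'.
have fl : flip_in a J j k l v v' T T' by split=> //; exact: word_cube_box.
have tT' := flip_in_tiling fl tT.
have [c3 op] := flip_opposite fl.
exists T'; split=> //; first by apply: flips_step => //; exists J, j, k, l, v, v'.
  by move=> d fd; right.
move=> c Tc rc; apply: faces_at_kept => //.
move=> /rc; apply/negP; rewrite -ltNge.
have Sj := S_gt0 j; have Sk := S_gt0 k; have Sl := S_gt0 l.
case: vv => [[-> _]|[-> _]]; rewrite /bottom_vertex /top_vertex.
  by rewrite !lin_vsum1 fcat ?ltrD2l ?fpath_middle // ltW.
rewrite !lin_vsum2 fcat ?addr_ge0 ?ltW // ltrD2l fge ?lerDl ?ltW //.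
have -> : S j + S l - S j = S l by ring.
by rewrite ltrD2l fpath_middle.
Qed.

(** The three tiles are those crossed when [j k l] is pushed through [k j l] and [k l j] to
    [l k j]. *)
Lemma bottom_faces_sub : T (J, [set j; k]%SET) -> T (J + e k, [set j; l]%SET) ->
  T (J, [set k; l]%SET) -> faces_at (cube J j k l) (bottom_vertex J j k l) `<=` T.
Proof.
move=> T1 T2 T3; apply: faces_at_tiles => //; first exact: tiling_face tT.
  exact/opposite_vertex/cube_opposite.
move=> i V A; rewrite /cube /bottom_vertex /= !inE coord_addb => ijkl Vi Vo ->.
have VE V' : V' ord0 i = V ord0 i -> (forall i', i' != i -> V' ord0 i' = J ord0 i') -> V = V'.
  move=> Ei Eo; apply: irow_eq => i'; have [->|ii] := eqVneq i' i; first by rewrite Ei.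
  by rewrite Eo // Vo.
case/orP: ijkl => [/orP[/eqP ij|/eqP ik]|/eqP il].
- rewrite (VE J) //; last by rewrite Vi ij njk addr0.
  have -> // : ([set j; k; l] :\ i)%SET = [set k; l]%SET.
  by apply/setP => i'; rewrite !inE ij; case: eqP => // ->; rewrite njk njl.
- rewrite (VE (J + e k)) //; last first.
  + by move=> i' ii; rewrite coord_addb -ik (negbTE ii) addr0.
  + by rewrite Vi coord_addb.
  have -> // : ([set j; k; l] :\ i)%SET = [set j; l]%SET.
  by apply/setP => i'; rewrite !inE ik; case: eqP => //= [->|_]; rewrite ?nkj ?nkl ?orbF.
- rewrite (VE J) //; last by rewrite Vi il nlk addr0.
  have -> // : ([set j; k; l] :\ i)%SET = [set j; k]%SET.
  by apply/setP => i'; rewrite !inE il; case: eqP => //= [->|_]; rewrite ?nlj ?nlk ?orbF.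
Qed.

(** These are the tiles of the other route, through [j l k] and [l j k]. *)
Lemma top_faces_sub : T (J + e j, [set k; l]%SET) -> T (J, [set j; l]%SET) ->
  T (J + e l, [set j; k]%SET) -> faces_at (cube J j k l) (top_vertex J j k l) `<=` T.
Proof.
move=> T1 T2 T3; apply: faces_at_tiles => //; first exact: tiling_face tT.
  exact/opposite_vertex/opposite_sym/cube_opposite.
move=> i V A; rewrite /cube /top_vertex /= !inE !coord_addb => ijkl Vi Vo ->.
have VE V' : V' ord0 i = V ord0 i -> (forall i', i' != i -> V' ord0 i' = J ord0 i') -> V = V'.
  move=> Ei Eo; apply: irow_eq => i'; have [->|ii] := eqVneq i' i; first by rewrite Ei.
  by rewrite Eo // Vo.
case/orP: ijkl => [/orP[/eqP ij|/eqP ik]|/eqP il].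
- rewrite (VE (J + e j)) //; last first.
  + by move=> i' ii; rewrite coord_addb -ij (negbTE ii) addr0.
  + by rewrite Vi coord_addb ij njl addr0.
  have -> // : ([set j; k; l] :\ i)%SET = [set k; l]%SET.
  by apply/setP => i'; rewrite !inE ij; case: eqP => // ->; rewrite njk njl.
- rewrite (VE J) //; last by rewrite Vi ik nkl nkj !addr0.
  have -> // : ([set j; k; l] :\ i)%SET = [set j; l]%SET.
  by apply/setP => i'; rewrite !inE ik; case: eqP => //= [->|_]; rewrite ?nkj ?nkl ?orbF.
- rewrite (VE (J + e l)) //; last first.
  + by move=> i' ii; rewrite coord_addb -il (negbTE ii) addr0.
  + by rewrite Vi coord_addb il nlj addr0.
  have -> // : ([set j; k; l] :\ i)%SET = [set j; k]%SET.
  by apply/setP => i'; rewrite !inE il; case: eqP => //= [->|_]; rewrite ?nlj ?nlk ?orbF.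
Qed.

Lemma bottom_first_tile :
  faces_at (cube J j k l) (bottom_vertex J j k l) (J, [set j; k]%SET).
Proof.
have vc := opposite_vertex (cube_opposite J jkl).
apply/(faces_atP _ (card_cube J jkl) vc); split.
  split=> [|i]; last by rewrite /= lexx lerDl.
  by apply/fintype.subsetP => i; rewrite !inE => ->.
by exists l; rewrite !inE ?eqxx ?orbT // nlj nlk /bottom_vertex coord_addb nlk addr0 eqxx.
Qed.

Lemma top_first_tile :
  faces_at (cube J j k l) (top_vertex J j k l) (J + e j, [set k; l]%SET).
Proof.
have vc := opposite_vertex (opposite_sym (cube_opposite J jkl)).
apply/(faces_atP _ (card_cube J jkl) vc); split.
  split=> [|i] /=.
    by apply/fintype.subsetP => i; rewrite !inE => /orP[] ->; rewrite ?orbT.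
  rewrite coord_addb !inE; have [->|ij] := eqVneq i j; first by rewrite njk njl /=; lia.
  by rewrite addr0 lexx lerDl.
by exists j; rewrite !inE ?eqxx // njk njl /top_vertex !coord_addb njl addr0 eqxx.
Qed.

End Hexagon.

Fixpoint ninv w : nat :=
  if w is j :: w' then (count (fun i : 'I_n => j < i)%N w' + ninv w')%N else 0%N.

Lemma ninv_swap u (j k : 'I_n) z : (j < k)%N ->
  ninv (u ++ j :: k :: z) = (ninv (u ++ k :: j :: z)).+1.
Proof.
move=> jk; elim: u => [|i u IH] /=; last by rewrite IH !count_cat /= ; lia.
by rewrite jk ltnNge (ltnW jk) /=; lia.
Qed.

Lemma sweep_exists w : exists L, sweep w L.
Proof.
have [N] := ubnP (ninv w); elim: N w => // N IH w; rewrite ltnS => leN.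
case: (boolP (sorted (@geo n) w)) => [sw|]; first by exists set0; constructor.
move=> /not_sorted_ascent[u [j [k [z [wE jk _]]]]].
have [|L sL] := IH (u ++ k :: j :: z); first by rewrite -(ninv_swap _ _ jk) -wE.
by exists ([set (vsum u, [set j; k]%SET)] `|` L); rewrite wE; constructor.
Qed.

(** Two pairs of adjacent letters coincide, overlap in one letter, or are disjoint: respectively
    nothing to do, a hexagon, or a commutation in [sweep_connect]. *)
Lemma cat2_eq u (j k : 'I_n) z u' j' k' z' : u ++ j :: k :: z = u' ++ j' :: k' :: z' ->
  [/\ u = u', j = j', k = k' & z = z'] \/
  ([/\ u' = rcons u j, j' = k & z = k' :: z'] \/ [/\ u = rcons u' j', j = k' & z' = k :: z]) \/
  ((exists x, u' = u ++ j :: k :: x /\ z = x ++ j' :: k' :: z') \/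
   (exists x, u = u' ++ j' :: k' :: x /\ z' = x ++ j :: k :: z)).
Proof.
elim: u u' => [|i u IH] [|i' u'] /=.
- by move=> [-> -> ->]; left.
- case=> -> ; case: u' => [|i'' u''] /= [-> E0]; first by right; left; left; rewrite E0.
  by right; right; left; exists u''.
- case=> <-; case: u {IH} => [|i'' u''] /= [<- E0]; first by right; left; right; rewrite -E0.
  by right; right; right; exists u''.
- case=> -> /IH[[-> -> -> ->]|[[[-> -> ->]|[-> -> ->]]|[[x [-> ->]]|[x [-> ->]]]]].
  + by left.
  + by right; left; left.
  + by right; left; right.
  + by right; right; left; exists x.
  + by right; right; right; exists x.
Qed.

(* Two ascents of w at distance at least two commute and two adjacent ones span
   a hexagon, so the next tile can be prescribed at the price of flips on the
   left of w. *)
Lemma sweep_connect w L T : tiling a theta T -> full a w -> path_in T 0 w -> sweep w L ->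
  exists T', [/\ flips T T', tiling a theta T',
    forall c, T c -> right_of w c -> T' c & L `<=` T'].
Proof.
have [N] := ubnP (ninv w); elim: N w L T => // N IH w L T; rewrite ltnS => leN tT fw pw sw.
case: sw leN fw pw => {w L} [w _|u j k z L jk sL] leN fw pw.
  by exists T; split=> //; exact: flips_refl.
set w := u ++ j :: k :: z in leN fw pw *.
have ninv_lt u' (j' k' : 'I_n) z' : (j' < k')%N -> w = u' ++ j' :: k' :: z' ->
    (ninv (u' ++ k' :: j' :: z') < N)%N.
  by move=> jk' wE; rewrite -(ninv_swap _ _ jk') -wE.
have neq (i i' : 'I_n) : (i < i')%N -> i != i' by move=> ii; rewrite -val_eqE /= ltn_eqF.
(* It is enough to bring the first tile of the sweep into the tiling; the induction hypothesis for
   the pushed word does the rest. *)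
have [T1 [fl1 tT1 kept1 Tp]] : exists T1, [/\ flips T T1, tiling a theta T1,
    forall c, T c -> right_of w c -> T1 c & T1 (vsum u, [set j; k]%SET)].
  have [|u2 [j2 [k2 [z2 [wE jk2 Tq]]]]] := ascent_tile projE S_gt0 cross_gt0 tT fw pw.
    apply/negP; rewrite /w => sw; have geoT : transitive (@geo n).
      by move=> x y t xy yt; exact: leq_trans yt xy.
    move: sw; rewrite (sorted_pairwise geoT) pairwise_cat => /and3P[_ _].
    by rewrite /= /geo leqNgt jk.
  have Tface := tiling_face tT.
  have fw2 : full a (u2 ++ k2 :: j2 :: z2) by apply: full_swap; rewrite -wE.
  have pw2 : path_in T 0 (u2 ++ k2 :: j2 :: z2).
    by apply: path_in_step => //; rewrite ?add0r ?neq // -wE.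
  (* After pushing over the tile that [T] already has, any sweep of the pushed word can be realized,
     and the tile survives because it is right of that word. *)
  have via L2 : sweep (u2 ++ k2 :: j2 :: z2) L2 -> exists T2, [/\ flips T T2,
      tiling a theta T2, forall c, T c -> right_of w c -> T2 c, L2 `<=` T2 &
      T2 (vsum u2, [set j2; k2]%SET)].
    move=> sw2; have [T2 [fl2 tT2 kept2 sub2]] := IH _ _ T (ninv_lt _ _ _ _ jk2 wE) tT fw2 pw2 sw2.
    exists T2; split=> //; last by apply: kept2 => //; exact: right_of_tile.
    move=> c Tc rc; apply: kept2 => //; apply: right_of_step => //.
      exact: tiling_box tT _ Tc.
    by rewrite -wE.
  case: (cat2_eq wE) => 
    [[uE jE kE zE]|[[[uE jE zE]|[uE jE zE]]|[[x [uE zE]]|[x [uE zE]]]]].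
  - exists T; split=> //; first exact: flips_refl.
    by rewrite uE jE kE.
  - (* w = u j k k2 z2 and T has the tile {k, k2}: complete the top hexagon *)
    have [L2 sL2] := sweep_exists (u ++ k2 :: k :: j :: z2).
    have jl : (j < k2)%N by rewrite -jE in jk; exact: ltn_trans jk jk2.
    have [|T2 [fl2 tT2 kept2 sub2 Tq2]] := via
        ([set (vsum u, [set j; k2]%SET)] `|` ([set (vsum (rcons u k2), [set j; k]%SET)] `|` L2)).
      rewrite uE jE cat_rcons; constructor=> //.
      by rewrite -cat_rcons; constructor=> //; rewrite cat_rcons.
    have jkl : (j < k < k2)%N by rewrite jk -jE.
    have fw' : full a (u ++ j :: k :: k2 :: z2) by rewrite -zE.
    have [||T3 [fl3 tT3 sub3 kept3]] := @hexagon_flip u z2 j k k2 T2 jkl fw' tT2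
        (top_vertex (vsum u) j k k2) (bottom_vertex (vsum u) j k k2).
    + by right.
    + apply: top_faces_sub => //.
      * by move: Tq2; rewrite uE vsum_rcons jE.
      * by apply: sub2; left.
      * by apply: sub2; right; left; rewrite vsum_rcons.
    exists T3; split=> //; first exact: flips_trans fl3.
      by move=> c Tc rc; apply: kept3; [exact: kept2|rewrite -zE].
    by apply: sub3; exact: bottom_first_tile.
  - (* w = u2 j2 j k z and T has the tile {j2, j}: complete the bottom hexagon *)
    have [L2 sL2] := sweep_exists (u2 ++ k :: j :: j2 :: z).
    have jl : (j2 < k)%N by apply: ltn_trans jk; rewrite jE.
    have [|T2 [fl2 tT2 kept2 sub2 Tq2]] := via
        ([set (vsum (rcons u2 j), [set j2; k]%SET)] `|` ([set (vsum u2, [set j; k]%SET)] `|` L2)).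
      rewrite zE -jE -cat_rcons; constructor=> //.
      by rewrite cat_rcons; constructor=> //.
    have jkl : (j2 < j < k)%N by rewrite jk jE jk2.
    have wE' : w = u2 ++ j2 :: j :: k :: z by rewrite /w uE cat_rcons.
    have fw' : full a (u2 ++ j2 :: j :: k :: z) by rewrite -wE'.
    have [||T3 [fl3 tT3 sub3 kept3]] := @hexagon_flip u2 z j2 j k T2 jkl fw' tT2
        (bottom_vertex (vsum u2) j2 j k) (top_vertex (vsum u2) j2 j k).
    + by left.
    + apply: bottom_faces_sub => //.
      * by rewrite jE.
      * by apply: sub2; left; rewrite vsum_rcons.
      * by apply: sub2; right; left.
    exists T3; split=> //; first exact: flips_trans fl3.
      by move=> c Tc rc; apply: kept3; [exact: kept2|rewrite -wE'].
    by apply: sub3; rewrite uE vsum_rcons; exact: top_first_tile.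
  (* Disjoint ascents: after the push over the available tile the wanted ascent is still present, so
     a sweep beginning with its tile can be prescribed. *)
  - have [L2 sL2] := sweep_exists (u ++ k :: j :: x ++ k2 :: j2 :: z2).
    have [|T2 [fl2 tT2 kept2 sub2 _]] := via ([set (vsum u, [set j; k]%SET)] `|` L2).
      by rewrite uE -catA; constructor.
    by exists T2; split=> //; apply: sub2; left.
  - have [L2 sL2] := sweep_exists ((u2 ++ k2 :: j2 :: x) ++ k :: j :: z).
    have [|T2 [fl2 tT2 kept2 sub2 _]] := via ([set (vsum (u2 ++ k2 :: j2 :: x), [set j; k]%SET)] `|` L2).
      rewrite zE.
      have -> : u2 ++ k2 :: j2 :: x ++ j :: k :: z = (u2 ++ k2 :: j2 :: x) ++ j :: k :: z.
        by rewrite -catA.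
      by constructor.
    (* The base point of a tile does not depend on the order of the letters before it. *)
    exists T2; split=> //; apply: sub2; left; rewrite uE; congr pair.
    by rewrite !vsum_cat /vsum !big_cons; congr (_ + _); rewrite addrCA.
have fw1 : full a (u ++ k :: j :: z) by exact: full_swap.
have pw1 : path_in T1 0 (u ++ k :: j :: z).
  apply: path_in_step; [exact: tiling_face tT1|exact: neq| |by rewrite add0r].
  exact: path_kept kept1.
have [T2 [fl2 tT2 kept2 sub2]] := IH _ _ T1 (ninv_lt _ _ _ _ jk erefl) tT1 fw1 pw1 sL.
exists T2; split=> //; first exact: flips_trans fl2.
- move=> c Tc rc; apply: kept2; first exact: kept1.
  by apply: right_of_step => //; exact: tiling_box tT _ Tc.
- move=> c [->|/sub2//]; apply: kept2 => //; exact: right_of_tile.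
Qed.

End Connectivity.

(** * The standard sweep and the theorem *)

Section Standard.
Variables (n : nat) (a : 'I_n -> nat).
Implicit Types (U V : 'rV[int]_n) (u w z : seq 'I_n).
Local Notation e := (@basis_vec n).
Local Notation interval := (interval_form (fun=> 0 : int) (fun i => (a i)%:Z)).

Lemma right_word_exists : exists w, full a w /\ sorted (@leo n) w.
Proof.
pose w0 := \big[cat/[::]]_(i : 'I_n) nseq (a i) i.
exists (sort (@leo n) w0); split; last by apply: sort_sorted => i j; exact: leq_total.
move=> i; rewrite count_sort (big_morph (count_mem i) (count_cat _) (erefl _)).
rewrite (bigD1 i) //= count_nseq /= eqxx mul1n big1 ?addn0 // => j ji.
by rewrite count_nseq /= (negbTE ji).
Qed.

Fixpoint path_interval V w : Prop :=
  interval V /\ (if w is j :: w' then path_interval (V + e j) w' else True).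

Lemma path_interval_cat V u z : path_interval V (u ++ z) <->
  path_interval V u /\ path_interval (V + vsum u) z.
Proof.
elim: u V => [|j u IH] V /=.
  rewrite /vsum big_nil addr0; split=> [|[]//]; by case: z => [|? ?] /= [].
by rewrite IH /vsum big_cons addrA; split=> [[? []]|[[? ?] ?]].
Qed.

(** In the increasing word a letter [l] occurs only once every smaller [k] is used up. *)
Lemma right_path_interval w : full a w -> sorted (@leo n) w -> path_interval 0 w.
Proof.
move=> fw sw.
have leoT : transitive (@leo n) by move=> x y t; exact: leq_trans.
have pre u z : w = u ++ z -> interval (vsum u).
  move=> wE i k l /andP[ik kl] _; rewrite !vsum_coord => lu.
  have {}lu : l \in u by rewrite -has_pred1 has_count; lia.
  have kz : k \notin z.
    apply/negP => kz; move: sw; rewrite wE (sorted_pairwise leoT) pairwise_cat.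
    by move=> /and3P[/allrelP/(_ l k lu kz)]; rewrite /leo leqNgt kl.
  by rewrite -(fw k) wE count_cat (count_memPn kz) addn0.
have main u z : w = u ++ z -> path_interval (vsum u) z.
  elim: z u => [|j z IH] u wE /=; split=> //; try exact: pre wE.
  by rewrite -vsum_rcons; apply: IH; rewrite cat_rcons.
by have := main [::] w erefl; rewrite /vsum big_nil.
Qed.

(* Always resolving the leftmost ascent keeps every vertex of interval form. *)
Lemma interval_sweep w : path_interval 0 w -> exists L, sweep w L /\
  forall c, L c -> forall U, face_of (vertex U) c -> interval U.
Proof.
have [N] := ubnP (ninv w); elim: N w => // N IH w; rewrite ltnS => leN pw.
case: (boolP (sorted (@geo n) w)) => [sw|]; first by exists set0; split=> //; constructor.
move=> /not_sorted_ascent[u [j [k [z [wE jk ju]]]]].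
have njk : j != k by rewrite -val_eqE /= ltn_eqF.
move: pw; rewrite wE => /path_interval_cat[pu]; rewrite add0r => -[iV [iVj pz]].
have iVjk : interval (vsum u + e j + e k) by case: z pz {wE} => [|? ?] [].
(* The support of the new vertex starts at [j] or later, so an inner coordinate [m] exceeds [j] and
   is the same at [vsum u + e j + e k], a vertex of the old path. *)
have iVk : interval (vsum u + e k).
  move=> i m l /andP[im ml] Vi Vl.
  have ji : (j <= i)%N.
    move: Vi; rewrite coord_addb vsum_coord; case: (eqVneq i k) => [-> _|_].
      exact: ltnW.
    by rewrite addr0 => Vi; apply: ju; rewrite -has_pred1 has_count; lia.
  have nmj : (m == j) = false by rewrite -val_eqE /= gtn_eqF // (leq_ltn_trans ji im).
  have := iVjk i m l; rewrite im ml !coord_addb nmj addr0; apply=> //.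
    by move: Vi; rewrite coord_addb; case: (i == j); lia.
  by move: Vl; rewrite coord_addb; case: (l == j); lia.
have [||L [sL iL]] := IH (u ++ k :: j :: z); first by rewrite -(ninv_swap _ _ jk) -wE.
  apply/path_interval_cat; split=> //; rewrite add0r /=; split=> //; split=> //.
  by rewrite addrAC.
exists ([set (vsum u, [set j; k]%SET)] `|` L); split; first by constructor.
move=> c [->|/iL//] U /(tile_vertexP njk)[->|->|->|->] //.
Qed.

End Standard.

Section Determined.
Variables (R : realType) (n : nat) (a : 'I_n -> nat) (theta : 'I_n -> R).
Variables C S : 'I_n -> R.
Local Notation cross := (vcross C S).
Hypothesis projE : forall p, Defs.proj theta p = (lin C p, lin S p).
Hypothesis S_gt0 : forall i, 0 < S i.
Hypothesis cross_gt0 : forall i j : 'I_n, (i < j)%N -> 0 < cross i j.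
Implicit Types (c d : cell n) (T L : set (cell n)) (w : seq 'I_n).
Local Notation interval := (interval_form (fun=> 0 : int) (fun i => (a i)%:Z)).

Lemma tiling_sweep T w : tiling a theta T -> full a w -> path_in T 0 w ->
  exists2 L, sweep w L & L `<=` T.
Proof.
move=> tT; have [N] := ubnP (ninv w); elim: N w => // N IH w; rewrite ltnS => leN fw pw.
case: (boolP (sorted (@geo n) w)) => [sw|nsw]; first by exists set0 => //; constructor.
have [u [j [k [z [wE jk Tt]]]]] := ascent_tile projE S_gt0 cross_gt0 tT fw pw nsw.
have njk : j != k by rewrite -val_eqE /= ltn_eqF.
have [|||L sL LT] := IH (u ++ k :: j :: z); first by rewrite -(ninv_swap _ _ jk) -wE.
- by apply: full_swap; rewrite -wE.
- by apply: path_in_step; [exact: tiling_face tT|exact: njk|rewrite -wE|rewrite add0r].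
exists ([set (vsum u, [set j; k]%SET)] `|` L); first by rewrite wE; constructor.
by move=> c [->|/LT].
Qed.

(** By [sweep_cover] the intersection of [T] and [T'] covers the zonogon. The center of a cell of
    [T] thus lifts to it, injectivity on [T] makes the lift the center itself, and its carrier is in
    [T']. Here [T'] may be any face-closed property of cells. *)
Lemma sweep_determines T T' w L : tiling a theta T -> full a w -> (0 < size w)%N ->
  sorted (@leo n) w -> sweep w L -> L `<=` T ->
  (forall c d, T' c -> face_of d c -> T' d) -> path_in T' 0 w -> L `<=` T' -> T `<=` T'.
Proof.
move=> tT fw w0 sw sL LT T'f pT' LT' c Tc.
have pT := right_path_in projE S_gt0 cross_gt0 tT fw sw.
pose D := T `&` T'.
have Df d d' : D d -> face_of d' d -> D d'.
  by move=> [Td T'd] d'd; split; [exact: (tiling_face tT Td d'd)|exact: T'f d'd].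
have pD V z : path_in T V z -> path_in T' V z -> path_in D V z.
  by elim: z V => //= j z IH V [? ?] [? ?]; split; [split|exact: IH].
have bc := in_box_points (tiling_box tT Tc) (center_points R c).
have [|q [[d [[Td T'd] qd]] qc]] := sweep_cover S_gt0 cross_gt0 sL fw w0 Df (pD _ _ pT pT') _ bc
  (box_le_right_path S_gt0 cross_gt0 fw w0 sw bc).
  by move=> d Ld; split; [exact: LT|exact: LT'].
have qE : q = center R c.
  apply: (tiling_inj projE tT) => //; first by exists d.
  by exists c; split=> //; exact: center_points.
rewrite -[c](center_carrier R) -qE; apply: T'f T'd _; exact: carrier_face.
Qed.

Lemma tilings_connected T T' : (0 < n)%N -> (forall i, (0 < a i)%N) ->
  tiling a theta T -> tiling a theta T' -> flips a theta T T'.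
Proof.
move=> n_gt0 a_gt0 tT tT'; have [w [fw sw]] := right_word_exists a.
have w0 : (0 < size w)%N.
  by apply: leq_trans (count_size (pred1 (Ordinal n_gt0)) w); rewrite fw.
have pT := right_path_in projE S_gt0 cross_gt0 tT fw sw.
have pT' := right_path_in projE S_gt0 cross_gt0 tT' fw sw.
have [L sL LT'] := tiling_sweep tT' fw pT'.
have [T1 [fl tT1 _ LT1]] := sweep_connect projE S_gt0 cross_gt0 tT fw pT sL.
have pT1 := right_path_in projE S_gt0 cross_gt0 tT1 fw sw.
have -> // : T' = T1; apply/seteqP; split.
- by apply: (sweep_determines tT' fw w0 sw sL) => //; exact: tiling_face tT1.
- by apply: (sweep_determines tT1 fw w0 sw sL) => //; exact: tiling_face tT'.
Qed.

Lemma interval_tiling T : (0 < n)%N -> (forall i, (0 < a i)%N) -> tiling a theta T ->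
  exists T1, flips a theta T T1 /\ forall K, T1 (vertex K) -> interval K.
Proof.
move=> n_gt0 a_gt0 tT; have [w [fw sw]] := right_word_exists a.
have w0 : (0 < size w)%N.
  by apply: leq_trans (count_size (pred1 (Ordinal n_gt0)) w); rewrite fw.
have pT := right_path_in projE S_gt0 cross_gt0 tT fw sw.
have iw := right_path_interval fw sw.
have [L [sL iL]] := interval_sweep iw.
have [T1 [fl tT1 _ LT1]] := sweep_connect projE S_gt0 cross_gt0 tT fw pT sL.
exists T1; split=> // K T1K.
(* This property of cells is closed under faces and holds on the right path and the swept tiles,
   hence on all of [T1]. *)
pose T' : set (cell n) := [set c | forall U, face_of (vertex U) c -> interval U].
suff : T' (vertex K) by apply; exact: face_of_refl.
apply: (sweep_determines tT1 fw w0 sw sL LT1) T1K => //.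
- by move=> c d T'c dc U Ud; apply: T'c; exact: face_of_trans dc.
- elim: w 0 iw {fw w0 pT sL sw} => //= j w IH V [iV iw]; split; last exact: IH.
  by move=> U /edge_vertexP[->|->] //; case: w iw {IH} => [|? ?] [].
Qed.

End Determined.

Theorem theorem2p2 (R : realType) (n : nat) (a : 'I_n -> nat)
    (theta : 'I_n -> R)
    (n_ge3 : (3 <= n)%N)
    (a_gt0 : forall i, (0 < a i)%N)
    (theta_bounds : forall i, 0 < theta i < pi)
    (theta_incr : forall i j : 'I_n, (i < j)%N -> theta i < theta j) :
  (forall T T' : set (cell n), tiling a theta T -> tiling a theta T' ->
     exists (m : nat) (s : nat -> set (cell n)),
       flip_sequence a theta T T' m s)
  /\
  (forall (F : realFieldType) (T T' : set (cell n)) (x : 'rV[int]_n -> F),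
     tiling a theta T -> tiling a theta T' ->
     (forall J, T (vertex J) -> 0 < x J) ->
     (forall (m : nat) (s : nat -> set (cell n)),
        flip_sequence a theta T T' m s ->
        exists xs : nat -> 'rV[int]_n -> F, values_along a m s x xs)
     /\
     (forall (m1 m2 : nat) (s1 s2 : nat -> set (cell n))
             (xs1 xs2 : nat -> 'rV[int]_n -> F),
        flip_sequence a theta T T' m1 s1 ->
        flip_sequence a theta T T' m2 s2 ->
        values_along a m1 s1 x xs1 ->
        values_along a m2 s2 x xs2 ->
        forall J, T' (vertex J) -> xs1 m1 J = xs2 m2 J)).
Proof.
have n_gt0 : (0 < n)%N by apply: leq_trans n_ge3.
have projE p : Defs.proj theta p = (lin (fun i => cos (theta i)) p, lin (fun i => sin (theta i)) p) by [].
have S_gt0 := sin_theta_gt0 theta_bounds.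
have cr_gt0 : forall i j : 'I_n, (i < j)%N ->
    0 < vcross (fun i => cos (theta i)) (fun i => sin (theta i)) i j.
  by move=> i j ij; exact: cross_theta_gt0.
split=> [T T' tT tT'|F T T' x tT tT' x_gt0]; first exact: tilings_connected projE S_gt0 cr_gt0 _ _ _ _ _ _.
split=> [m s [s0 sm ts fs]|].
  have [|xs [vx _]] := @values_along_exist F n a m s x fs; last by exists xs.
  by rewrite s0.
have [T1 [[m [s [s0 sm ts fs]]] iT1]] := interval_tiling projE S_gt0 cr_gt0 n_gt0 a_gt0 tT.
have [|xs [vx xs_gt0]] := @values_along_exist F n a m s x fs; first by rewrite s0.
(* The default 1 makes the data positive on the whole lattice, as [bkp_extension] requires. *)
pose x0 K := if `[< T1 (vertex K) >] then xs m K else 1.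
have [|X [X_gt0 X_bkp Xx0]] := @bkp_extension F n (fun=> 0) (fun i => (a i)%:Z) x0.
  by move=> K; rewrite /x0; case: asboolP => [TK|_]; [apply: xs_gt0; rewrite sm|exact: ltr01].
have tT1 : tiling a theta T1 by rewrite -sm; exact: ts.
(* Agreement with [X] is traced back from [T1] to [T]: the vertex created by a flip is never a
   vertex of the preceding tiling, so no value is lost. *)
have XT K : T (vertex K) -> x K = X K.
  rewrite -s0; apply: (values_along_solution_back X_gt0 X_bkp vx).
    move=> i im J j k l v w fl; apply: flip_in_new projE cr_gt0 _ _ _ _ _ _ _ _ fl _.
    exact/ts/ltnW.
  move=> K'; rewrite sm => T1K; rewrite Xx0; last exact: iT1.
    by rewrite /x0; case: asboolP.
  exact: in_box_vertex (tiling_box tT1 T1K) (face_of_refl _).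
move=> m1 m2 s1 s2 xs1 xs2 [s10 s1m _ _] [s20 s2m _ _] v1 v2 J TJ.
rewrite (values_along_solution X_gt0 X_bkp v1) ?s10 ?s1m //.
by rewrite (values_along_solution X_gt0 X_bkp v2) ?s20 ?s2m.
Qed.
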